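(* Let $\Lambda$ be the Auslander algebra of $K[x]/(x^n)$ and let $\Gamma$ be the preprojective algebra of Dynkin type $A_n$, regarded as a factor algebra of $\Lambda$. Then: (1) The map $-\otimes_\Lambda\Gamma:\mathrm{s}\tau\text{-}\mathrm{tilt}\,\Lambda\to\mathrm{s}\tau\text{-}\mathrm{tilt}\,\Gamma$ given by $U\mapsto U\otimes_\Lambda\Gamma$ is bijective. (2) The map in (1) is an isomorphism of posets with respect to the generation orders.
   Context: $K$ is an arbitrary field and $n\ge1$. The Auslander algebra $\Lambda$ of $K[x]/(x^n)$ is $\mathrm{End}_{K[x]/(x^n)}\big(\bigoplus_{i=1}^nK[x]/(x^i)\big)$. It is presented by the quiver with vertices $1,\ldots,n$, arrows $a_i:i\to i+1$ and $b_{i+1}:i+1\to i$ ($1\le i\le n-1$), and relations $a_1b_2=0$, $a_ib_{i+1}=b_ia_{i-1}$ for $2\le i\le n-1$, paths being composed from left to right. The preprojective algebra $\Gamma$ of type $A_n$ is presented by the same quiver with relations $a_1b_2=0$, $b_na_{n-1}=0$, $a_ib_{i+1}=b_ia_{i-1}$ for $2\le i\le n-1$; thus $\Gamma=\Lambda/L$ where $L$ is the ideal generated by $b_na_{n-1}$ (for $n=1$, $\Gamma=\Lambda=K$). Modules are finitely generated right modules. For a finite dimensional algebra $A$, $|N|$ is the number of non-isomorphic indecomposable summands of $N$ and $\tau$ is the Auslander–Reiten translation. $N$ is $\tau$-rigid if $\mathrm{Hom}_A(N,\tau N)=0$; $\tau$-tilting if moreover $|N|=|A|$; support $\tau$-tilting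 if there is an idempotent $e$ of $A$ such that $N$ is a $\tau$-tilting $A/(e)$-module. $\mathrm{s}\tau\text{-}\mathrm{tilt}\,A$ is the set of isomorphism classes of basic support $\tau$-tilting $A$-modules. Generation order: $T\le U$ iff $\mathrm{Fac}\,T\subseteq\mathrm{Fac}\,U$, where $\mathrm{Fac}\,X$ is the class of quotients of modules $X^m$, $m\ge0$. *)

(* Defs.v *)
From HB Require Import structures.
From mathcomp Require Import all_boot all_order all_algebra.

Set Implicit Arguments.
Unset Strict Implicit.
Unset Printing Implicit Defensive.

Import GRing.Theory.
Local Open Scope ring_scope.

Reserved Notation "x ** y" (at level 40, left associativity).

Lemma linfunE (R : nzRingType) (U V : vectType R) (f : U -> V) :
  linear f -> linfun f =1 f.
Proof.
move=> lf u.
pose F : {linear U -> V} := HB.pack f (GRing.isLinear.Build R U V *:%R f lf).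
by rewrite -[f]/(F : U -> V) lfunE.
Qed.

Lemma lin_sub (R : pzRingType) (U V : lmodType R) (f : U -> V) :
  linear f -> forall u v, f (u - v) = f u - f v.
Proof.
by move=> lf u v; rewrite addrC -scaleN1r lf scaleN1r addrC.
Qed.

Lemma lin0 (R : pzRingType) (U V : lmodType R) (f : U -> V) :
  linear f -> f 0 = 0.
Proof. by move=> lf; rewrite -(subrr 0) (lin_sub lf) subrr. Qed.

Lemma lin_scale (R : pzRingType) (U V : lmodType R) (f : U -> V) :
  linear f -> forall k u, f (k *: u) = k *: f u.
Proof. by move=> lf k u; rewrite -[k *: u]addr0 lf (lin0 lf) addr0. Qed.

Lemma lin_sum (R : pzRingType) (U V : lmodType R) (f : U -> V) :
  linear f -> forall (I : Type) (r : seq I) (P : pred I) (F : I -> U),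
  f (\sum_(i <- r | P i) F i) = \sum_(i <- r | P i) f (F i).
Proof.
move=> lf I r P F; apply: (big_morph f) => [u v|]; last exact: lin0.
by rewrite -[u]scale1r lf !scale1r.
Qed.

(* MathComp's [algType] imposes [1 != 0], but the factor algebra A/(e) vanishes
   for e = 1; hence algebras are bundled here, with 1 = 0 allowed. *)
Record algStruct (K : fieldType) (V : lmodType K) := AlgStruct {
  struct_mul : V -> V -> V;
  struct_one : V;
  struct_linl : forall y, linear (struct_mul^~ y);
  struct_linr : forall x, linear (struct_mul x);
  struct_mul1 : left_id struct_one struct_mul;
  struct_1mul : right_id struct_one struct_mul;
  struct_mulA : associative struct_mul
}.

Record algebra (K : fieldType) := Algebra {
  alg_car :> lmodType K;
  alg_struct : algStruct alg_car
}.

Record fdalgebra (K : fieldType) := FDAlgebra {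
  fdalg_car :> vectType K;
  fdalg_struct : algStruct fdalg_car
}.

Coercion alg_of_fdalg (K : fieldType) (A : fdalgebra K) : algebra K :=
  Algebra (fdalg_struct A).
Canonical alg_of_fdalg.

Definition amul (K : fieldType) (A : algebra K) : A -> A -> A :=
  struct_mul (alg_struct A).
Definition aone (K : fieldType) (A : algebra K) : A :=
  struct_one (alg_struct A).
Arguments aone {K} A.
Notation "x ** y" := (amul x y) : ring_scope.

Section AlgTheory.
Variables (K : fieldType) (A : algebra K).
Implicit Types x y z : A.

Lemma amul_linl y : linear (fun x => x ** y).
Proof. exact: struct_linl. Qed.
Lemma amul_linr x : linear (fun y => x ** y).
Proof. exact: struct_linr. Qed.
Lemma amul1l x : aone A ** x = x. Proof. exact: struct_mul1. Qed.
Lemma amul1r x : x ** aone A = x. Proof. exact: struct_1mul. Qed.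
Lemma amulA x y z : x ** (y ** z) = x ** y ** z.
Proof. exact: struct_mulA. Qed.

End AlgTheory.

Record algHom (K : fieldType) (A B : algebra K) := AlgHom {
  alghom_fun :> A -> B;
  alghom_lin : linear alghom_fun;
  alghom1 : alghom_fun (aone A) = aone B;
  alghomM : forall x y, alghom_fun (x ** y) = alghom_fun x ** alghom_fun y
}.

(* The carrier being a [vectType], modules over a finite dimensional algebra
   are automatically finitely generated. *)
Record rmodule (K : fieldType) (A : fdalgebra K) := RModule {
  rcar :> vectType K;
  ract : rcar -> A -> rcar;
  ract_linl : forall a, linear (ract^~ a);
  ract_linr : forall m, linear (ract m);
  ract1 : forall m, ract m (aone A) = m;
  ractM : forall m a b, ract m (a ** b) = ract (ract m a) b
}.

Record lmodule (K : fieldType) (A : fdalgebra K) := LModule {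
  lcar :> vectType K;
  lact : A -> lcar -> lcar;
  lact_linl : forall m, linear (lact^~ m);
  lact_linr : forall a, linear (lact a);
  lact1 : forall m, lact (aone A) m = m;
  lactM : forall a b m, lact (a ** b) m = lact a (lact b m)
}.

Section Homs.
Variables (K : fieldType) (A : fdalgebra K).
Implicit Types M N : rmodule A.

Definition is_rhom M N (f : 'Hom(M, N)) :=
  forall m a, f (ract m a) = ract (f m) a.

Definition is_lhom (M N : lmodule A) (f : 'Hom(M, N)) :=
  forall a m, f (lact a m) = lact a (f m).

Definition risom M N :=
  exists f : 'Hom(M, N), [/\ is_rhom f, lker f = 0%VS & limg f = fullv].

Definition zero_module M := \dim {: M} = 0%N.

Definition ract_lfun M a : 'End(M) := linfun (fun m : M => ract m a).

Lemma ract_lfunE M a m : ract_lfun M a m = ract m a.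
Proof. by rewrite linfunE //; apply: ract_linl. Qed.

Definition lact_lfun (M : lmodule A) a : 'End(M) := linfun (lact a : M -> M).

Lemma lact_lfunE (M : lmodule A) a m : lact_lfun M a m = lact a m.
Proof. by rewrite linfunE //; apply: lact_linr. Qed.

Definition rhom_defect M N (a : A) (f : 'Hom(M, N)) : 'Hom(M, N) :=
  (f \o ract_lfun M a)%VF - (ract_lfun N a \o f)%VF.

Definition rhoms M N : {vspace 'Hom(M, N)} :=
  (\bigcap_(i < \dim {: A}) lker (linfun (@rhom_defect M N (vbasis {: A})`_i)))%VS.

Lemma rhom_defectE M N a (f : 'Hom(M, N)) m :
  rhom_defect a f m = f (ract m a) - ract (f m) a.
Proof.
by rewrite /rhom_defect add_lfunE opp_lfunE !comp_lfunE !ract_lfunE.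
Qed.

Lemma rhom_defect_lin M N a : linear (@rhom_defect M N a).
Proof.
move=> k u v; apply/lfunP => m.
rewrite [RHS]add_lfunE [X in _ = X + _]scale_lfunE !rhom_defectE.
rewrite !add_lfunE !scale_lfunE.
by rewrite (ract_linl a) scalerBr opprD addrACA.
Qed.

Lemma rhomsP M N (f : 'Hom(M, N)) : reflect (is_rhom f) (f \in rhoms M N).
Proof.
apply: (iffP idP) => [fh m a|fh].
  have hb (i : 'I_(\dim {: A})) :
      f (ract m (vbasis {: A})`_i) = ract (f m) (vbasis {: A})`_i.
    have := subvP (bigcapv_inf i isT (subvv _)) f fh.
    rewrite memv_ker linfunE; last exact: rhom_defect_lin.
    move=> /eqP/lfunP/(_ m) /eqP.
    by rewrite rhom_defectE zero_lfunE subr_eq0 => /eqP.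
  have lm : linear (fun a => f (ract m a) - ract (f m) a).
    move=> k u v /=.
    by rewrite !ract_linr linearP scalerBr opprD addrACA.
  apply/eqP; rewrite -subr_eq0 -[_ - _](linfunE lm) (coord_vbasis (memvf a)).
  rewrite linear_sum big1 // => i _.
  by rewrite linearZ /= linfunE // hb // subrr scaler0.
rewrite memvE; apply/subv_bigcapP => i _; rewrite -memvE memv_ker.
rewrite linfunE; last exact: rhom_defect_lin.
apply/eqP/lfunP => m.
by rewrite rhom_defectE zero_lfunE fh subrr.
Qed.

Definition regular : rmodule A :=
  @RModule K A A (fun x a => x ** a) (@amul_linl K A) (@amul_linr K A)
    (@amul1r K A) (@amulA K A).

End Homs.
Arguments regular {K} A.
Arguments rhomsP {K A M N f}.

(* V/W is realised on the complement W^C, through the projection along W. *)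
Section QuotientSpace.
Variables (K : fieldType) (V : vectType K) (W : {vspace V}).

Definition quotv : vectType K := subvs_of (W^C)%VS.

Definition qproj (v : V) : quotv := vsproj (W^C)%VS (daddv_pi (W^C)%VS W v).

Lemma qproj_lin : linear qproj.
Proof. by move=> k u v; rewrite /qproj !linearP. Qed.

Lemma qprojK (x : quotv) : qproj (vsval x) = x.
Proof.
rewrite /qproj daddv_pi_id ?vsvalK ?subvsP //.
by rewrite capvC capv_compl.
Qed.

Lemma qproj_val (v : V) : v - vsval (qproj v) \in W.
Proof.
rewrite /qproj vsprojK ?memv_pi // -{1}(@daddv_pi_add _ _ (W^C)%VS W v).
- by rewrite addrAC subrr add0r memv_pi.
- by rewrite capvC capv_compl.
by rewrite addvC addv_complf memvf.
Qed.

Lemma qproj_eq0 (v : V) : (qproj v == 0) = (v \in W).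
Proof.
apply/eqP/idP => [v0|vW].
  by have := qproj_val v; rewrite v0 (linear0 vsval) subr0.
have : vsval (qproj v) \in (W :&: W^C)%VS.
  rewrite memv_cap subvsP andbT -[vsval _](subKr v) rpredB //.
  exact: qproj_val.
by rewrite capv_compl memv0 => /eqP v0; apply: val_inj.
Qed.

Lemma qproj_eq (u v : V) : u - v \in W -> qproj u = qproj v.
Proof.
rewrite -qproj_eq0 => /eqP uv; apply/eqP; rewrite -subr_eq0 -uv.
by have := qproj_lin (-1) v u; rewrite !scaleN1r => E; rewrite addrC -E addrC.
Qed.

End QuotientSpace.

Section QuotientAlgebra.
Variables (K : fieldType) (A : fdalgebra K).

Record ideal := Ideal {
  ideal_vs :> {vspace A};
  ideal_mull : forall a x : A, x \in ideal_vs -> a ** x \in ideal_vs;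
  ideal_mulr : forall a x : A, x \in ideal_vs -> x ** a \in ideal_vs
}.

Section Quot.
Variable I : ideal.
Implicit Types x y z : quotv I.

Let qmul x y : quotv I := qproj I ((vsval x : A) ** (vsval y : A)).

Lemma qproj_mul (a b : A) : qmul (qproj I a) (qproj I b) = qproj I (a ** b).
Proof.
apply: qproj_eq; rewrite -opprB memvN.
set a' : A := vsval _; set b' : A := vsval _.
have -> : a ** b - a' ** b' = (a - a') ** b + a' ** (b - b').
  have := amul_linl b (-1) a' a; have := amul_linr a' (-1) b' b.
  rewrite !scaleN1r ![- _ + _]addrC => -> ->.
  by rewrite addrA subrK.
by apply: rpredD; [apply: ideal_mulr|apply: ideal_mull]; apply: qproj_val.
Qed.

Fact quot_linl y : linear (qmul^~ y).
Proof.
move=> k x1 x2; rewrite /qmul linearP -qproj_lin. congr (qproj _ _). 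
exact: amul_linl.
Qed.
Fact quot_linr x : linear (qmul x).
Proof.
move=> k y1 y2; rewrite /qmul linearP -qproj_lin.
congr (qproj _ _). exact: amul_linr.
Qed.
Fact quot_mul1 : left_id (qproj I (aone A)) qmul.
Proof. by move=> x; rewrite -[x]qprojK qproj_mul amul1l. Qed.
Fact quot_1mul : right_id (qproj I (aone A)) qmul.
Proof. by move=> x; rewrite -[x]qprojK qproj_mul amul1r. Qed.
Fact quot_mulA : associative qmul.
Proof.
move=> x y z; rewrite -[x]qprojK -[y]qprojK -[z]qprojK.
by rewrite !qproj_mul amulA.
Qed.

Definition quot_alg : fdalgebra K :=
  FDAlgebra (AlgStruct quot_linl quot_linr quot_mul1 quot_1mul quot_mulA).

Definition quot_hom : algHom A quot_alg.
Proof.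
exists (qproj I : A -> quot_alg); first exact: qproj_lin.
  by [].
by move=> x y; rewrite -qproj_mul.
Defined.

End Quot.

Definition gen_ideal_vs (x : A) : {vspace A} :=
  (\sum_(i < \dim {: A}) \sum_(j < \dim {: A})
     <[(vbasis {: A})`_i ** x ** (vbasis {: A})`_j : A]>)%VS.

Lemma mem_gen_ideal (x a b : A) : a ** x ** b \in gen_ideal_vs x.
Proof.
pose e (i : 'I_(\dim {: A})) : A := (vbasis {: A})`_i.
have lb (c : A) : linear (fun b : A => c ** b) by exact: amul_linr.
have la (c : A) : linear (fun a : A => a ** x ** c).
  by move=> k u v; rewrite (amul_linl x) (amul_linl c).
rewrite -[_ ** b](linfunE (lb (a ** x))) (coord_vbasis (memvf b)) linear_sum.
apply: memv_suml => j _; rewrite linearZ /= rpredZ // linfunE //.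
rewrite -[_ ** _](linfunE (la _)) (coord_vbasis (memvf a)) linear_sum.
apply: memv_suml => i _; rewrite linearZ /= rpredZ // linfunE //.
rewrite memvE.
by apply: (sumv_sup i) => //; apply: (sumv_sup j) => //; apply: subvv.
Qed.

Lemma gen_ideal_ind (x : A) (U : {vspace A}) :
  (forall a b : A, a ** x ** b \in U) -> (gen_ideal_vs x <= U)%VS.
Proof.
move=> h; apply/subv_sumP => i _; apply/subv_sumP => j _.
by rewrite -memvE h.
Qed.

Fact gen_ideal_mull (x a y : A) :
  y \in gen_ideal_vs x -> a ** y \in gen_ideal_vs x.
Proof.
have la : linear (fun y : A => a ** y) by exact: amul_linr.
move=> yI; rewrite -[a ** y](linfunE la) memv_preim.
apply: (subvP _ _ yI); apply: gen_ideal_ind => b c.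
by rewrite -memv_preim linfunE // !amulA mem_gen_ideal.
Qed.

Fact gen_ideal_mulr (x a y : A) :
  y \in gen_ideal_vs x -> y ** a \in gen_ideal_vs x.
Proof.
have la : linear (fun y : A => y ** a) by exact: amul_linl.
move=> yI; rewrite -[y ** a](linfunE la) memv_preim.
apply: (subvP _ _ yI); apply: gen_ideal_ind => b c.
by rewrite -memv_preim linfunE // -amulA mem_gen_ideal.
Qed.

Definition gen_ideal (x : A) : ideal :=
  Ideal (@gen_ideal_mull x) (@gen_ideal_mulr x).

End QuotientAlgebra.

Section DffunVector.
Variables (K : fieldType) (n : nat) (V : 'I_n -> vectType K).
Local Notation VI := {dffun forall i : 'I_n, V i}.
Implicit Types f g : VI.

Let addf f g : VI := [ffun i => f i + g i].
Let oppf f : VI := [ffun i => - f i].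
Let zerof : VI := [ffun i => 0].
Let scalef (k : K) f : VI := [ffun i => k *: f i].

Fact dffun_addA : associative addf.
Proof. by move=> f g h; apply/ffunP => i; rewrite !ffunE addrA. Qed.
Fact dffun_addC : commutative addf.
Proof. by move=> f g; apply/ffunP => i; rewrite !ffunE addrC. Qed.
Fact dffun_add0 : left_id zerof addf.
Proof. by move=> f; apply/ffunP => i; rewrite !ffunE add0r. Qed.
Fact dffun_addN : left_inverse zerof oppf addf.
Proof. by move=> f; apply/ffunP => i; rewrite !ffunE addNr. Qed.

HB.instance Definition _ := GRing.isZmodule.Build VI
  dffun_addA dffun_addC dffun_add0 dffun_addN.

Fact dffun_scaleA (a b : K) f : scalef a (scalef b f) = scalef (a * b) f.
Proof. by apply/ffunP => i; rewrite !ffunE scalerA. Qed.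
Fact dffun_scale1 : left_id 1 scalef.
Proof. by move=> f; apply/ffunP => i; rewrite !ffunE scale1r. Qed.
Fact dffun_scaleDr : right_distributive scalef +%R.
Proof. by move=> a f g; apply/ffunP => i; rewrite !ffunE scalerDr. Qed.
Fact dffun_scaleDl f : {morph scalef^~ f : a b / a + b}.
Proof. by move=> a b; apply/ffunP => i; rewrite !ffunE scalerDl. Qed.

HB.instance Definition _ := GRing.Zmodule_isLmodule.Build K VI
  dffun_scaleA dffun_scale1 dffun_scaleDr dffun_scaleDl.

Lemma dffunD f g i : (f + g) i = f i + g i. Proof. exact: ffunE. Qed.
Lemma dffunZ k f i : (k *: f) i = k *: f i. Proof. exact: ffunE. Qed.

Import VectorInternalTheory.

Fact dffun_vect_iso : Vector.axiom (\sum_(i < n) dim (V i)) VI.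
Proof.
exists (fun f : VI => \mxrow_i v2r (f i)).
  move=> k f g; apply/mxrowP => i; rewrite mxrowK dffunD dffunZ linearP.
  apply/rowP => j; rewrite [RHS]mxE [RHS]mxE [X in _ = X + _]mxE.
  have E (h : VI) :
      (\mxrow_i v2r (h i)) 0 (tagnat.Rank i j) = v2r (h i) 0 j.
    by have /rowP/(_ j) := mxrowK (fun i => v2r (h i)) i; rewrite mxE.
  by rewrite !E !mxE.
exists (fun r => [ffun i => r2v (submxrow r i)] : VI).
  by move=> f; apply/ffunP => i; rewrite ffunE mxrowK v2rK.
by move=> r; apply/mxrowP => i; rewrite mxrowK ffunE r2vK.
Qed.

HB.instance Definition _ := Lmodule_hasFinDim.Build K VI dffun_vect_iso.

End DffunVector.

Section DirectSums.
Variables (K : fieldType) (A : fdalgebra K).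

Section Binary.
Variables M N : rmodule A.
Let act (x : M * N) (a : A) : M * N := (ract x.1 a, ract x.2 a).

Fact dsum2_linl a : linear (act^~ a).
Proof. by move=> k u v; congr pair; apply: (ract_linl a). Qed.
Fact dsum2_linr m : linear (act m).
Proof. by move=> k u v; congr pair; apply: ract_linr. Qed.
Fact dsum2_1 m : act m (aone A) = m.
Proof. by case: m => m1 m2; rewrite /act !ract1. Qed.
Fact dsum2M m a b : act m (a ** b) = act (act m a) b.
Proof. by rewrite /act !ractM. Qed.

Definition dsum2 : rmodule A := RModule dsum2_linl dsum2_linr dsum2_1 dsum2M.
End Binary.

Section Family.
Variables (n : nat) (M : 'I_n -> rmodule A).
Let V : vectType K := {dffun forall i, M i}.
Let act (x : V) (a : A) : V := [ffun i => ract (x i) a].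

Fact dsum_linl a : linear (act^~ a).
Proof.
move=> k u v; apply/ffunP => i; rewrite dffunD dffunZ !ffunE.
exact: (ract_linl a).
Qed.
Fact dsum_linr m : linear (act m).
Proof.
move=> k u v; apply/ffunP => i; rewrite dffunD dffunZ !ffunE.
exact: ract_linr.
Qed.
Fact dsum_1 m : act m (aone A) = m.
Proof. by apply/ffunP => i; rewrite ffunE ract1. Qed.
Fact dsumM m a b : act m (a ** b) = act (act m a) b.
Proof. by apply/ffunP => i; rewrite !ffunE ractM. Qed.

Definition dsum : rmodule A := RModule dsum_linl dsum_linr dsum_1 dsumM.
End Family.

Definition direct_summand (X M : rmodule A) :=
  exists Y : rmodule A, risom M (dsum2 X Y).

Definition indecomposable (M : rmodule A) :=
  ~ zero_module M /\
  forall X Y : rmodule A, risom M (dsum2 X Y) -> zero_module X \/ zero_module Y.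

(* |M| = k *)
Definition num_indec (M : rmodule A) (k : nat) :=
  exists S : 'I_k -> rmodule A,
  [/\ forall i, indecomposable (S i) /\ direct_summand (S i) M,
      forall i j, risom (S i) (S j) -> i = j
    & forall X, indecomposable X -> direct_summand X M ->
        exists i, risom X (S i)].

Definition basic (M : rmodule A) :=
  forall X, indecomposable X -> ~ direct_summand (dsum2 X X) M.

Definition Fac (M X : rmodule A) :=
  exists m, exists f : 'Hom(dsum (fun _ : 'I_m => M), X),
    is_rhom f /\ limg f = fullv.

Definition gen_le (T U : rmodule A) := forall X, Fac T X -> Fac U X.

End DirectSums.

Section Translation.
Variables (K : fieldType) (A : fdalgebra K).
Implicit Types M N P Q X : rmodule A.

Definition projective P :=
  forall M N (g : 'Hom(M, N)) (f : 'Hom(P, N)),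
    is_rhom g -> limg g = fullv -> is_rhom f ->
    exists2 h : 'Hom(P, M), is_rhom h & (g \o h)%VF = f.

(* p is a projective cover of its image: P is projective and p is an essential
   epimorphism onto limg p *)
Definition proj_cover_img P M (p : 'Hom(P, M)) :=
  [/\ projective P, is_rhom p
    & forall X (h : 'Hom(X, P)), is_rhom h -> limg (p \o h)%VF = limg p ->
        limg h = fullv].

Definition min_proj_presentation M P1 P0
    (d1 : 'Hom(P1, P0)) (d0 : 'Hom(P0, M)) :=
  [/\ proj_cover_img d0, proj_cover_img d1, limg d0 = fullv
    & limg d1 = lker d0].

(* Hom_A(P, A) as a left module *)
Section RegularDual.
Variable P : rmodule A.
Let V : vectType K := subvs_of (rhoms P (regular A)).

Let lmul (a : A) : 'End(A) := linfun (fun x : A => a ** x : A).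

Let lmulE a x : lmul a x = a ** x.
Proof. by rewrite linfunE //; apply: amul_linr. Qed.

Let act (a : A) (g : V) : V := vsproj _ (lmul a \o vsval g)%VF.

Fact reg_dual_actE a g p : vsval (act a g) p = a ** (vsval g p : A).
Proof.
rewrite /act vsprojK; first by rewrite comp_lfunE lmulE.
apply/rhomsP => m b; rewrite !comp_lfunE !lmulE.
by rewrite (rhomsP (subvsP g)) /= amulA.
Qed.

Fact reg_dual_linl g : linear (act^~ g).
Proof.
move=> k a b; apply/val_inj/lfunP => p.
rewrite reg_dual_actE linearP add_lfunE scale_lfunE !reg_dual_actE.
exact: amul_linl.
Qed.
Fact reg_dual_linr a : linear (act a).
Proof.
move=> k f g; apply/val_inj/lfunP => p.
rewrite reg_dual_actE !linearP !add_lfunE !scale_lfunE !reg_dual_actE.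
exact: amul_linr.
Qed.
Fact reg_dual1 g : act (aone A) g = g.
Proof. by apply/val_inj/lfunP => p; rewrite reg_dual_actE amul1l. Qed.
Fact reg_dualM a b g : act (a ** b) g = act a (act b g).
Proof. by apply/val_inj/lfunP => p; rewrite !reg_dual_actE amulA. Qed.

Definition reg_dual : lmodule A :=
  LModule reg_dual_linl reg_dual_linr reg_dual1 reg_dualM.
End RegularDual.

(* Hom_A(f, A), for f an A-linear map *)
Definition reg_dual_map P Q (f : 'Hom(P, Q)) : 'Hom(reg_dual Q, reg_dual P) :=
  linfun (fun g : reg_dual Q =>
    vsproj (rhoms P (regular A)) (vsval g \o f)%VF : reg_dual P).

Lemma reg_dual_mapE P Q (f : 'Hom(P, Q)) (g : reg_dual Q) : is_rhom f ->
  vsval (reg_dual_map f g) = (vsval g \o f)%VF.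
Proof.
move=> fh; rewrite linfunE => [|k u v]; last first.
  by rewrite -linearP; congr vsproj; rewrite linearP comp_lfunDl comp_lfunZl.
rewrite vsprojK //; apply/rhomsP => m a.
by rewrite !comp_lfunE fh (rhomsP (subvsP g)).
Qed.

(* D M = Hom_K(M, K) *)
Section Dual.
Variable M : lmodule A.
Let V : vectType K := 'Hom(M, K^o).
Let act (phi : V) (a : A) : V := (phi \o lact_lfun M a)%VF.

Fact dual_actE phi a m : act phi a m = phi (lact a m).
Proof. by rewrite comp_lfunE lact_lfunE. Qed.
Fact dual_linl a : linear (act^~ a).
Proof.
by move=> k u v; apply/lfunP => m;
   rewrite add_lfunE scale_lfunE !dual_actE add_lfunE scale_lfunE.
Qed.
Fact dual_linr phi : linear (act phi).
Proof.
move=> k a b; apply/lfunP => m; rewrite add_lfunE scale_lfunE !dual_actE.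
by rewrite lact_linl linearP.
Qed.
Fact dual1 phi : act phi (aone A) = phi.
Proof. by apply/lfunP => m; rewrite dual_actE lact1. Qed.
Fact dualM phi a b : act phi (a ** b) = act (act phi a) b.
Proof. by apply/lfunP => m; rewrite !dual_actE lactM. Qed.

Definition dual : rmodule A := RModule dual_linl dual_linr dual1 dualM.
End Dual.

(* T is the transpose of M: a cokernel of Hom_A(d1, A) for some minimal
   projective presentation of M *)
Definition is_transpose M (T : lmodule A) :=
  exists P1 P0 (d1 : 'Hom(P1, P0)) (d0 : 'Hom(P0, M)),
    min_proj_presentation d1 d0 /\
    exists q : 'Hom(reg_dual P1, T),
      [/\ is_lhom q, limg q = fullv & lker q = limg (reg_dual_map d1)].

Definition is_tau M X := exists2 T : lmodule A, is_transpose M T & risom X (dual T).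

(* is_tau M X determines X up to isomorphism *)
Definition tau_rigid M :=
  exists2 X, is_tau M X & forall f : 'Hom(M, X), is_rhom f -> f = 0.

Definition tau_tilting M :=
  tau_rigid M /\ exists k, num_indec M k /\ num_indec (regular A) k.

End Translation.

Section Restriction.
Variables (K : fieldType) (A B : fdalgebra K) (f : algHom A B) (M : rmodule B).
Let act (m : M) (a : A) : M := ract m (f a).

Fact restr_linl a : linear (act^~ a).
Proof. exact: ract_linl. Qed.
Fact restr_linr m : linear (act m).
Proof. by move=> k a b; rewrite /act alghom_lin ract_linr. Qed.
Fact restr1 m : act m (aone A) = m.
Proof. by rewrite /act alghom1 ract1. Qed.
Fact restrM m a b : act m (a ** b) = act (act m a) b.
Proof. by rewrite /act alghomM ractM. Qed.

Definition restriction : rmodule A :=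
  RModule restr_linl restr_linr restr1 restrM.
End Restriction.

Definition support_tau_tilting (K : fieldType) (A : fdalgebra K)
    (M : rmodule A) :=
  exists e : A, e ** e = e /\
  exists N : rmodule (quot_alg (gen_ideal e)),
    tau_tilting N /\ risom M (restriction (quot_hom (gen_ideal e)) N).

(* The members of the isomorphism classes forming s-tau-tilt A *)
Definition stau_tilt (K : fieldType) (A : fdalgebra K) (M : rmodule A) :=
  support_tau_tilting M /\ basic M.

Section QuotientModule.
Variables (K : fieldType) (A : fdalgebra K) (M : rmodule A) (W : {vspace M}).
Hypothesis subW : forall m a, m \in W -> ract m a \in W.
Let act (x : quotv W) (a : A) : quotv W := qproj W (ract (vsval x) a).

Fact qmod_actE m a : act (qproj W m) a = qproj W (ract m a).
Proof.
apply/esym/qproj_eq; rewrite -(lin_sub (ract_linl a)).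
exact/subW/qproj_val.
Qed.
Fact qmod_linl a : linear (act^~ a).
Proof.
by move=> k x y; rewrite /act linearP (ract_linl a) qproj_lin.
Qed.
Fact qmod_linr x : linear (act x).
Proof. by move=> k a b; rewrite /act ract_linr qproj_lin. Qed.
Fact qmod1 x : act x (aone A) = x.
Proof. by rewrite /act ract1 qprojK. Qed.
Fact qmodM x a b : act x (a ** b) = act (act x a) b.
Proof. by rewrite -[x]qprojK !qmod_actE ractM. Qed.

Definition quot_mod : rmodule A := RModule qmod_linl qmod_linr qmod1 qmodM.
End QuotientModule.

(* U (x)_A B for B viewed as an A-B-bimodule through f : A -> B, as the quotient
   of U (x)_K B by the balancing relations.  For a basis (u_i) of U, U (x)_K B
   is the direct sum of the u_i (x) B. *)
Section Tensor.
Variables (K : fieldType) (A B : fdalgebra K) (f : algHom A B).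
Variable U : rmodule A.

Let UB : rmodule B := dsum (fun _ : 'I_(\dim {: U}) => regular B).

Definition ktensor (u : U) (c : B) : UB :=
  [ffun i => coord (vbasis {: U}) i u *: c].

Lemma ktensor_linl c : linear (ktensor^~ c).
Proof.
move=> k u v; apply/ffunP => i.
by rewrite dffunD dffunZ !ffunE linearP scalerDl scalerA.
Qed.

Lemma ktensor_linr u : linear (ktensor u).
Proof.
move=> k c d; apply/ffunP => i; rewrite dffunD dffunZ !ffunE.
by rewrite scalerDr !scalerA mulrC.
Qed.

Lemma ktensorM u c d : ract (ktensor u c) d = ktensor u (c ** d).
Proof.
apply/ffunP => i; rewrite !ffunE /=.
by rewrite (lin_scale (amul_linl d)).
Qed.

Definition balancing (u : U) (a : A) (c : B) : UB :=
  ktensor (ract u a) c - ktensor u (f a ** c).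

Definition balancing_rels : {vspace UB} :=
  (\sum_(i < \dim {: U}) \sum_(j < \dim {: A}) \sum_(k < \dim {: B})
     <[balancing (vbasis {: U})`_i (vbasis {: A})`_j (vbasis {: B})`_k]>)%VS.

Lemma balancing_lin1 a c : linear (fun u => balancing u a c).
Proof.
move=> k u v; rewrite /balancing (ract_linl a) !ktensor_linl scalerBr.
by rewrite opprD addrACA.
Qed.
Lemma balancing_lin2 u c : linear (fun a => balancing u a c).
Proof.
move=> k a d; rewrite /balancing ract_linr (ktensor_linl c) alghom_lin.
by rewrite (amul_linl c) ktensor_linr scalerBr opprD addrACA.
Qed.
Lemma balancing_lin3 u a : linear (fun c => balancing u a c).
Proof.
move=> k c d; rewrite /balancing (amul_linr (f a)) !ktensor_linr scalerBr.
by rewrite opprD addrACA.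
Qed.

Lemma mem_balancing u a c : balancing u a c \in balancing_rels.
Proof.
rewrite -[balancing _ _ _](linfunE (balancing_lin1 a c)).
rewrite (coord_vbasis (memvf u)) linear_sum.
apply: memv_suml => i _; rewrite linearZ /= rpredZ //.
rewrite (linfunE (balancing_lin1 a c)).
rewrite -[balancing _ _ _](linfunE (balancing_lin2 _ c)).
rewrite (coord_vbasis (memvf a)) linear_sum.
apply: memv_suml => j _; rewrite linearZ /= rpredZ //.
rewrite (linfunE (balancing_lin2 _ c)).
rewrite -[balancing _ _ _](linfunE (balancing_lin3 _ _)).
rewrite (coord_vbasis (memvf c)) linear_sum.
apply: memv_suml => l _; rewrite linearZ /= rpredZ //.
rewrite (linfunE (balancing_lin3 _ _)) memvE.
apply: (sumv_sup i) => //; apply: (sumv_sup j) => //.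
by apply: (sumv_sup l) => //; apply: subvv.
Qed.

Fact balancing_rels_sub (w : UB) d :
  w \in balancing_rels -> ract w d \in balancing_rels.
Proof.
move=> wW; rewrite -ract_lfunE memv_preim; apply: (subvP _ _ wW).
apply/subv_sumP => i _; apply/subv_sumP => j _; apply/subv_sumP => l _.
rewrite -memvE -memv_preim ract_lfunE (lin_sub (ract_linl d)) !ktensorM -amulA.
exact: mem_balancing.
Qed.

Definition tensor : rmodule B := quot_mod balancing_rels_sub.

Definition tens (u : U) (c : B) : tensor := qproj balancing_rels (ktensor u c).

Lemma tens_linl c : linear (tens^~ c).
Proof. by move=> k u v; rewrite /tens ktensor_linl qproj_lin. Qed.
Lemma tens_linr u : linear (tens u).
Proof. by move=> k c d; rewrite /tens ktensor_linr qproj_lin. Qed.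
Lemma tens_balanced u a c : tens (ract u a) c = tens u (f a ** c).
Proof. exact/qproj_eq/mem_balancing. Qed.
Lemma tensM u c d : ract (tens u c) d = tens u (c ** d).
Proof. by rewrite /tens /= (qmod_actE balancing_rels_sub) ktensorM. Qed.

Lemma tensor_universal (V : vectType K) (beta : U -> B -> V) :
  (forall c, linear (beta^~ c)) -> (forall u, linear (beta u)) ->
  (forall u a c, beta (ract u a) c = beta u (f a ** c)) ->
  exists! h : 'Hom(tensor, V), forall u c, h (tens u c) = beta u c.
Proof.
move=> bl br bb.
pose g (w : UB) : V := \sum_(i < \dim {: U}) beta (vbasis {: U})`_i (w i).
have gl : linear g.
  move=> k x y; rewrite /g scaler_sumr -big_split; apply: eq_bigr => i _.
  by rewrite dffunD dffunZ br.
have gE u c : g (ktensor u c) = beta u c.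
  rewrite -[beta u c](linfunE (bl c)) {2}(coord_vbasis (memvf u)) linear_sum.
  apply: eq_bigr => i _; rewrite ffunE linearZ /= (linfunE (bl c)).
  by rewrite -!(linfunE (br _)) linearZ.
have g0 w : w \in balancing_rels -> g w = 0.
  move=> wW; apply/eqP; rewrite -(linfunE gl) -memv_ker; apply: (subvP _ _ wW).
  apply/subv_sumP => i _; apply/subv_sumP => j _; apply/subv_sumP => l _.
  by rewrite -memvE memv_ker (linfunE gl) (lin_sub gl) !gE bb subrr.
have hl : linear (fun x : tensor => g (vsval x)).
  by move=> k x y; rewrite linearP gl.
exists (linfun (fun x : tensor => g (vsval x))); split.
  move=> u c; rewrite (linfunE hl) -gE; apply/eqP; rewrite eq_sym -subr_eq0.
  by rewrite -(lin_sub gl) g0 // qproj_val.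
move=> h hE; apply/lfunP => x; rewrite (linfunE hl) -{2}[x]qprojK.
have -> : vsval x = \sum_(i < \dim {: U}) ktensor (vbasis {: U})`_i ((vsval x : UB) i) :> UB.
  apply/ffunP => i; rewrite (big_morph (fun w : UB => w i)
    (id1 := 0) (op1 := +%R)) => [|? ?|]; [|exact: dffunD|exact: ffunE].
  rewrite (bigD1 i) //= ffunE coord_free ?(basis_free (vbasisP _)) // eqxx.
  rewrite scale1r big1 ?addr0 // => j ji; rewrite ffunE coord_free.
    by rewrite (negbTE ji) scale0r.
  exact: (basis_free (vbasisP _)).
rewrite (lin_sum gl) (lin_sum (@qproj_lin _ _ balancing_rels)) linear_sum.
by apply: eq_bigr => i _; rewrite gE -hE.
Qed.

End Tensor.

Section EndAlgebra.
Variables (K : fieldType) (A : fdalgebra K) (M : rmodule A).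
Let V : vectType K := subvs_of (rhoms M M).
Implicit Types f g h : V.

Let emul f g : V := vsproj (rhoms M M) (vsval f \o vsval g)%VF.
Let eone : V := vsproj (rhoms M M) \1%VF.

Fact end_mulE f g : vsval (emul f g) = (vsval f \o vsval g)%VF.
Proof.
rewrite vsprojK //; apply/rhomsP => m a.
by rewrite !comp_lfunE (rhomsP (subvsP g)) (rhomsP (subvsP f)).
Qed.
Fact end_oneE : vsval eone = \1%VF.
Proof. by rewrite vsprojK //; apply/rhomsP => m a; rewrite !id_lfunE. Qed.

Let subvsP_lin k f g : vsval (k *: f + g) = k *: vsval f + vsval g.
Proof. exact: linearP. Qed.

Fact end_linl g : linear (emul^~ g).
Proof.
move=> k f1 f2; apply: val_inj; rewrite /= end_mulE !subvsP_lin !end_mulE.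
by rewrite comp_lfunDl comp_lfunZl.
Qed.
Fact end_linr f : linear (emul f).
Proof.
move=> k f1 f2; apply: val_inj; rewrite /= end_mulE !subvsP_lin !end_mulE.
by rewrite comp_lfunDr comp_lfunZr.
Qed.
Fact end_mul1 : left_id eone emul.
Proof.
by move=> f; apply: val_inj; rewrite /= end_mulE end_oneE comp_lfun1l.
Qed.
Fact end_1mul : right_id eone emul.
Proof.
by move=> f; apply: val_inj; rewrite /= end_mulE end_oneE comp_lfun1r.
Qed.
Fact end_mulA : associative emul.
Proof. by move=> f g h; apply: val_inj; rewrite /= !end_mulE comp_lfunA. Qed.

Definition end_alg : fdalgebra K :=
  FDAlgebra (AlgStruct end_linl end_linr end_mul1 end_1mul end_mulA).

Lemma end_algM (f g : end_alg) :
  vsval (f ** g : end_alg) = (vsval (f : V) \o vsval (g : V))%VF.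
Proof. exact: end_mulE. Qed.

Lemma end_alg1 : vsval (aone end_alg : V) = \1%VF.
Proof. exact: end_oneE. Qed.

End EndAlgebra.

Section Auslander.
Variables (K : fieldType) (n : nat).

(* K[x]/(x^n); the library's convention makes {poly %/ 'X^0} equal to
   K[x]/(x), so this is only meant for n > 0 *)
Definition trunc_alg : fdalgebra K :=
  @FDAlgebra K {poly %/ ('X^n : {poly K})}
    (@AlgStruct K {poly %/ ('X^n : {poly K})} *%R 1
      (fun y k u v => etrans (mulrDl _ _ _) (congr1 (+%R^~ _) (esym (scalerAl _ _ _))))
      (fun x k u v => etrans (mulrDr _ _ _) (congr1 (+%R^~ _) (esym (scalerAr _ _ _))))
      (@mul1r _) (@mulr1 _) (@mulrA _)).

(* K[x]/(x^(i+1)), through the canonical surjection from K[x]/(x^n) *)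
Section TruncModule.
Variable i : 'I_n.
Let V : vectType K := {poly %/ ('X^(i.+1) : {poly K})}.
Let red (p : trunc_alg) : {poly %/ ('X^(i.+1) : {poly K})} :=
  in_qpoly 'X^(i.+1) (p : {poly K}).

Lemma in_qpoly_trunc (p : {poly K}) :
  in_qpoly 'X^(i.+1) (in_qpoly 'X^n p : {poly K}) =
  in_qpoly 'X^(i.+1) p :> {poly %/ ('X^(i.+1) : {poly K})}.
Proof.
have mn : mk_monic ('X^n : {poly K}) = 'X^n.
  by rewrite mk_monic_Xn prednK // (leq_ltn_trans _ (ltn_ord i)).
rewrite {2}(Pdiv.RingMonic.rdivp_eq (monic_mk_monic ('X^n : {poly K})) p).
rewrite linearD /= rmorphM /= mn.
have -> : in_qpoly 'X^(i.+1) ('X^n : {poly K}) = 0.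
  have En : 'X^n = 'X^(n - i.+1) * 'X^(i.+1) :> {poly K}.
    by rewrite -exprD subnK.
  apply: val_inj; rewrite /= mk_monic_Xn /= En.
  by rewrite Pdiv.RingMonic.rmodp_mull // monicXn.
by rewrite mulr0 add0r.
Qed.

Let act (m : V) (p : trunc_alg) : V := m * red p.

Fact trunc_linl p : linear (act^~ p).
Proof. by move=> k u v; rewrite /act mulrDl scalerAl. Qed.
Fact trunc_linr m : linear (act m).
Proof. by move=> k p q; rewrite /act /red /= linearP mulrDr scalerAr. Qed.
Fact trunc1 m : act m (aone trunc_alg) = m.
Proof. by rewrite /act /red /= in_qpoly1 mulr1. Qed.
Fact truncM m p q : act m (p ** q) = act (act m p) q.
Proof.
rewrite /act -mulrA -[X in _ = _ * X](in_qpolyM _ (p : {poly K}) q).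
by rewrite -in_qpoly_trunc.
Qed.

Definition trunc_mod : rmodule trunc_alg :=
  RModule trunc_linl trunc_linr trunc1 truncM.

End TruncModule.

Definition trunc_sum : rmodule trunc_alg := dsum trunc_mod.

Definition auslander_alg : fdalgebra K := end_alg trunc_sum.

(* Multiplication by q from the summand K[x]/(x^i) to the summand K[x]/(x^j),
   1 <= i, j <= n; it is well defined if x^j divides x^i q *)
Definition trunc_mul (i j : nat) (q : {poly K}) : 'End(trunc_sum) :=
  linfun (fun x : trunc_sum => [ffun k : 'I_n =>
    if k.+1 == j then
      \sum_(l < n | l.+1 == i) in_qpoly 'X^(k.+1) (q * (x l : {poly _}))
    else 0] : trunc_sum).

Definition trunc_elt i j q : auslander_alg := vsproj _ (trunc_mul i j q).

(* Since f ** g = f \o g, the elements of e_i Lambda e_j are the maps from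
   K[x]/(x^j) to K[x]/(x^i); hence a_i : i -> i+1 is the surjection from
   K[x]/(x^(i+1)) to K[x]/(x^i), and b_(i+1) : i+1 -> i is the inclusion of
   K[x]/(x^i) into K[x]/(x^(i+1)). *)
Definition aus_e (i : nat) := trunc_elt i i 1.
Definition aus_a (i : nat) := trunc_elt i.+1 i 1.
Definition aus_b (i : nat) := trunc_elt i.-1 i 'X.

End Auslander.

(* Vertices 1, ..., n and arrows a_i : i -> i+1 and b_(i+1) : i+1 -> i for
   1 <= i < n; other values of e, a and b are irrelevant. *)
Section Quiver.
Variables (K : fieldType) (n : nat).

Definition quiver_rel (B : algebra K) (e a b : nat -> B) :=
  [/\ forall i j, (1 <= i <= n)%N -> (1 <= j <= n)%N ->
        e i ** e j = if i == j then e i else 0,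
      \sum_(1 <= i < n.+1) e i = aone B,
      forall i, (1 <= i < n)%N -> e i ** a i ** e i.+1 = a i
    & forall i, (1 <= i < n)%N -> e i.+1 ** b i.+1 ** e i = b i.+1].

Definition auslander_rel (B : algebra K) (e a b : nat -> B) :=
  [/\ quiver_rel e a b,
      (1 < n)%N -> a 1%N ** b 2%N = 0
    & forall i, (2 <= i < n)%N -> a i ** b i.+1 = b i ** a i.-1].

Definition preprojective_rel (B : algebra K) (e a b : nat -> B) :=
  auslander_rel e a b /\ ((1 < n)%N -> b n ** a n.-1 = 0).

Definition maps_gens (A B : algebra K) (f : A -> B)
    (e a b : nat -> A) (e' a' b' : nat -> B) :=
  [/\ forall i, (1 <= i <= n)%N -> f (e i) = e' i,
      forall i, (1 <= i < n)%N -> f (a i) = a' i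
    & forall i, (1 <= i < n)%N -> f (b i.+1) = b' i.+1].

(* A is the path algebra of the quiver modulo the relations in [rel], e, a, b
   being the classes of the vertices and arrows: this is the universal property
   of path algebras with relations *)
Definition presented_by
    (rel : forall B : algebra K, (nat -> B) -> (nat -> B) -> (nat -> B) -> Prop)
    (A : algebra K) (e a b : nat -> A) :=
  rel A e a b /\
  forall (B : algebra K) (e' a' b' : nat -> B), rel B e' a' b' ->
    exists f : algHom A B, maps_gens f e a b e' a' b' /\
      forall g : algHom A B, maps_gens g e a b e' a' b' -> g =1 f.

Definition is_preprojective (A : algebra K) (e a b : nat -> A) :=
  presented_by preprojective_rel e a b.

End Quiver.

Section AuslanderRelations.
Variables (K : fieldType) (n : nat).
Local Notation M := (trunc_sum K n).
Implicit Types (q r : {poly K}) (x : M).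

Definition trunc_wd (i j : nat) q := 'X^j %| q * 'X^i.

Lemma in_qpolyXn_eq0 m q : 'X^(m.+1) %| q -> in_qpoly 'X^(m.+1) q = 0.
Proof.
move=> /dvdpP[r ->]; apply: val_inj.
by rewrite /= mk_monic_Xn /= Pdiv.RingMonic.rmodp_mull // monicXn.
Qed.

Lemma in_qpoly_wd i j q r : trunc_wd i.+1 j.+1 q ->
  in_qpoly 'X^(j.+1) (q * (in_qpoly 'X^(i.+1) r : {poly K})) =
  in_qpoly 'X^(j.+1) (q * r).
Proof.
move=> wd.
have E : r = Pdiv.CommonRing.rdivp r 'X^(i.+1) * 'X^(i.+1)
    + (in_qpoly 'X^(i.+1) r : {poly K}).
  by rewrite /= mk_monic_Xn /= -Pdiv.RingMonic.rdivp_eq ?monicXn.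
rewrite [in RHS]E mulrDr [RHS]linearD /= mulrCA.
rewrite [X in _ = X + _]in_qpolyXn_eq0 ?add0r //.
exact: dvdp_mull.
Qed.

Lemma trunc_mul_lin i j q :
  linear (fun x : M => [ffun k : 'I_n =>
    if k.+1 == j then
      \sum_(l < n | l.+1 == i) in_qpoly 'X^(k.+1) (q * (x l : {poly K}))
    else 0] : M).
Proof.
move=> c x y; apply/ffunP => k; rewrite dffunD dffunZ !ffunE.
case: ifP => _; last by rewrite scaler0 addr0.
rewrite scaler_sumr -big_split; apply: eq_bigr => l _ /=.
by rewrite dffunD dffunZ /= mulrDr -scalerAr linearP.
Qed.

Lemma trunc_mulE i j q x k :
  trunc_mul n i j q x k = if k.+1 == j then
      \sum_(l < n | l.+1 == i) in_qpoly 'X^(k.+1) (q * (x l : {poly K}))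
    else 0.
Proof. by rewrite (linfunE (@trunc_mul_lin i j q)) ffunE. Qed.

Lemma trunc_mul_hom i j q : trunc_wd i j q -> is_rhom (trunc_mul n i j q).
Proof.
move=> wd x p; apply/ffunP => k; rewrite trunc_mulE ffunE trunc_mulE.
case: ifP => [/eqP jk|_]; last by rewrite (lin0 (ract_linl p)).
subst j; rewrite (lin_sum (ract_linl p)); apply: eq_bigr => l /eqP il; subst i.
rewrite ffunE [in RHS]/= -in_qpolyM.
transitivity (in_qpoly 'X^(k.+1)
    (q * ((x l : {poly K}) * (in_qpoly 'X^(l.+1) (p : {poly K}) : {poly K})))).
  exact: in_qpoly_wd.
rewrite mulrA in_qpoly_wd //.
by rewrite /trunc_wd mulrAC; apply: dvdp_mulr.
Qed.

Lemma trunc_eltE i j q : trunc_wd i j q ->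
  vsval (trunc_elt n i j q) = trunc_mul n i j q.
Proof. by move=> wd; apply/vsprojK/rhomsP/trunc_mul_hom. Qed.

Lemma trunc_elt_mul i j k q r : (0 < j <= n)%N ->
  trunc_wd i j q -> trunc_wd j k r ->
  trunc_elt n j k r ** trunc_elt n i j q = trunc_elt n i k (r * q).
Proof.
move=> /andP[j0 jn] wq wr.
have wrq : trunc_wd i k (r * q).
  rewrite /trunc_wd -mulrA; apply: dvdp_trans wr _.
  exact: dvdp_mul.
apply: val_inj; apply: (etrans (end_algM _ _)).
rewrite !trunc_eltE // [RHS](trunc_eltE wrq); apply/lfunP => x.
apply/ffunP => m; rewrite comp_lfunE !trunc_mulE.
case: ifP => // /eqP km; subst k; case: j j0 jn wq wr => // j _ jn wq wr.
rewrite (bigD1 (Ordinal jn)) //= big1 ?addr0 => [|l /andP[/eqP[lj] /eqP[]]];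
  last by apply: val_inj; rewrite /= lj.
rewrite trunc_mulE /= eqxx poly_of_qpoly_sum mulr_sumr linear_sum.
by apply: eq_bigr => l _; apply: (etrans (in_qpoly_wd _ wr)); rewrite mulrA.
Qed.

Lemma trunc_elt_mul0 i j j' k q r : j != j' ->
  trunc_wd i j q -> trunc_wd j' k r ->
  trunc_elt n j' k r ** trunc_elt n i j q = 0.
Proof.
move=> jj' wq wr; apply: val_inj; apply: (etrans (end_algM _ _)).
rewrite !trunc_eltE //; apply/lfunP => x.
rewrite [RHS](_ : _ = 0 :> M); last exact: zero_lfunE.
apply/ffunP => m; rewrite comp_lfunE !trunc_mulE [RHS]ffunE.
case: ifP => // /eqP km; subst k; apply: big1 => l /eqP lj'.
by rewrite trunc_mulE lj' eq_sym (negbTE jj') mulr0 linear0.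
Qed.

Lemma trunc_wd1 i j : (j <= i)%N -> trunc_wd i j 1.
Proof. by move=> ji; rewrite /trunc_wd mul1r dvdp_exp2l. Qed.

Lemma trunc_wdX i : trunc_wd i i.+1 'X.
Proof. by rewrite /trunc_wd exprS. Qed.

Lemma aus_sum_e :
  \sum_(1 <= i < n.+1) aus_e K n i = aone (auslander_alg K n).
Proof.
apply: val_inj; apply: (etrans _ (esym (end_alg1 _))).
rewrite -[LHS]/(vsval _) linear_sum; apply/lfunP => x.
rewrite sum_lfunE id_lfunE; apply/ffunP => k.
rewrite (big_morph (fun w : M => w k) (id1 := 0) (op1 := +%R))
  => [|? ?|]; [|exact: dffunD|exact: ffunE].
rewrite big_add1 big_mkord (bigD1 k) //= [X in _ + X]big1 => [|i ik].
  rewrite addr0 trunc_eltE ?trunc_wd1 // trunc_mulE eqxx (bigD1 k) //=.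
  rewrite mul1r big1 ?addr0 => [|l /andP[/eqP[lk] /eqP[]]];
    last exact: val_inj.
  apply: val_inj; rewrite /= Pdiv.CommonRing.rmodp_small //.
  exact: size_mk_monic.
rewrite trunc_eltE ?trunc_wd1 // trunc_mulE eqSS.
by rewrite eq_sym [_ == _](negbTE ik).
Qed.

Lemma aus_rel : auslander_rel n (aus_e K n) (aus_a K n) (aus_b K n).
Proof.
split; first split.
- move=> i j hi _; case: eqVneq => [<-|ij].
    by rewrite /aus_e trunc_elt_mul ?mul1r ?trunc_wd1.
  by rewrite /aus_e trunc_elt_mul0 ?trunc_wd1 // eq_sym.
- exact: aus_sum_e.
- move=> i /andP[i0 ni]; rewrite /aus_e /aus_a.
  rewrite !trunc_elt_mul ?mulr1 ?trunc_wd1 ?i0 //=; exact: ltnW.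
- move=> i /andP[i0 ni]; rewrite /aus_e /aus_b.
  rewrite !trunc_elt_mul ?mulr1 ?mul1r ?trunc_wd1 ?trunc_wdX ?i0 //=.
  exact: ltnW.
- move=> n1; rewrite /aus_a /aus_b trunc_elt_mul ?trunc_wd1 ?trunc_wdX //.
  have wd : trunc_wd 1 1 (1 * 'X : {poly K}).
    by rewrite mul1r /trunc_wd dvdp_mull.
  apply: val_inj; rewrite [LHS](trunc_eltE wd); apply/lfunP => x.
  rewrite [RHS](_ : _ = 0 :> M); last exact: zero_lfunE.
  apply/ffunP => k; rewrite trunc_mulE [RHS]ffunE; case: eqP => // -[k0].
  by rewrite big1 // => l _; rewrite k0 mul1r in_qpolyXn_eq0 // dvdp_mulr.
move=> [|i] //= /andP[i0 ni]; rewrite /aus_a /aus_b /=.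
rewrite !trunc_elt_mul ?mulr1 ?mul1r ?trunc_wd1 ?trunc_wdX //.
by apply/andP; split=> //; apply: ltnW (ltnW ni).
Qed.

End AuslanderRelations.

(* F induces a bijection from the isomorphism classes of modules satisfying P to
   those of modules satisfying Q *)
Definition bij_on_classes (K : fieldType) (A B : fdalgebra K)
    (P : rmodule A -> Prop) (Q : rmodule B -> Prop)
    (F : rmodule A -> rmodule B) :=
  [/\ forall U, P U -> Q (F U),
      forall U V, P U -> P V -> risom U V <-> risom (F U) (F V)
    & forall T, Q T -> exists2 U, P U & risom (F U) T].

(* Main.v *)
(* Multiplication by x is a central nilpotent element c of Lambda, and
   b_n a_(n-1) = c e_n, so that ker (Lambda -> Gamma) is contained in c Lambda.
   It therefore suffices to compare both algebras with their common factor
   algebra Lambda/(c), which is done by Nakayama-type arguments: M is tau-rigid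
   if and only if Ext^1(M, Fac M) = 0, and for such an M a map M -> N/Nc lifts to
   N whenever N/Nc is in Fac M, the kernel Nc being filtered by quotients of N/Nc.
   Hence M is determined by M/Mc, the order is reflected, and by Fitting's lemma
   the summands of M/Mc lift to summands of M, so that |M| = |M/Mc|; the same
   applies to the projective modules Lambda/(e) of Lambda/(e). Conversely a
   tau-rigid Lambda/(c)-module is lifted by lifting a minimal projective
   presentation arbitrarily; rigidity of the lift again follows by successive
   approximation modulo powers of c. *)
Require Import Defs.
From HB Require Import structures.
From mathcomp Require Import all_boot all_order all_algebra.
From Stdlib Require Import Classical.

Set Implicit Arguments.
Unset Strict Implicit.
Unset Printing Implicit Defensive.

Import GRing.Theory.
Local Open Scope ring_scope.

Reserved Notation "M ~> N" (at level 90, no associativity).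

(** The kernel of [pi] is in general smaller than the ideal (c), so Gamma is not itself a reduction
    by a central element and the Nakayama arguments do not apply to U -> U (x) Gamma. They apply to
    U -> U/Uc and to U (x) Gamma -> U/Uc, and every property is carried down along the one and up
    along the other. To have one set of lemmas for both algebras and for their factors by
    idempotents, a module over a factor algebra is kept as a module over the larger algebra killed
    by a set S, and rigidity is stated relative to S: S empty means over Lambda, S = ker [pi] means
    over Gamma. The translate tau does not pass to factor algebras, which is why it is replaced at
    once by an Ext-vanishing that mentions only modules killed by S. *)

Definition surj (T S : Type) (f : T -> S) := forall y, exists x, f x = y.

Lemma surj_comp (T S R : Type) (f : T -> S) (g : S -> R) :
  surj f -> surj g -> surj (g \o f).
Proof.
by move=> sf sg z; have [y <-] := sg z; have [x <-] := sf y; exists x.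
Qed.

Lemma limg_surj (K : fieldType) (U V : vectType K) (f : 'Hom(U, V)) :
  limg f = fullv <-> surj f.
Proof.
split=> [fE y|sf].
  have /memv_imgP[x _ ->] : y \in limg f by rewrite fE memvf.
  by exists x.
apply/eqP; rewrite eqEsubv subvf /=; apply/subvP => y _.
by have [x <-] := sf y; rewrite memv_img ?memvf.
Qed.

Lemma mem_limgP (K : fieldType) (U V : vectType K) (f : 'Hom(U, V)) y :
  y \in limg f <-> exists x, f x = y.
Proof.
split=> [/memv_imgP[x _ ->]|[x <-]]; first by exists x.
by rewrite memv_img ?memvf.
Qed.

Lemma lker_inj (K : fieldType) (U V : vectType K) (f : 'Hom(U, V)) :
  lker f = 0%VS <-> injective f.
Proof.
split=> [/eqP/lker0P//|fI]; exact/eqP/lker0P.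
Qed.

(** * Homomorphisms of modules *)

Section ModuleHoms.
Variables (K : fieldType) (A : fdalgebra K).

Record hom (M N : rmodule A) :=
  Hom { hom_lfun :> 'Hom(M, N); homP : is_rhom hom_lfun }.
Local Notation "M ~> N" := (hom M N) : type_scope.
Implicit Types M N P Q X Y Z : rmodule A.

Lemma homD M N (f : M ~> N) u v : f (u + v) = f u + f v.
Proof. exact: linearD. Qed.
Lemma homB M N (f : M ~> N) u v : f (u - v) = f u - f v.
Proof. exact: linearB. Qed.
Lemma homN M N (f : M ~> N) u : f (- u) = - f u.
Proof. exact: linearN. Qed.
Lemma hom0 M N (f : M ~> N) : f 0 = 0.
Proof. exact: linear0. Qed.
Lemma hom_sum M N (f : M ~> N) (I : Type) (r : seq I) (P : pred I) (F : I -> M) :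
  f (\sum_(i <- r | P i) F i) = \sum_(i <- r | P i) f (F i).
Proof. exact: linear_sum. Qed.

Lemma ractD M (a : A) : {morph (fun m : M => ract m a) : u v / u + v}.
Proof. by move=> u v; have := ract_linl a 1 u v; rewrite !scale1r. Qed.
Lemma ractB M (a : A) : {morph (fun m : M => ract m a) : u v / u - v}.
Proof. exact: (lin_sub (ract_linl a)). Qed.
Lemma ract0 M (a : A) : ract (0 : M) a = 0.
Proof. exact: (lin0 (ract_linl a)). Qed.
Lemma ractBr M (m : M) : {morph (ract m) : a b / a - b}.
Proof. exact: (lin_sub (ract_linr m)). Qed.
Lemma ractr0 M (m : M) : ract m 0 = 0.
Proof. exact: (lin0 (ract_linr m)). Qed.
Lemma ractZr M (m : M) k a : ract m (k *: a) = k *: ract m a.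
Proof. exact: (lin_scale (ract_linr m)). Qed.

Lemma mkhom M N (F : M -> N) : linear F ->
  (forall m a, F (ract m a) = ract (F m) a) ->
  exists f : M ~> N, forall m, f m = F m.
Proof.
move=> lF FA; have h : is_rhom (linfun F) by move=> m a; rewrite !linfunE.
by exists (Hom h) => m; rewrite /= linfunE.
Qed.

Lemma id_rhom M : is_rhom (\1%VF : 'Hom(M, M)).
Proof. by move=> m a; rewrite !id_lfunE. Qed.
Definition hid M : M ~> M := Hom (@id_rhom M).

Lemma comp_rhom M N P (g : N ~> P) (f : M ~> N) : is_rhom (g \o f)%VF.
Proof. by move=> m a; rewrite !comp_lfunE !homP. Qed.
Definition hcomp M N P (g : N ~> P) (f : M ~> N) : M ~> P :=
  Hom (comp_rhom g f).

Lemma zero_rhom M N : is_rhom (0 : 'Hom(M, N)).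
Proof. by move=> m a; rewrite !zero_lfunE ract0. Qed.
Definition hzero M N : M ~> N := Hom (@zero_rhom M N).

Lemma add_rhom M N (f g : M ~> N) : is_rhom (hom_lfun f + hom_lfun g).
Proof. by move=> m a; rewrite !add_lfunE !homP ractD. Qed.
Definition hadd M N (f g : M ~> N) : M ~> N := Hom (add_rhom f g).

Lemma sub_rhom M N (f g : M ~> N) : is_rhom (hom_lfun f - hom_lfun g).
Proof. by move=> m a; rewrite !add_lfunE !opp_lfunE !homP ractB. Qed.
Definition hsub M N (f g : M ~> N) : M ~> N := Hom (sub_rhom f g).

Lemma hidE M m : hid M m = m. Proof. exact: id_lfunE. Qed.
Lemma hcompE M N P (g : N ~> P) (f : M ~> N) m : hcomp g f m = g (f m).
Proof. exact: comp_lfunE. Qed.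
Lemma hzeroE M N m : hzero M N m = 0. Proof. exact: zero_lfunE. Qed.
Lemma haddE M N (f g : M ~> N) m : hadd f g m = f m + g m.
Proof. exact: add_lfunE. Qed.
Lemma hsubE M N (f g : M ~> N) m : hsub f g m = f m - g m.
Proof. by rewrite /= add_lfunE opp_lfunE. Qed.
Definition homE := (hidE, hcompE, hzeroE, haddE, hsubE).

Definition hpow M (f : M ~> M) k : M ~> M := iter k (hcomp f) (hid M).
Lemma hpowE M (f : M ~> M) k m : hpow f k m = iter k f m.
Proof. by elim: k => [|k IH] /=; rewrite homE // IH. Qed.

Definition iso M N := exists (f : M ~> N) (g : N ~> M),
  (forall m, g (f m) = m) /\ (forall n, f (g n) = n).

Lemma bij_iso M N (f : M ~> N) : injective f -> surj f ->
  exists g : N ~> M, (forall m, g (f m) = m) /\ (forall n, f (g n) = n).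
Proof.
move=> fI fS; have k0 : lker f == 0%VS by apply/eqP/lker_inj.
have fg n : f ((f^-1)%VF n) = n.
  by have [m <-] := fS n; rewrite -[X in f X]comp_lfunE lker0_compVf // id_lfunE.
have gh : is_rhom (f^-1)%VF by move=> n a; apply: fI; rewrite homP !fg.
by exists (Hom gh); split=> // m; apply: fI; rewrite fg.
Qed.

Lemma risomP M N : risom M N <-> iso M N.
Proof.
split=> [[f [fh /lker_inj fI /limg_surj fS]]|[f [g [gf fg]]]].
  by have [g gP] := @bij_iso _ _ (Hom fh) fI fS; exists (Hom fh), g.
exists f; split; first exact: homP.
  by apply/lker_inj/(can_inj gf).
by apply/limg_surj => n; exists (g n).
Qed.

Lemma iso_refl M : iso M M.
Proof. by exists (hid M), (hid M); split=> m; rewrite !homE. Qed.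
Lemma iso_sym M N : iso M N -> iso N M.
Proof. by move=> [f [g [gf fg]]]; exists g, f. Qed.
Lemma iso_trans M N P : iso M N -> iso N P -> iso M P.
Proof.
move=> [f [g [gf fg]]] [f' [g' [gf' fg']]].
by exists (hcomp f' f), (hcomp g g'); split=> m; rewrite !homE (gf', fg) (gf, fg').
Qed.

Lemma fac_epi M Q X (q : M ~> Q) (h : M ~> X) : surj q ->
  (forall m, q m = 0 -> h m = 0) -> exists h' : Q ~> X, forall m, h' (q m) = h m.
Proof.
move=> qS qh; have fq : limg q = fullv by apply/limg_surj.
have qK y : q ((q^-1)%VF y) = y.
  by rewrite limg_lfunVK // fq memvf.
have qh' m m' : q m = q m' -> h m = h m'.
  move=> E; apply/eqP; rewrite -subr_eq0 -homB; apply/eqP/qh.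
  by rewrite homB E subrr.
(* The section [q^-1] is only K-linear; h after it is A-linear because h takes the same value on all
   preimages of an element. *)
have gh : is_rhom (h \o q^-1)%VF.
  by move=> y a; rewrite !comp_lfunE -homP; apply: qh'; rewrite homP !qK.
by exists (Hom gh) => m; rewrite comp_lfunE; apply: qh'; rewrite qK.
Qed.

Lemma fac_mono I M X (i : I ~> M) (h : X ~> M) : injective i ->
  (forall x, exists y, i y = h x) -> exists h' : X ~> I, forall x, i (h' x) = h x.
Proof.
move=> iI hi; have iK x : i ((i^-1)%VF (h x)) = h x.
  by have [y <-] := hi x; rewrite limg_lfunVK // memv_img ?memvf.
have gh : is_rhom (i^-1 \o h)%VF.
  by move=> y a; rewrite !comp_lfunE; apply: iI; rewrite [RHS]homP !iK homP.
by exists (Hom gh) => m; rewrite comp_lfunE iK.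
Qed.

(** * Kernels, cokernels, images and preimages *)

Section Submodule.
Variables (M : rmodule A) (W : {vspace M}).
Hypothesis subW : forall m a, m \in W -> ract m a \in W.
Let act (x : subvs_of W) (a : A) : subvs_of W := vsproj W (ract (vsval x) a).
Let actE x a : vsval (act x a) = ract (vsval x) a.
Proof. by rewrite vsprojK // subW // subvsP. Qed.
Let vsval_lin k (x y : subvs_of W) : vsval (k *: x + y) = k *: vsval x + vsval y.
Proof. exact: linearP. Qed.
Fact smod_linl a : linear (act^~ a).
Proof.
move=> k x y; apply: val_inj; rewrite [LHS]actE vsval_lin [RHS]vsval_lin !actE.
exact: (ract_linl a).
Qed.
Fact smod_linr x : linear (act x).
Proof. by move=> k a b; apply: val_inj; rewrite [LHS]actE [RHS]vsval_lin !actE ract_linr. Qed.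
Fact smod1 x : act x (aone A) = x.
Proof. by apply: val_inj; rewrite [LHS]actE ract1. Qed.
Fact smodM x a b : act x (a ** b) = act (act x a) b.
Proof. by apply: val_inj; rewrite [LHS]actE [RHS]actE actE ractM. Qed.
Definition sub_mod : rmodule A := RModule smod_linl smod_linr smod1 smodM.

Lemma sub_modP : exists I (i : I ~> M),
  injective i /\ forall m, m \in W <-> exists x, i x = m.
Proof.
have [|x a|i iE] := @mkhom sub_mod M vsval.
- exact: linearP.
- exact: actE.
exists sub_mod, i; split=> [x y|m].
  by rewrite !iE; apply: val_inj.
by split=> [mW|[x <-]]; [exists (vsproj W m); rewrite iE vsprojK | rewrite iE subvsP].
Qed.

Lemma quot_modP : exists Q (q : M ~> Q),
  surj q /\ forall m, q m = 0 <-> m \in W.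
Proof.
have [|x a|q qE] := @mkhom M (quot_mod subW) (qproj W).
- exact: qproj_lin.
- by rewrite /= (qmod_actE subW).
exists (quot_mod subW), q; split=> [y|m].
  by exists (vsval y); rewrite qE qprojK.
by rewrite qE -qproj_eq0; split=> /eqP.
Qed.
End Submodule.

Lemma ker_mod M N (f : M ~> N) : exists I (i : I ~> M),
  injective i /\ forall m, f m = 0 <-> exists x, i x = m.
Proof.
have [|I [i [iI iP]]] := @sub_modP M (lker f).
  by move=> m a; rewrite !memv_ker homP => /eqP ->; rewrite ract0.
by exists I, i; split=> // m; rewrite -iP memv_ker; split=> /eqP.
Qed.

Lemma coker_mod M N (f : M ~> N) : exists Q (q : N ~> Q),
  surj q /\ forall n, q n = 0 <-> exists m, f m = n.
Proof.
have [|Q [q [qI qP]]] := @quot_modP N (limg f).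
  by move=> _ a /mem_limgP[m <-]; rewrite -homP memv_img ?memvf.
by exists Q, q; split=> // m; rewrite qP; apply: mem_limgP.
Qed.

Lemma img_mod M N (f : M ~> N) : exists I (q : M ~> I) (i : I ~> N),
  [/\ surj q, injective i & forall m, i (q m) = f m].
Proof.
have [|I [i [iI iP]]] := @sub_modP N (limg f).
  by move=> _ a /mem_limgP[m <-]; rewrite -homP memv_img ?memvf.
have [|q qE] := @fac_mono _ _ _ i f iI.
  by move=> m; apply/iP; rewrite memv_img ?memvf.
exists I, q, i; split=> // x.
have /mem_limgP[m fm] : i x \in limg f by apply/iP; exists x.
by exists m; apply: iI; rewrite qE.
Qed.

Lemma preim_mod M N N' (f : M ~> N) (j : N' ~> N) : exists I (i : I ~> M),
  injective i /\ forall m, (exists y, j y = f m) <-> exists x, i x = m.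
Proof.
have [Q [q [_ qP]]] := coker_mod j.
have [I [i [iI iP]]] := ker_mod (hcomp q f).
by exists I, i; split=> // m; rewrite -iP homE -qP.
Qed.

(** Inclusions and projections instead of an isomorphism with [dsum2]: equations between maps
    survive reduction and restriction. The vanishing of q i and p j follows from the three
    equations, see [split_dsum0]. *)
Definition split_dsum M X Y :=
  exists (i : X ~> M) (p : M ~> X) (j : Y ~> M) (q : M ~> Y),
  [/\ forall x, p (i x) = x, forall y, q (j y) = y
    & forall m, m = i (p m) + j (q m)].

Lemma split_dsum0 M X Y (i : X ~> M) (p : M ~> X) (j : Y ~> M) (q : M ~> Y) :
  (forall x, p (i x) = x) -> (forall y, q (j y) = y) ->
  (forall m, m = i (p m) + j (q m)) ->
  (forall x, q (i x) = 0) /\ (forall y, p (j y) = 0).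
Proof.
move=> pi qj ij; split=> [x|y].
  have := ij (i x); rewrite pi => /eqP; rewrite -{1}[i x]addr0 (inj_eq (addrI _)).
  by move=> /eqP/(congr1 q); rewrite qj hom0.
have := ij (j y); rewrite qj => /eqP; rewrite -{1}[j y]add0r (inj_eq (addIr _)).
by move=> /eqP/(congr1 p); rewrite pi hom0.
Qed.

Lemma split_dsum_sym M X Y : split_dsum M X Y -> split_dsum M Y X.
Proof.
move=> [i [p [j [q [pi qj ij]]]]]; exists j, q, i, p; split=> // m.
by rewrite addrC -ij.
Qed.

Lemma split_dsum_dsum2 X Y : split_dsum (dsum2 X Y) X Y.
Proof.
have [||i iE] := @mkhom X (dsum2 X Y) (fun x => (x, 0)).
- by move=> k u v; congr pair => //=; rewrite scaler0 addr0.
- by move=> m a; congr pair => //=; rewrite ract0.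
have [||j jE] := @mkhom Y (dsum2 X Y) (fun x => (0, x)).
- by move=> k u v; congr pair => //=; rewrite scaler0 addr0.
- by move=> m a; congr pair => //=; rewrite ract0.
have [||p pE] := @mkhom (dsum2 X Y) X (fun x => x.1); [by [] | by [] |].
have [||q qE] := @mkhom (dsum2 X Y) Y (fun x => x.2); [by [] | by [] |].
exists i, p, j, q; split=> [x|y|m]; rewrite ?(iE, pE, jE, qE) //.
by case: m => x y; congr pair; rewrite ?addr0 ?add0r.
Qed.

Lemma split_dsum_iso M N X Y : iso M N -> split_dsum M X Y -> split_dsum N X Y.
Proof.
move=> [f [g [gf fg]]] [i [p [j [q [pi qj ij]]]]].
exists (hcomp f i), (hcomp p g), (hcomp f j), (hcomp q g).
split=> m; rewrite !homE; [by rewrite gf pi | by rewrite gf qj |].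
by rewrite -homD -ij fg.
Qed.

Lemma split_dsum_unique M N X X' Y Y' : split_dsum M X Y -> split_dsum N X' Y' ->
  iso X X' -> iso Y Y' -> iso M N.
Proof.
move=> [i [p [j [q [pi qj ij]]]]] [i' [p' [j' [q' [pi' qj' ij']]]]].
have [qi pj] := split_dsum0 pi qj ij; have [qi' pj'] := split_dsum0 pi' qj' ij'.
move=> [f [g [gf fg]]] [f' [g' [gf' fg']]].
exists (hadd (hcomp i' (hcomp f p)) (hcomp j' (hcomp f' q))).
exists (hadd (hcomp i (hcomp g p')) (hcomp j (hcomp g' q'))).
by split=> m; rewrite !homE !homD ?pi ?qi ?pj ?qj ?pi' ?qi' ?pj' ?qj'
  !hom0 ?addr0 ?add0r (gf, fg) (gf', fg') -?ij -?ij'.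
Qed.

Lemma split_dsumP M X Y : risom M (dsum2 X Y) <-> split_dsum M X Y.
Proof.
split=> [/risomP/iso_sym h|h]; first exact/(split_dsum_iso h)/split_dsum_dsum2.
by apply/risomP/(split_dsum_unique h (split_dsum_dsum2 X Y)); apply: iso_refl.
Qed.

Definition retract X M := exists (i : X ~> M) (p : M ~> X), forall x, p (i x) = x.

Lemma retract_split X M (i : X ~> M) (p : M ~> X) : (forall x, p (i x) = x) ->
  exists Y (j : Y ~> M) (q : M ~> Y),
    (forall y, q (j y) = y) /\ (forall m, m = i (p m) + j (q m)).
Proof.
move=> pi; have [Y [j [jI jP]]] := ker_mod p.
have [|q qE] := @fac_mono _ _ _ j (hsub (hid M) (hcomp i p)) jI.
  by move=> m; apply/jP; rewrite !homE homB pi subrr.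
exists Y, j, q; split=> [y|m].
  apply: jI; rewrite qE !homE.
  by have /jP -> : exists x, j x = j y by [exists y]; rewrite hom0 subr0.
by rewrite qE !homE addrC subrK.
Qed.

Lemma summandP X M : direct_summand X M <-> retract X M.
Proof.
split=> [[Y /split_dsumP[i [p [j [q [pi _ _]]]]]]|[i [p pi]]]; first by exists i, p.
have [Y [j [q [qj ij]]]] := retract_split pi.
by exists Y; apply/split_dsumP; exists i, p, j, q.
Qed.

Lemma retract_trans X Y Z : retract X Y -> retract Y Z -> retract X Z.
Proof.
move=> [i [p pi]] [i' [p' pi']]; exists (hcomp i' i), (hcomp p p') => x.
by rewrite !homE pi' pi.
Qed.

Lemma iso_retract X Y : iso X Y -> retract X Y.
Proof. by move=> [f [g [gf fg]]]; exists f, g. Qed.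

Lemma zero_modP M : zero_module M <-> forall m : M, m = 0.
Proof.
rewrite /zero_module; split=> [/eqP|h].
  by rewrite dimv_eq0 => /eqP E m; apply/eqP; rewrite -memv0 -E memvf.
apply/eqP; rewrite dimv_eq0 -subv0; apply/subvP => m _.
by rewrite [m]h mem0v.
Qed.

Lemma indecP M : indecomposable M <->
  ~ zero_module M /\ forall X Y, split_dsum M X Y -> zero_module X \/ zero_module Y.
Proof.
split=> -[nz h]; split=> // X Y; first by move=> /split_dsumP/h.
by move=> /split_dsumP/h.
Qed.

Lemma indec_iso M N : iso M N -> indecomposable M -> indecomposable N.
Proof.
move=> iMN /indecP[nz h]; apply/indecP; split=> [/zero_modP z|X Y s].
  apply: nz; apply/zero_modP => m; have [f [g [gf _]]] := iMN.
  by rewrite -(gf m) (z (f m)) hom0.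
exact/h/(split_dsum_iso (iso_sym iMN)).
Qed.

Section DsumHoms.
Variables (n : nat) (F : 'I_n -> rmodule A).

Lemma dsum_sumE (I : Type) (r : seq I) (Q : pred I) (G : I -> dsum F) i :
  (\sum_(j <- r | Q j) G j) i = \sum_(j <- r | Q j) G j i.
Proof.
by apply: (big_morph (fun w : dsum F => w i)) => [u v|];
  [exact: dffunD | exact: ffunE].
Qed.

Lemma dsum_proj i : exists p : dsum F ~> F i, forall v, p v = v i.
Proof.
by apply: mkhom => [k u v|m a]; rewrite ?dffunD ?dffunZ ?ffunE.
Qed.

Lemma dsum_out X (f : forall i, F i ~> X) :
  exists u : dsum F ~> X, forall v, u v = \sum_i f i (v i).
Proof.
apply: mkhom => [k u v|m a].
  rewrite scaler_sumr -big_split; apply: eq_bigr => i _ /=.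
  by rewrite dffunD dffunZ linearP.
have -> : ract (\sum_i f i (m i)) a = \sum_i ract (f i (m i)) a.
  exact: (lin_sum (ract_linl a)).
by apply: eq_bigr => i _; rewrite ffunE homP.
Qed.

Lemma dsum_in X (f : forall i, X ~> F i) :
  exists u : X ~> dsum F, forall x i, u x i = f i x.
Proof.
have [||u uE] := @mkhom X (dsum F) (fun x => [ffun i => f i x]).
- by move=> k u v; apply/ffunP => i; rewrite dffunD dffunZ !ffunE linearP.
- by move=> m a; apply/ffunP => i; rewrite !ffunE homP.
by exists u => x i; rewrite uE ffunE.
Qed.

End DsumHoms.

Lemma dsum_hom_sum n M X (u : dsum (fun _ : 'I_n => M) ~> X) :
  exists f : 'I_n -> M ~> X, forall v, u v = \sum_i f i (v i).
Proof.
have inj (i : 'I_n) : exists e : M ~> dsum (fun _ : 'I_n => M),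
    forall m j, e m j = if j == i then m else 0.
  have [e eE] := @dsum_in n (fun=> M) M (fun j => if j == i then hid M else hzero M M).
  by exists e => m j; rewrite eE; case: ifP; rewrite homE.
have [e eE] := fin_all_exists inj.
exists (fun i => hcomp u (e i)) => v; under eq_bigr do rewrite homE.
rewrite -hom_sum; congr (u _); apply/ffunP => j.
rewrite dsum_sumE (bigD1 j) //= eE eqxx big1 ?addr0 // => i ij.
by rewrite eE eq_sym (negbTE ij).
Qed.

End ModuleHoms.
Notation "M ~> N" := (hom M N) : type_scope.

(** * Vanishing of extensions and largest killed quotients *)

Section Span.
Variables (K : fieldType) (A : fdalgebra K).
Implicit Types M N P Q X Y Z : rmodule A.

(** An inductive predicate, so that lifts and corrections can be built one summand at a time. It
    serves both for Fac M ([gen], with all maps) and for the kernel condition in [extfree]. *)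
Inductive span M Y (Q : M ~> Y -> Prop) : Y -> Prop :=
| span0 : span Q 0
| span_cons f m y : Q f -> span Q y -> span Q (f m + y).

Lemma span_one M Y (Q : M ~> Y -> Prop) f m : Q f -> span Q (f m).
Proof. by move=> Qf; rewrite -[f m]addr0; apply: span_cons => //; apply: span0. Qed.

Lemma spanD M Y (Q : M ~> Y -> Prop) y z : span Q y -> span Q z -> span Q (y + z).
Proof.
move=> sy sz; elim: sy => [|f m x Qf _ IH]; first by rewrite add0r.
by rewrite -addrA; apply: span_cons.
Qed.

Lemma span_sum M Y (Q : M ~> Y -> Prop) (I : Type) (r : seq I) (F : I -> Y) :
  (forall i, span Q (F i)) -> span Q (\sum_(i <- r) F i).
Proof.
move=> h; elim: r => [|i r IH]; first by rewrite big_nil; apply: span0.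
by rewrite big_cons; apply: spanD.
Qed.

Lemma span_map M N Y Z (Q : M ~> Y -> Prop) (R : N ~> Z -> Prop) (h : Y ~> Z) y :
  (forall f, Q f -> forall m, span R (h (f m))) -> span Q y -> span R (h y).
Proof.
move=> QR; elim=> [|f m x Qf _ IH]; first by rewrite hom0; apply: span0.
by rewrite homD; apply: spanD => //; apply: QR.
Qed.

Definition gen M Y := forall y : Y, span (fun _ : M ~> Y => True) y.

Lemma gen_surj M Y (f : M ~> Y) : surj f -> gen M Y.
Proof. by move=> fS y; have [m <-] := fS y; apply: span_one. Qed.

Lemma gen_trans M N Y : gen M N -> gen N Y -> gen M Y.
Proof.
move=> MN NY y; elim: (NY y) => [|f n x _ _ IH]; first exact: span0.
apply: spanD => //; apply: span_map (MN n) => g _ m.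
by rewrite -hcompE; apply: span_one.
Qed.

(** [Fac] asks for one epimorphism from a power of M, whereas [span] lets the maps vary with y. For
    finitely many y, in [FacP] a basis, the families are concatenated and the coefficients padded by
    zeros. *)
Lemma span_fam M Y (s : seq Y) : (forall y, y \in s -> span (fun _ : M ~> Y => True) y) ->
  exists n (F : 'I_n -> M ~> Y), forall y, y \in s ->
    exists v : 'I_n -> M, y = \sum_i F i (v i).
Proof.
have cat n1 n2 (F1 : 'I_n1 -> M ~> Y) (F2 : 'I_n2 -> M ~> Y) :
    exists F : 'I_(n1 + n2) -> M ~> Y,
      forall v1 v2, exists v : 'I_(n1 + n2) -> M,
      \sum_i F i (v i) = \sum_i F1 i (v1 i) + \sum_i F2 i (v2 i).
  exists (fun i => match split i with inl j => F1 j | inr j => F2 j end) => v1 v2.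
  exists (fun i => match split i with inl j => v1 j | inr j => v2 j end).
  rewrite big_split_ord; congr (_ + _); apply: eq_bigr => i _.
    by rewrite -[lshift n2 i]/(unsplit (inl i)) unsplitK.
  by rewrite -[rshift n1 i]/(unsplit (inr i)) unsplitK.
have one y : span (fun _ : M ~> Y => True) y -> exists n (F : 'I_n -> M ~> Y) v,
    y = \sum_i F i (v i).
  elim=> [|f m x _ _ [n [F [v ->]]]].
    by exists 0%N, (fun=> hzero M Y), (fun=> 0); rewrite big_ord0.
  have [G GP] := cat 1%N n (fun=> f) F; have [w wP] := GP (fun=> m) v.
  by exists (1 + n)%N, G, w; rewrite wP big_ord1.
elim: s => [_|y s IH ys]; first by exists 0%N, (fun=> hzero M Y).
have [n1 [F1 [v1 y1]]] := one y (ys y (mem_head _ _)).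
have [z zs|n2 [F2 F2P]] := IH; first by apply: ys; rewrite inE zs orbT.
have [G GP] := cat _ _ F1 F2; exists (n1 + n2)%N, G => z; rewrite inE.
case/predU1P=> [->|/F2P[v2 ->]].
  have [v vP] := GP v1 (fun=> 0); exists v; rewrite vP [X in _ + X]big1 ?addr0 // => i _.
  by rewrite hom0.
have [v vP] := GP (fun=> 0) v2; exists v; rewrite vP [X in X + _]big1 ?add0r // => i _.
by rewrite hom0.
Qed.

Lemma FacP M X : Fac M X <-> gen M X.
Proof.
split=> [[m [f [fh /limg_surj fS]]] x|h].
  have [F FE] := dsum_hom_sum (Hom fh); have [v <-] := fS x.
  by rewrite -[f v]/(Hom fh v) FE; apply: span_sum => i; apply: span_one.
have [y _|n [F FP]] := @span_fam M X (vbasis {: X}); first exact: h.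
have [u uE] := dsum_out F; exists n, u; split; first exact: homP.
apply/eqP; rewrite eqEsubv subvf /= -(span_basis (vbasisP {: X})).
apply/span_subvP => y /FP[v ->]; apply/mem_limgP.
by exists [ffun i => v i]; rewrite uE; apply: eq_bigr => i _; rewrite ffunE.
Qed.

Lemma gen_leP M N : gen_le M N <-> gen N M.
Proof.
split=> [h|NM X /FacP MX].
  by apply/FacP/h/FacP/(@gen_surj _ _ (hid M)) => m; exists m; rewrite homE.
by apply/FacP/(gen_trans NM MX).
Qed.

Definition killed (S : A -> Prop) M := forall a, S a -> forall m : M, ract m a = 0.

Lemma killed_surj S M N (f : M ~> N) : surj f -> killed S M -> killed S N.
Proof. by move=> fS kM a Sa n; have [m <-] := fS n; rewrite -homP kM // hom0. Qed.

Lemma killed_inj S M N (f : M ~> N) : injective f -> killed S N -> killed S M.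
Proof. by move=> fI kM a Sa n; apply: fI; rewrite homP kM // hom0. Qed.

(* Ext^1(M, Fac M) = 0 in the category of the modules killed by S: the condition
   on g says that its kernel is a quotient of a power of M. *)
Definition extfree (S : A -> Prop) M := forall Y Z (g : Y ~> Z),
  killed S Y -> surj g ->
  (forall y, g y = 0 -> span (fun f : M ~> Y => forall m, g (f m) = 0) y) ->
  forall h : M ~> Z, exists h' : M ~> Y, forall m, g (h' m) = h m.

Lemma extfree_weaken (S T : A -> Prop) M :
  (forall Y, killed T Y -> killed S Y) -> extfree S M -> extfree T M.
Proof. by move=> ST eM Y Z g /ST; apply: eM. Qed.

Lemma extfree_retract S X M : retract X M -> extfree S M -> extfree S X.
Proof.
move=> [i [p pi]] eM Y Z g kY gS gk h.
have [y gy|h' hE] := eM Y Z g kY gS _ (hcomp h p).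
  rewrite -[y](hidE y); apply: span_map (gk y gy) => f gf x; rewrite homE.
  by rewrite -(pi x) -hcompE; apply: span_one => m; rewrite homE gf.
by exists (hcomp h' i) => x; rewrite !homE hE homE pi.
Qed.

Lemma extfree_iso S X M : iso X M -> extfree S M -> extfree S X.
Proof. by move=> /iso_retract; apply: extfree_retract. Qed.

(** Modules killed by an idempotent e are closed under extensions: if y e lies in a submodule killed
    by e, then y e = y e e = 0. The lifting problem is therefore restricted to the preimage Y0 of
    the image of h, an extension of that image by a quotient of a power of M. *)
Lemma extfree_idem S e M : e ** e = e ->
  killed (fun a => S a \/ a = e) M -> extfree (fun a => S a \/ a = e) M ->
  extfree S M.
Proof.
move=> ee kM eM Y Z g kY gS gk h.
have Me m : ract (m : M) e = 0 by apply: kM; right.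
have [Y0 [i [iI iP]]] := preim_mod g h.
have [Z0 [q [j [qS jI jq]]]] := img_mod (hcomp g i).
have [h1 h1E] : exists h1 : M ~> Z0, forall m, j (h1 m) = h m.
  apply: (fac_mono jI) => m; have [y gy] := gS (h m).
  have /iP[x ix] : exists m, h m = g y by exists m.
  by exists (q x); rewrite jq homE ix gy.
have kerY0 (f : M ~> Y) : (forall m, g (f m) = 0) -> exists f' : M ~> Y0, forall m, i (f' m) = f m.
  move=> gf; apply: (fac_mono (h := f) iI) => m; apply/iP.
  by exists 0; rewrite gf hom0.
have spY0 y : g (i y) = 0 -> span (fun f : M ~> Y0 => forall m, q (f m) = 0) y.
  move=> gy; move: (gk _ gy); move: {1 3}(i y) (erefl (i y)) => z iz sp.
  have : exists2 y', span (fun f : M ~> Y0 => forall m, q (f m) = 0) y' & i y' = z.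
    elim: sp {iz} => [|f m x gf _ [y' sy' iy']].
      by exists 0; [apply: span0 | rewrite hom0].
    have [f' fE] := kerY0 f gf; exists (f' m + y'); last by rewrite homD fE iy'.
    by apply: span_cons => // m'; apply: jI; rewrite jq homE fE gf hom0.
  by move=> [y' sy' iy']; rewrite -(iI y' y) // iy' iz.
have [|y qy|h' hE] := eM Y0 Z0 q _ qS _ h1.
- move=> a [Sa|->] y; first exact: (killed_inj iI kY).
  have [m hm] : exists m, h m = g (i y) by apply/iP; exists y.
  apply: iI; rewrite homP hom0.
  have := gk (ract (i y) e); rewrite homP -hm -homP Me hom0 => /(_ erefl) sp.
  rewrite -ee ractM; elim: sp => [|f x z _ _ IH]; first exact: ract0.
  by rewrite ractD IH -homP Me hom0 addr0.
- by apply: spY0; rewrite -hcompE -jq qy hom0.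
by exists (hcomp i h') => m; rewrite -(h1E m) -(hE m) jq !homE.
Qed.

(* t is the projection of U onto its largest quotient killed by S: this is
   U -> U (x)_A B for S the kernel of a surjection f : A -> B, and U -> U/Uc for
   S = {c} with c central. *)
Definition red (S : A -> Prop) U T (t : U ~> T) := [/\ surj t, killed S T &
  forall Y (f : U ~> Y), killed S Y -> exists f' : T ~> Y, forall u, f' (t u) = f u].

Lemma red_comp (S T : A -> Prop) U V W (u : U ~> V) (v : V ~> W) :
  (forall Y, killed T Y -> killed S Y) ->
  red S u -> red T v -> red T (hcomp v u).
Proof.
move=> ST [uS kV uP] [vS kW vP]; split=> // [y|Y f kY].
  by have [x <-] := vS y; have [z <-] := uS x; exists z; rewrite homE.
have [f1 f1E] := uP Y f (ST _ kY); have [f2 f2E] := vP Y f1 kY.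
by exists f2 => z; rewrite homE f2E f1E.
Qed.

Lemma red_ext (S T : A -> Prop) U V (u : U ~> V) :
  (forall Y, killed T Y <-> killed S Y) -> red S u -> red T u.
Proof.
by move=> ST [uS kV uP]; split=> // [|Y f /ST]; [apply/ST | apply: uP].
Qed.

Lemma red_map S U V U' V' (u : U ~> U') (v : V ~> V') (f : U ~> V) :
  red S u -> red S v -> exists f' : U' ~> V', forall x, f' (u x) = v (f x).
Proof.
move=> [uS kU uP] [vS kV vP]; have [f' fE] := uP V' (hcomp v f) kV.
by exists f' => x; rewrite fE homE.
Qed.

Lemma red_map_iso S U V U' V' (u : U ~> U') (v : V ~> V') :
  red S u -> red S v -> iso U V -> iso U' V'.
Proof.
move=> ru rv [f [g [gf fg]]].
have [f' fE] := red_map f ru rv; have [g' gE] := red_map g rv ru.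
exists f', g'; have [uS _ _] := ru; have [vS _ _] := rv.
by split=> [m|n]; [have [x <-] := uS m; rewrite fE gE gf |
  have [x <-] := vS n; rewrite gE fE fg].
Qed.

Lemma red_unique S U V V' (v : U ~> V) (v' : U ~> V') :
  red S v -> red S v' -> iso V V'.
Proof. by move=> rv rv'; apply: (red_map_iso rv rv'); apply: iso_refl. Qed.

Lemma red_gen S U V U' V' (u : U ~> U') (v : V ~> V') :
  red S u -> red S v -> gen U V -> gen U' V'.
Proof.
move=> ru rv UV y; have [vS _ _] := rv; have [x <-] := vS y.
apply: span_map (UV x) => f _ m; have [f' <-] := red_map f ru rv.
exact: span_one.
Qed.

(** Maps from U and maps from T to modules killed by S are the same, so a lift is found on U and
    then descends. *)
Lemma red_extfree S U T (t : U ~> T) : red S t -> extfree S U -> extfree S T.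
Proof.
move=> [tS kT tP] eU Y Z g kY gS gk h.
have [y gy|h1 h1E] := eU Y Z g kY gS _ (hcomp h t).
  rewrite -[y](hidE y); apply: span_map (gk y gy) => f gf x; rewrite homE.
  have [u <-] := tS x; rewrite -hcompE; apply: span_one => m.
  by rewrite homE gf.
have [h' hE] := tP _ h1 kY; exists h' => m; have [u <-] := tS m.
by rewrite hE h1E homE.
Qed.

End Span.

(** * Projective modules and Fitting's lemma *)

Section Projective.
Variables (K : fieldType) (A : fdalgebra K).
Implicit Types M N P Q X Y Z : rmodule A.

(** The dual basis form of projectivity. It gives lifts by explicit formulas and writes a map P -> N
    as a sum of tensors n (x) xi with xi in Hom(P, A). *)
Definition dual_basis P := exists n (x : 'I_n -> P) (xi : 'I_n -> P ~> regular A),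
  forall p, p = \sum_j ract (x j) (xi j p).

Lemma hom_regular M (m : M) : exists f : regular A ~> M, forall a, f a = ract m a.
Proof. by apply: mkhom => [|a b]; [apply: ract_linr | rewrite /= ractM]. Qed.

Lemma hom_of_family P M n (xi : 'I_n -> P ~> regular A) (m : 'I_n -> M) :
  exists f : P ~> M, forall p, f p = \sum_j ract (m j) (xi j p).
Proof.
apply: mkhom => [k u v|p a].
  rewrite scaler_sumr -big_split; apply: eq_bigr => j _ /=.
  by rewrite linearP ract_linr.
rewrite (lin_sum (ract_linl a)); apply: eq_bigr => j _.
by rewrite homP /= ractM.
Qed.

Lemma dual_basis_lift P M N (g : M ~> N) (h : P ~> N) : dual_basis P ->
  (forall p, exists m, g m = h p) -> exists h' : P ~> M, forall p, g (h' p) = h p.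
Proof.
move=> [n [x [xi xiP]]] gh.
have /fin_all_exists[m mP] : forall j, exists m, g m = h (x j) by move=> j; apply: gh.
have [h' hE] := hom_of_family xi m; exists h' => p.
rewrite hE hom_sum [in RHS](xiP p) hom_sum; apply: eq_bigr => j _.
by rewrite !homP mP.
Qed.

Lemma dual_basis_retract X P : retract X P -> dual_basis P -> dual_basis X.
Proof.
move=> [i [p pi]] [n [x [xi xiP]]].
exists n, (fun j => p (x j)), (fun j => hcomp (xi j) i) => y.
rewrite -{1}(pi y) {1}(xiP (i y)) hom_sum; apply: eq_bigr => j _.
by rewrite homP homE.
Qed.

Definition free_mod n : rmodule A := dsum (fun _ : 'I_n => regular A).

Lemma free_dual_basis n : dual_basis (free_mod n).
Proof.
have /fin_all_exists[p pE] := dsum_proj (fun _ : 'I_n => regular A).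
exists n, (fun j => [ffun i => if i == j then aone A else 0] : free_mod n), p => v.
apply/ffunP => i; rewrite dsum_sumE (bigD1 i) //= !ffunE eqxx big1 => [|j ij].
  by rewrite addr0 pE amul1l.
by rewrite !ffunE eq_sym (negbTE ij) (lin0 (amul_linl _)).
Qed.

Lemma free_cover M : exists n (f : free_mod n ~> M), surj f.
Proof.
have /fin_all_exists[f fE] := fun i : 'I_(\dim {: M}) => hom_regular (vbasis {: M})`_i.
have [u uE] := dsum_out f; exists (\dim {: M}), u => m.
exists [ffun i => coord (vbasis {: M}) i m *: aone A].
rewrite uE [RHS](coord_vbasis (memvf m)); apply: eq_bigr => i _.
by rewrite ffunE fE ractZr ract1.
Qed.

Lemma dual_basis_projective P : dual_basis P -> projective P.
Proof.
move=> dP M N g f gh /limg_surj gS fh.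
have [|h hE] := @dual_basis_lift _ _ _ (Hom gh) (Hom fh) dP; first by move=> p; apply: gS.
exists h; first exact: homP.
by apply/lfunP => p; rewrite comp_lfunE; apply: hE.
Qed.

Lemma projective_retract P M (f : M ~> P) : projective P -> surj f -> retract P M.
Proof.
move=> pP fS; have [| | |h hh hE] := pP M P f (hid P).
- exact: homP.
- exact/limg_surj.
- exact: homP.
exists (Hom hh), f => p; have /lfunP/(_ p) := hE.
by rewrite comp_lfunE => ->; rewrite homE.
Qed.

Lemma projectiveP P : projective P <-> dual_basis P.
Proof.
split=> [pP|]; last exact: dual_basis_projective.
have [n [f fS]] := free_cover P.
exact: dual_basis_retract (projective_retract pP fS) (free_dual_basis n).
Qed.

Lemma dual_basis_extfree S P : dual_basis P -> extfree S P.
Proof. by move=> dP Y Z g _ gS _ h; apply: dual_basis_lift => // p. Qed.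

Lemma surj_inj M N (f : M ~> N) : surj f -> (\dim {: M} <= \dim {: N})%N -> injective f.
Proof.
move=> /limg_surj fE le; apply/lker_inj/eqP; rewrite -dimv_eq0.
have := limg_ker_dim f {: M}; rewrite capfv fE => E.
by move: le; rewrite -E -subn_eq0 addnK.
Qed.

Lemma surj_dim M N (f : M ~> N) : surj f -> (\dim {: N} <= \dim {: M})%N.
Proof.
move=> /limg_surj fE; have := limg_ker_dim f {: M}; rewrite capfv fE => <-.
exact: leq_addl.
Qed.

Lemma nat_fun_min (F : nat -> nat) : exists k, forall l, (F k <= F l)%N.
Proof.
suff: forall d k, (F k <= d)%N -> exists k, forall l, (F k <= F l)%N.
  by move=> h; apply: (h (F 0%N) 0%N).
elim=> [|d IH] k.
  by rewrite leqn0 => /eqP k0; exists k => l; rewrite k0.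
move=> kd; have [[l lk]|no] := classic (exists l, (F l < F k)%N).
  by apply: (IH l); rewrite -ltnS (leq_trans lk).
by exists k => l; rewrite leqNgt; apply/negP => lk; apply: no; exists l.
Qed.

(** For large n the image of f^n no longer shrinks, so f^n maps it onto itself, hence bijectively by
    dimension; inverting this restriction turns M -> f^n(M) into a retraction p with the kernel of
    f^n. *)
Lemma fitting M (f : M ~> M) : exists n X (i : X ~> M) (p : M ~> X),
  [/\ (0 < n)%N, forall x, p (i x) = x,
      forall m, p m = 0 <-> iter n f m = 0,
      forall x, exists m, i x = iter n f m
    & forall m, exists x, iter n f m = i x].
Proof.
have [k kmin] := nat_fun_min (fun l => \dim (limg (hpow f l))).
have stable l m : exists m', iter k.+1 f m = iter (l + k.+1)%N f m'.
  suff E : limg (hpow f k.+1) = limg (hpow f (l + k.+1)).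
    have : hpow f k.+1 m \in limg (hpow f (l + k.+1)).
      by rewrite -E; apply/mem_limgP; exists m.
    by move=> /mem_limgP[m' E']; exists m'; rewrite -!hpowE E'.
  have sub a b : (limg (hpow f (b + a)) <= limg (hpow f b))%VS.
    apply/subvP => _ /mem_limgP[x <-]; apply/mem_limgP.
    by exists (iter a f x); rewrite !hpowE iterD.
  have dimE l' : \dim (limg (hpow f (k + l'))) = \dim (limg (hpow f k)).
    by apply/eqP; rewrite eqn_leq kmin andbT dimvS // sub.
  apply/eqP; rewrite eq_sym eqEdim (addnC l) sub andTb.
  by rewrite addSnnS -{1}(addn1 k) !dimE.
have [X [q [i [qS iI iq]]]] := img_mod (hpow f k.+1).
have qiS : surj (hcomp q i).
  move=> x; have [m <-] := qS x; have [m' E] := stable k.+1 m.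
  exists (q m'); apply: iI; rewrite homE !iq !hpowE E iterD.
  by congr iter; rewrite -!hpowE.
have [r [rq qr]] := bij_iso (surj_inj qiS (leqnn _)) qiS.
(* The exponent is k+1 rather than k to make it positive: the applications need f applied at least
   once. *)
exists k.+1, X, i, (hcomp r q); split=> // [x|m|x|m].
- by rewrite homE -[q (i x)]hcompE rq.
- rewrite homE -hpowE -iq; split=> [E|E].
    by rewrite -(qr (q m)) E !hom0.
  by rewrite (_ : q m = 0) ?hom0 //; apply: iI; rewrite E hom0.
- by have [m <-] := qS x; exists m; rewrite iq hpowE.
by exists (q m); rewrite iq hpowE.
Qed.

(** Since p need not be onto, h is tested on the image of p; the same predicate thus covers the map
    P1 -> P0 of a minimal presentation. *)
Definition essential P M (p : P ~> M) := forall X (h : X ~> P),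
  (forall y, exists x, p (h x) = p y) -> surj h.

Lemma proj_cover_imgP P M (p : P ~> M) :
  proj_cover_img p <-> dual_basis P /\ essential p.
Proof.
split=> [[/projectiveP dP _ ess]|[/projectiveP pP ess]].
  split=> // X h hS; apply/limg_surj/ess; first exact: homP.
  apply/eqP; rewrite eqEsubv; apply/andP; split; apply/subvP => _ /mem_limgP[x <-].
    by rewrite comp_lfunE; apply/mem_limgP; exists (h x).
  by have [y <-] := hS x; apply/mem_limgP; exists y; rewrite comp_lfunE.
split=> // [|X h hh E]; first exact: homP.
apply/limg_surj/(ess X (Hom hh)) => y.
have : p y \in limg (p \o h)%VF by rewrite E; apply/mem_limgP; exists y.
by move=> /mem_limgP[x]; rewrite comp_lfunE; exists x.
Qed.

(** By descent on the dimension of P. If h : X -> P shows that p is not essential, lifting p through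
    p h yields an endomorphism f of P with p f = p and image inside h(X). By Fitting's lemma P
    splits into f^n(P) and ker f^n; the first is a proper summand, and it still covers M because p =
    p f^n vanishes on the second. *)
Lemma proj_cover M : exists P (p : P ~> M), [/\ dual_basis P, essential p & surj p].
Proof.
suff: forall d P (p : P ~> M), (\dim {: P} < d)%N -> dual_basis P -> surj p ->
    exists P (p : P ~> M), [/\ dual_basis P, essential p & surj p].
  have [n [f fS]] := free_cover M; move/(_ _ _ f (ltnSn _)); apply=> //.
  exact: free_dual_basis.
elim=> // d IH P p dimP dP pS.
have [ess|] := classic (essential p); first by exists P, p.
move=> ness; have [X nX] := not_all_ex_not _ _ ness.
have [h nh] := not_all_ex_not _ _ nX; have {nh} [hp hS] := imply_to_and _ _ nh.
have [s sE] : exists s : P ~> X, forall y, hcomp p h (s y) = p y.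
  apply: (dual_basis_lift (g := hcomp p h) (h := p)) => // y.
  by have [x E] := hp y; exists x; rewrite homE.
pose f := hcomp h s; have pf y : p (f y) = p y by rewrite /f homE -[RHS]sE homE.
have [n [Q [i [q [n0 qi qf iQ _]]]]] := fitting f.
apply: (IH Q (hcomp p i)).
- rewrite ltnNge; apply/negP => le; apply: hS => y.
  have iS : surj i.
    have qS : surj q by move=> x; exists (i x).
    have := surj_inj qS (leq_trans (ltnSE dimP) le) => qI z.
    by exists (q z); apply: qI; rewrite qi.
  have [x <-] := iS y; have [m ->] := iQ x; case: n n0 {qf iQ} => // n _.
  by exists (s (iter n f m)); rewrite iterS {2}/f homE.
- by apply: dual_basis_retract dP; exists i, q.
move=> m; have [y <-] := pS m; exists (q y); rewrite homE.
have [z zE] : exists z, i (q y) = y - z /\ p z = 0.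
  exists (y - i (q y)); split; first by rewrite subKr.
  have /qf : q (y - i (q y)) = 0 by rewrite homB qi subrr.
  move: (y - _) => z; have : forall k, p (iter k f z) = p z.
    by elim=> // k IHk; rewrite iterS pf.
  by move=> /(_ n) <- ->; rewrite hom0.
by case: zE => -> pz; rewrite homB pz subr0.
Qed.

Lemma min_presentation M : exists P1 P0 (d : P1 ~> P0) (p : P0 ~> M),
  [/\ dual_basis P1 /\ essential d, dual_basis P0 /\ essential p, surj p
    & forall y, p y = 0 <-> exists x, d x = y].
Proof.
have [P0 [p [dP0 pess pS]]] := proj_cover M.
have [I [i [iI iP]]] := ker_mod p.
have [P1 [r [dP1 ress rS]]] := proj_cover I.
exists P1, P0, (hcomp i r), p; split=> //.
  split=> // X h hd; apply: ress => y; have [x E] := hd y; exists x.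
  by apply: iI; move: E; rewrite !homE.
move=> y; rewrite iP; split=> [[x <-]|[x <-]]; last by exists (r x); rewrite homE.
by have [z <-] := rS x; exists z; rewrite homE.
Qed.

End Projective.

(** * tau-rigidity as vanishing of extensions *)

Section LeftQuotient.
Variables (K : fieldType) (A : fdalgebra K) (M : lmodule A) (W : {vspace M}).
Hypothesis subW : forall a m, m \in W -> lact a m \in W.
Let act (a : A) (x : quotv W) : quotv W := qproj W (lact a (vsval x)).

Let actE a m : act a (qproj W m) = qproj W (lact a m).
Proof.
apply/esym/qproj_eq; rewrite -(lin_sub (lact_linr a)).
exact/subW/qproj_val.
Qed.
Fact lqmod_linl x : linear (act^~ x).
Proof. by move=> k a b; rewrite /act lact_linl qproj_lin. Qed.
Fact lqmod_linr a : linear (act a).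
Proof. by move=> k x y; rewrite /act linearP lact_linr qproj_lin. Qed.
Fact lqmod1 x : act (aone A) x = x.
Proof. by rewrite /act lact1 qprojK. Qed.
Fact lqmodM a b x : act (a ** b) x = act a (act b x).
Proof. by rewrite -[x]qprojK !actE lactM. Qed.

Definition lquot_mod : lmodule A := LModule lqmod_linl lqmod_linr lqmod1 lqmodM.

Lemma lquot_modP : exists (T : lmodule A) (q : 'Hom(M, T)),
  [/\ is_lhom q, limg q = fullv & lker q = W].
Proof.
have qE := linfunE (@qproj_lin _ _ W).
exists lquot_mod, (linfun (qproj W) : 'Hom(M, lquot_mod)); split.
- by move=> a m; rewrite !qE -actE.
- by apply/limg_surj => x; exists (vsval x); rewrite qE qprojK.
by apply/vspaceP => m; rewrite memv_ker qE qproj_eq0.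
Qed.
End LeftQuotient.

Section RegularDualHoms.
Variables (K : fieldType) (A : fdalgebra K).
Implicit Types M N P Q X Y Z : rmodule A.

Lemma reg_dual_eq P (g h : reg_dual P) : (forall p, vsval g p = vsval h p) -> g = h.
Proof. by move=> E; apply/val_inj/lfunP. Qed.

Definition dual_elt P (xi : P ~> regular A) : reg_dual P :=
  vsproj (rhoms P (regular A)) xi.

Lemma dual_eltE P (xi : P ~> regular A) p : vsval (dual_elt xi) p = xi p.
Proof. by rewrite vsprojK //; apply/rhomsP/homP. Qed.

Lemma dual_elt_ex P (g : reg_dual P) : exists xi : P ~> regular A, g = dual_elt xi.
Proof.
have gh : is_rhom (vsval g) by apply/rhomsP/subvsP.
by exists (Hom gh); apply: reg_dual_eq => p; rewrite [RHS]dual_eltE.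
Qed.

Lemma reg_dual_sumE P (I : Type) (r : seq I) (F : I -> reg_dual P) p :
  vsval (\sum_(i <- r) F i) p = \sum_(i <- r) vsval (F i) p.
Proof. by rewrite linear_sum sum_lfunE. Qed.

Lemma dual_elt_expand P n (y : 'I_n -> P) (eta : 'I_n -> P ~> regular A) (xi : P ~> regular A) :
  (forall p, p = \sum_j ract (y j) (eta j p)) ->
  dual_elt xi = \sum_j lact (xi (y j)) (dual_elt (eta j)) :> reg_dual P.
Proof.
move=> yP; apply: reg_dual_eq => p; rewrite [LHS]dual_eltE [RHS]reg_dual_sumE {1}(yP p) hom_sum.
by apply: eq_bigr => j _; rewrite homP [RHS]reg_dual_actE dual_eltE.
Qed.

Lemma reg_dual_map_elt P Q (d : P ~> Q) (xi : Q ~> regular A) :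
  reg_dual_map d (dual_elt xi) = dual_elt (hcomp xi d).
Proof.
apply: reg_dual_eq => p; rewrite [RHS]dual_eltE homE.
by rewrite (reg_dual_mapE _ (homP d)) comp_lfunE dual_eltE.
Qed.

Lemma lfun_sum (U V : vectType K) (f : 'Hom(U, V)) n (F : 'I_n -> U) :
  f (\sum_j F j) = \sum_j f (F j).
Proof. exact: linear_sum. Qed.

End RegularDualHoms.

Section TauRigid.
Variables (K : fieldType) (A : fdalgebra K).
Implicit Types M N P Q X Y Z : rmodule A.

Lemma limg_reg_dual_map_sub P Q (d : P ~> Q) a (g : reg_dual P) :
  g \in limg (reg_dual_map d) -> lact a g \in limg (reg_dual_map d).
Proof.
move=> /mem_limgP[x <-]; apply/mem_limgP; exists (lact a x).
apply: reg_dual_eq => p; rewrite [RHS]reg_dual_actE.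
by rewrite !(reg_dual_mapE _ (homP d)) !comp_lfunE reg_dual_actE.
Qed.

Section HomToDual.
Variables (P1 P0 : rmodule A) (d : P1 ~> P0) (T : lmodule A).
Variable q : 'Hom(reg_dual P1, T).
Hypotheses (dP1 : dual_basis P1) (dP0 : dual_basis P0).
Hypotheses (qh : is_lhom q) (qS : limg q = fullv).
Hypothesis qK : lker q = limg (reg_dual_map d).

(* Hom(N, D T) is dual to the cokernel of Hom(d, N), an element n (x) xi of
   N (x) Hom(P1, A) being identified with the map p |-> n * xi p. *)
Lemma hom_dual0 N : (forall al : P1 ~> N, exists be : P0 ~> N, forall p, be (d p) = al p) ->
  forall (f : N ~> dual T) n t, f n t = 0.
Proof.
move=> ext f n t; move/limg_surj: (qS) => /(_ t)[g <-].
have [xi ->] := dual_elt_ex g; have [m [y [eta yP]]] := dP1; have [k [x [xi0 xP]]] := dP0.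
have ev n' (ga : P1 ~> regular A) :
    f n' (q (dual_elt ga)) = \sum_j f (ract n' (ga (y j))) (q (dual_elt (eta j))).
  rewrite (dual_elt_expand _ yP) !lfun_sum; apply: eq_bigr => j _.
  by rewrite qh homP /= dual_actE.
have [al alE] : exists al : P1 ~> N, forall p, al p = ract n (xi p).
  by have [al0 alE] := hom_regular n; exists (hcomp al0 xi) => p; rewrite homE alE.
have [be beE] := ext al.
rewrite ev; under eq_bigr => j _ do rewrite -alE -beE {1}(xP (d (y j))) !hom_sum sum_lfunE.
rewrite exchange_big big1 // => i _ /=.
under eq_bigr => j _ do rewrite homP -(hcompE (xi0 i) d).
rewrite -ev -reg_dual_map_elt.
suff -> : q (reg_dual_map d (dual_elt (xi0 i))) = 0 by rewrite linear0.
by apply/eqP; rewrite -memv_ker qK; apply/mem_limgP; exists (dual_elt (xi0 i)).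
Qed.

(** If al did not extend along d, some functional psi on the linear maps P1 -> N would vanish on all
    be d but not on al. However n |-> (q g |-> psi(n (x) g)) is a homomorphism N -> D T, hence zero,
    and al is a sum of tensors n (x) g. The functionals psi are coordinates of the class modulo
    W. *)
Lemma hom_dual0_ext N : (forall (f : N ~> dual T) n, f n = 0) ->
  forall al : P1 ~> N, exists be : P0 ~> N, forall p, be (d p) = al p.
Proof.
move=> f0 al.
have lc : linear (fun be : 'Hom(P0, N) => (be \o d)%VF).
  by move=> k u v; rewrite comp_lfunDl comp_lfunZl.
pose W := (linfun (fun be : 'Hom(P0, N) => (be \o d)%VF) @: rhoms P0 N)%VS.
have inW (be : P0 ~> N) : (be \o d)%VF \in W.
  by rewrite -[(_ \o _)%VF](linfunE lc) memv_img //; apply/rhomsP/homP.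
suff : (al : 'Hom(P1, N)) \in W.
  case/memv_imgP => be0 /rhomsP beh; rewrite linfunE // => E.
  by exists (Hom beh) => p; rewrite E comp_lfunE.
pose ten n (g : reg_dual P1) : 'Hom(P1, N) := linfun (fun p => ract n (vsval g p)).
have tenE n g p : ten n g p = ract n (vsval g p).
  by rewrite linfunE // => k u v; rewrite linearP ract_linr.
have ten_linl g : linear (ten^~ g).
  move=> k u v; apply/lfunP => p; rewrite add_lfunE scale_lfunE !tenE.
  exact: (ract_linl (vsval g p)).
have ten_linr n : linear (ten n).
  move=> k u v; apply/lfunP => p; rewrite add_lfunE scale_lfunE !tenE.
  by rewrite linearP add_lfunE scale_lfunE ract_linr.
have [m [y [eta yP]]] := dP1.
have alE : (al : 'Hom(P1, N)) = \sum_j ten (al (y j)) (dual_elt (eta j)).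
  apply/lfunP => p; rewrite sum_lfunE {1}(yP p) hom_sum; apply: eq_bigr => j _.
  by rewrite tenE dual_eltE homP.
rewrite -qproj_eq0 (coord_vbasis (memvf (qproj W al))) big1 // => i _.
pose psi (be : 'Hom(P1, N)) : K^o := coord (vbasis fullv) i (qproj W be).
have psi_lin : linear psi by move=> k u v; rewrite /psi qproj_lin linearP.
have psiW be : be \in W -> psi be = 0.
  by rewrite -qproj_eq0 /psi => /eqP ->; rewrite linear0.
suff ten0 n g : psi (ten n g) = 0.
  have -> : coord (vbasis fullv) i (qproj W al) = 0.
    by rewrite -[LHS]/(psi al) alE (lin_sum psi_lin) big1.
  by rewrite scale0r.
have tenK n' g' : q g' = 0 -> psi (ten n' g') = 0.
  move=> /eqP; rewrite -memv_ker qK => /mem_limgP[x <-].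
  have [xi ->] := dual_elt_ex x; rewrite reg_dual_map_elt; apply: psiW.
  have [h hE] := hom_regular n'; have -> : ten n' (dual_elt (hcomp xi d)) = (hcomp h xi \o d)%VF.
    by apply/lfunP => p; rewrite tenE dual_eltE !comp_lfunE hE.
  exact: inW.
have tenq n' g1 g2 : q g1 = q g2 -> psi (ten n' g1) = psi (ten n' g2).
  move=> E; apply/eqP; rewrite -subr_eq0 -(lin_sub psi_lin) -(lin_sub (ten_linr n')).
  by apply/eqP/tenK; rewrite linearB /= E subrr.
have qVK t : q ((q^-1)%VF t) = t by rewrite limg_lfunVK // qS memvf.
have lF n' : linear (fun t : T => psi (ten n' ((q^-1)%VF t))).
  by move=> k u v; rewrite linearP ten_linr psi_lin.
have [| |f fE] := @mkhom K A N (dual T)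
    (fun n' => linfun (fun t : T => psi (ten n' ((q^-1)%VF t)))).
- move=> k u v; apply/lfunP => t; rewrite add_lfunE scale_lfunE !linfunE //.
  by rewrite ten_linl psi_lin.
- move=> n' a; apply/lfunP => t; rewrite dual_actE !linfunE //.
  rewrite -(tenq n' (lact a ((q^-1)%VF t))); last by rewrite qh !qVK.
  congr psi; apply/lfunP => p; rewrite !tenE reg_dual_actE.
  by rewrite ractM.
have := f0 f n => /lfunP/(_ (q g)); rewrite fE linfunE // zero_lfunE => <-.
by apply: tenq; rewrite qVK.
Qed.

End HomToDual.

(** Lift h p to k : P0 -> Y. By the kernel condition each k d(x_j) is a sum of values f(m) with g f
    = 0. The map z |-> m xi_j(z) from P1 to M extends along d; composing the extensions with the f
    and summing gives k' into ker g with k' d = k d. Then k - k' factors through p. *)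
Lemma ext_pres_extfree S M P1 P0 (d : P1 ~> P0) (p : P0 ~> M) :
  dual_basis P1 -> dual_basis P0 -> surj p ->
  (forall y, p y = 0 <-> exists x, d x = y) ->
  (forall al : P1 ~> M, exists be : P0 ~> M, forall x, be (d x) = al x) ->
  extfree S M.
Proof.
move=> dP1 dP0 pS pd ext Y Z g kY gS gk h.
have [k kE] : exists k : P0 ~> Y, forall x, g (k x) = hcomp h p x.
  by apply: dual_basis_lift.
have pd0 x : p (d x) = 0 by apply/pd; exists x.
have [k' [k'g k'E]] : exists k' : P0 ~> Y,
    (forall x, g (k' x) = 0) /\ forall x, k' (d x) = k (d x).
  have [n [x [xi xP]]] := dP1.
  have one j : exists k' : P0 ~> Y,
      (forall x, g (k' x) = 0) /\ forall z, k' (d z) = ract (k (d (x j))) (xi j z).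
    have /gk : g (k (d (x j))) = 0 by rewrite kE homE pd0 hom0.
    elim=> [|f m y gf _ [k' [gk' k'E]]].
      by exists (hzero P0 Y); split=> z; rewrite homE ?hom0 ?ract0.
    have [al0 alE] := hom_regular m; have [be beE] := ext (hcomp al0 (xi j)).
    exists (hadd (hcomp f be) k'); split=> z; rewrite !homE.
      by rewrite homD gf gk' addr0.
    by rewrite beE k'E homE alE homP ractD.
  have /fin_all_exists[F FP] := one.
  have sumF r : exists k' : P0 ~> Y, forall z, k' z = \sum_(j <- r) F j z.
    elim: r => [|j r [k' k'E]].
      by exists (hzero P0 Y) => z; rewrite homE big_nil.
    by exists (hadd (F j) k') => z; rewrite homE big_cons k'E.
  have [k' k'E] := sumF (index_enum _); exists k'; split=> z; rewrite k'E.
    by rewrite hom_sum big1 // => j _; case: (FP j).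
  rewrite [in RHS](xP z) !hom_sum; apply: eq_bigr => j _.
  by case: (FP j) => _ ->; rewrite !homP.
have [h' hE] : exists h' : M ~> Y, forall y, h' (p y) = hsub k k' y.
  by apply: fac_epi => // y /pd[x <-]; rewrite homE k'E subrr.
exists h' => m; have [y <-] := pS m.
by rewrite hE homE homB k'g subr0 kE homE.
Qed.

Lemma extfree_ext_pres M P1 P0 (d : P1 ~> P0) (p : P0 ~> M) :
  extfree (fun=> False) M ->
  dual_basis P1 -> essential d -> dual_basis P0 -> surj p ->
  (forall y, p y = 0 <-> exists x, d x = y) ->
  forall al : P1 ~> M, exists be : P0 ~> M, forall x, be (d x) = al x.
Proof.
move=> eM dP1 ess dP0 pS pd al.
have pd0 x : p (d x) = 0 by apply/pd; exists x.
(* Y is the pushout of al along d. A section of Y ->> M extends al to P0 up to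
   a map with values in al (ker d), and essentiality of d kills that error. *)
have [i [pi [j [pj [pii pjj ij]]]]] := split_dsum_dsum2 P0 M.
have [pji pij] := split_dsum0 pii pjj ij.
have [Y [c [cS cP]]] := coker_mod (hsub (hcomp i d) (hcomp j al)).
have cd x : c (i (d x)) = c (j (al x)).
  apply/eqP; rewrite -subr_eq0 -homB; apply/eqP/cP; exists x.
  by rewrite !homE.
have [g gE] : exists g : Y ~> M, forall z, g (c z) = hcomp p pi z.
  by apply: fac_epi => // z /cP[x <-]; rewrite !homE homB pij subr0 pii pd0.
have gS : surj g.
  by move=> m; have [y <-] := pS m; exists (c (i y)); rewrite gE homE pii.
have gk y : g y = 0 -> exists m, c (j m) = y.
  have [z <-] := cS y; rewrite gE homE => /pd[x dx].
  exists (al x + pj z); rewrite !homD -cd dx -homD; congr (c _).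
  by rewrite -ij.
have [| y /gk[m <-]|s sE] := eM Y M g _ gS _ (hid M); first by [].
  by rewrite -hcompE; apply: span_one => m'; rewrite homE gE homE pij hom0.
have [be beE] : exists be : P0 ~> M, forall y,
    hcomp c j (be y) = hsub (hcomp c i) (hcomp s p) y.
  apply: dual_basis_lift => // y; have [|m mE] := gk (hsub (hcomp c i) (hcomp s p) y).
    by rewrite !homE homB sE gE !homE pii subrr.
  by exists m; rewrite homE.
have dif x : exists2 k, d k = 0 & al k = al x - be (d x).
  have : c (j (al x - be (d x))) = 0.
    have := beE (d x); rewrite !homE pd0 hom0 subr0 cd => E.
    by rewrite !homB E subrr.
  move=> /cP[k]; rewrite !homE => E; exists (- k).
    by have := congr1 pi E; rewrite homB pii !pij subr0 homN => ->; rewrite oppr0.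
  have := congr1 pj E; rewrite homB pji !pjj sub0r => <-.
  by rewrite homN.
exists be => x.
(* I is the submodule where al and be d agree. By [dif], I and ker d span P1, so d(I) = d(P1) and
   essentiality gives I = P1. *)
have [I [e [eI eP]]] := ker_mod (hsub al (hcomp be d)).
have eS : surj e.
  apply: ess => z; have [k dk alk] := dif z.
  have /eP[w wE] : hsub al (hcomp be d) (z - k) = 0.
    by rewrite homB !homE dk hom0 subr0 alk subrr.
  by exists w; rewrite wE homB dk subr0.
have [w wx] := eS x; have /eP : exists w, e w = x by exists w.
by rewrite !homE => /eqP; rewrite subr_eq0 => /eqP.
Qed.

(** Auslander-Reiten duality: Hom(M, tau M) is dual to the cokernel of Hom(d, M) for a minimal
    presentation d : P1 -> P0, so it vanishes exactly when every map P1 -> M extends along d.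
    [ext_pres_extfree] and [extfree_ext_pres] pass between this extension property and the vanishing
    of Ext^1(M, Fac M). *)
Lemma tau_rigidP M : tau_rigid M <-> extfree (fun=> False) M.
Proof.
split.
  move=> [X [T [P1 [P0 [d1 [d0 [pres [q [qh qS qK]]]]]]] /risomP[f [g [gf fg]]]] X0].
  case: pres => [[/projectiveP dP0 d0h _] [/projectiveP dP1 d1h _] d0S E].
  apply: (@ext_pres_extfree _ M P1 P0 (Hom d1h) (Hom d0h)) => //.
  - exact/limg_surj.
  - move=> y; rewrite -mem_limgP /= E memv_ker; split=> [->//|/eqP //].
  apply: (@hom_dual0_ext P1 P0 (Hom d1h) T q dP1 qh qS qK) => h n.
  have := X0 (hcomp g h) (homP _) => /lfunP/(_ n); rewrite homE zero_lfunE => E'.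
  by rewrite -(fg (h n)) E' hom0.
move=> eM.
have [P1 [P0 [d [p [[dP1 dess] [dP0 pess] pS pd]]]]] := min_presentation M.
have [T [q [qh qS qK]]] := lquot_modP (@limg_reg_dual_map_sub P1 P0 d).
exists (dual T).
  exists T; last by apply/risomP; apply: iso_refl.
  exists P1, P0, d, p; split; last by exists q.
  split; [by apply/proj_cover_imgP | by apply/proj_cover_imgP | by apply/limg_surj |].
  apply/vspaceP => y; rewrite memv_ker; apply/idP/eqP.
    by move=> /mem_limgP h; apply/pd.
  by move=> /pd h; apply/mem_limgP.
move=> f fh; apply/lfunP => n; rewrite zero_lfunE; apply/lfunP => t.
rewrite zero_lfunE; apply: (@hom_dual0 P1 P0 d T q dP1 dP0 qh qS qK M _ (Hom fh)).
exact: (extfree_ext_pres eM dP1 dess dP0 pS pd).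
Qed.

End TauRigid.

(** * Reduction modulo a central nilpotent element *)

Section SummandInvariants.
Variables (K : fieldType) (A : fdalgebra K).
Implicit Types M N P Q X Y Z : rmodule A.

Lemma split_dsum_retract M X Y : split_dsum M X Y -> retract X M.
Proof. by move=> [i [p [j [q [pi _ _]]]]]; exists i, p. Qed.

Lemma split_dsum_isor M X Y Z : iso Y Z -> split_dsum M X Y -> split_dsum M X Z.
Proof.
move=> YZ s; apply: split_dsum_iso (split_dsum_dsum2 X Z).
apply: iso_sym; apply: (split_dsum_unique s (split_dsum_dsum2 X Z)) => //.
exact: iso_refl.
Qed.

Lemma num_indec_iso M N k : iso M N -> num_indec M k -> num_indec N k.
Proof.
move=> MN [S [S1 S2 S3]]; exists S; split=> // [i|X iX /summandP rX].
  have [iS /summandP rS] := S1 i; split=> //.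
  exact/summandP/(retract_trans rS)/iso_retract.
by apply/S3/summandP/(retract_trans rX)/iso_retract/iso_sym.
Qed.

End SummandInvariants.

Section CentralReduction.
Variables (K : fieldType) (A : fdalgebra K) (c : A) (nc : nat).
Hypothesis cC : forall a : A, c ** a = a ** c.
Hypothesis c_nil : iter nc (amul c) (aone A) = 0.
Implicit Types M N P Q X Y Z T : rmodule A.
Let isc (a : A) := a = c.

Lemma cmap_hom M : exists f : M ~> M, forall m, f m = ract m c.
Proof. by apply: mkhom => [|m a]; [apply: ract_linl | rewrite -!ractM cC]. Qed.

Lemma ract_iter M (m : M) k :
  iter k (fun x => ract x c) m = ract m (iter k (amul c) (aone A)).
Proof.
elim: k m => [|k IH] m; first by rewrite /= ract1.
by rewrite iterSr IH iterS ractM.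
Qed.

Lemma c_nilM M (m : M) : iter nc (fun x => ract x c) m = 0.
Proof. by rewrite ract_iter c_nil ractr0. Qed.

Lemma red_intro M T (t : M ~> T) : surj t -> killed isc T ->
  (forall m, t m = 0 -> exists m', ract m' c = m) -> red isc t.
Proof.
move=> tS kT tk; split=> // Y f kY; apply: fac_epi => // m /tk[m' <-].
by rewrite homP kY.
Qed.

Lemma red_ex M : exists T (t : M ~> T), red isc t.
Proof.
have [f fE] := cmap_hom M; have [T [t [tS tk]]] := coker_mod f.
exists T, t; apply: red_intro => // [a -> y|m].
  by have [m <-] := tS y; rewrite -homP; apply/tk; exists m.
by move=> /tk[m' <-]; exists m'.
Qed.

Lemma red_ker M T (t : M ~> T) : red isc t ->
  forall m, t m = 0 <-> exists m', ract m' c = m.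
Proof.
move=> [tS kT tP] m; split=> [tm|[m' <-]]; last by rewrite homP kT.
have [f fE] := cmap_hom M; have [Q [q [qS qk]]] := coker_mod f.
have [|g gE] := tP Q q.
  by move=> a -> y; have [x <-] := qS y; rewrite -homP; apply/qk; exists x.
have /qk[m' <-] : q m = 0 by rewrite -gE tm hom0.
by exists m'.
Qed.

(** By induction on k, each n is w + n' c^k with w in W, and c^nc = 0. W may be any additive
    predicate stable under c: an image, a trace given by [span], or annihilation by an element. *)
Lemma nakayama_ind N T (t : N ~> T) (W : N -> Prop) : red isc t ->
  W 0 -> (forall u v, W u -> W v -> W (u + v)) -> (forall u, W u -> W (ract u c)) ->
  (forall n, exists2 w, W w & t n = t w) -> forall n, W n.
Proof.
move=> rt W0 WD Wc WT n.
have Wi k u : W u -> W (iter k (fun x => ract x c) u).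
  by move=> Wu; elim: k => // k; apply: Wc.
suff: forall k, exists2 w, W w & exists n', n = w + iter k (fun x => ract x c) n'.
  by move=> /(_ nc)[w Ww [n' ->]]; rewrite c_nilM addr0.
elim=> [|k [w Ww [n' nE]]]; first by exists 0 => //; exists n; rewrite add0r.
have [w' Ww' tE] := WT n'.
have /(red_ker rt)[n'' E] : t (n' - w') = 0 by rewrite homB tE subrr.
have [f fE] := cmap_hom N.
exists (w + iter k (fun x => ract x c) w'); first by apply: WD => //; apply: Wi.
exists n''; rewrite nE -addrA iterSr E; congr (w + _).
by rewrite !ract_iter -ractD addrC subrK.
Qed.

Lemma nakayama_surj X N T (t : N ~> T) (f : X ~> N) : red isc t ->
  (forall n, exists x, t (f x) = t n) -> surj f.
Proof.
move=> rt tf; apply: (nakayama_ind rt) => [|u v [x <-] [y <-]|u [x <-]|n].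
- by exists 0; rewrite hom0.
- by exists (x + y); rewrite homD.
- by exists (ract x c); rewrite homP.
by have [x E] := tf n; exists (f x); first by exists x.
Qed.

Lemma red_zero M T (t : M ~> T) : red isc t -> zero_module M <-> zero_module T.
Proof.
move=> rt; have [tS _ _] := rt; split=> /zero_modP z; apply/zero_modP.
  by move=> y; have [m <-] := tS y; rewrite (z m) hom0.
apply: (nakayama_ind rt) => // [u v -> ->|u ->|n]; rewrite ?addr0 ?ract0 //.
by exists 0; rewrite // !(z (t _)).
Qed.

(* Induction on k through the quotients N/Nc^(k+1), the successive kernels being
   quotients of N/Nc. *)
Lemma red_lift S M N T (t : N ~> T) (h : M ~> T) : extfree S M -> killed S N ->
  red isc t -> gen M T -> exists h' : M ~> N, forall m, t (h' m) = h m.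
Proof.
move=> eM kN rt MT; have [tS kT _] := rt; have [f fE] := cmap_hom N.
have fk k n : hpow f k n = iter k (fun x => ract x c) n.
  by rewrite hpowE; apply: eq_iter.
suff: forall k, exists Q (q : N ~> Q) (r : Q ~> T) (g : M ~> Q),
    [/\ surj q, forall n, q n = 0 <-> exists n', iter k.+1 (fun x => ract x c) n' = n,
        forall n, r (q n) = t n & forall m, r (g m) = h m].
  move=> /(_ nc)[Q [q [r [g [qS qk rq rg]]]]].
  have qI : injective q.
    move=> u v E; apply/eqP; rewrite -subr_eq0; apply/eqP.
    have /qk[n' <-] : q (u - v) = 0 by rewrite homB E subrr.
    by rewrite iterS c_nilM ract0.
  have [q' [q'q qq']] := bij_iso qI qS.
  by exists (hcomp q' g) => m; rewrite homE -rg -rq qq'.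
elim=> [|k [Q [q [r [g [qS qk rq rg]]]]]].
  exists T, t, (hid T), h; split=> // [n|n|m]; rewrite ?homE //.
  exact: (red_ker rt).
have [Q' [q' [q'S q'k]]] := coker_mod (hpow f k.+2).
have [s sE] : exists s : Q' ~> Q, forall n, s (q' n) = q n.
  apply: fac_epi => // n /q'k[n' <-]; apply/qk; exists (ract n' c).
  by rewrite fk [RHS]iterSr.
have sS : surj s by move=> y; have [n <-] := qS y; exists (q' n).
have [w wE] : exists w : T ~> Q', forall n, w (t n) = hcomp q' (hpow f k.+1) n.
  apply: fac_epi => // n /(red_ker rt)[n' <-]; rewrite homE; apply/q'k; exists n'.
  by rewrite !fk [LHS]iterSr.
have [| y sy|g' gE] := eM Q' Q s _ sS _ g.
- by apply: killed_surj q'S kN.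
- have [n qn] := q'S y; move: sy; rewrite -qn sE => /qk[n' nE].
  rewrite -nE -fk -hcompE -wE; apply: span_map (MT (t n')) => e _ m.
  rewrite -hcompE; apply: span_one => {}m; rewrite homE.
  have [z <-] := tS (e m); rewrite wE homE sE; apply/qk.
  by exists z; rewrite fk.
exists Q', q', (hcomp r s), g'; split=> // [n|n|m].
- by rewrite q'k; split=> -[n' <-]; exists n'; rewrite fk.
- by rewrite homE sE.
by rewrite homE gE.
Qed.

(** Since N' lies in Fac M, [red_lift] lifts every map M -> N' to N. The trace of M in N thus covers
    N', and by Nakayama it is all of N. *)
Lemma red_gen_lift S M N M' N' (t : M ~> M') (s : N ~> N') : extfree S M ->
  killed S N -> red isc t -> red isc s -> gen M' N' -> gen M N.
Proof.
move=> eM kN rt rs MN; have [tS _ _] := rt.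
have MN' : gen M N' by apply: gen_trans MN; apply: gen_surj tS.
apply: (nakayama_ind rs) => [|u v|u|n]; first exact: span0; first exact: spanD.
  elim=> [|f m y _ _ IH]; first by rewrite ract0; apply: span0.
  by rewrite ractD -homP; apply: span_cons.
elim: (MN' (s n)) => [|f m y _ _ [w Ww ->]]; first by exists 0; [apply: span0 | rewrite hom0].
have [f' fE] := red_lift f eM kN rs MN'.
by exists (f' m + w); [apply: span_cons | rewrite homD fE].
Qed.

(** Both f and g lift to epimorphisms, by [red_lift] and Nakayama. The lifts need not be mutually
    inverse, but epimorphisms both ways between finite dimensional modules are bijective. *)
Lemma red_iso S M N M' N' (t : M ~> M') (s : N ~> N') : extfree S M ->
  killed S M -> extfree S N -> killed S N -> red isc t -> red isc s ->
  iso M' N' -> iso M N.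
Proof.
move=> eM kM eN kN rt rs [f [g [gf fg]]].
have cover M1 N1 M2 N2 (t1 : M1 ~> M2) (s1 : N1 ~> N2) (e : M2 ~> N2) :
    extfree S M1 -> killed S N1 -> red isc t1 -> red isc s1 -> surj e ->
    exists F : M1 ~> N1, surj F.
  move=> e1 k1 r1 r2 eS; have [t1S _ _] := r1.
  have et1S : surj (hcomp e t1).
    by move=> y; have [x <-] := eS y; have [z <-] := t1S x; exists z; rewrite homE.
  have [F FE] := red_lift (hcomp e t1) e1 k1 r2 (gen_surj et1S).
  exists F; apply: (nakayama_surj r2) => n; have [x xE] := et1S (s1 n).
  by exists x; rewrite FE.
have [F FS] : exists F : M ~> N, surj F by apply: cover rt rs _ => // y; exists (g y).
have [G GS] : exists G : N ~> M, surj G by apply: cover rs rt _ => // y; exists (f y).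
have [F' FP] := bij_iso (surj_inj FS (surj_dim GS)) FS.
by exists F, F'.
Qed.

Lemma red_split M X Y M' X' Y' (t : M ~> M') (x : X ~> X') (y : Y ~> Y') :
  red isc t -> red isc x -> red isc y -> split_dsum M X Y -> split_dsum M' X' Y'.
Proof.
move=> rt rx ry [i [p [j [q [pi qj ij]]]]].
have [i' iE] := red_map i rx rt; have [p' pE] := red_map p rt rx.
have [j' jE] := red_map j ry rt; have [q' qE] := red_map q rt ry.
have [[tS _ _] [xS _ _] [yS _ _]] := And3 rt rx ry.
exists i', p', j', q'; split=> [u|u|u].
- by have [z <-] := xS u; rewrite iE pE pi.
- by have [z <-] := yS u; rewrite jE qE qj.
by have [z <-] := tS u; rewrite pE qE iE jE -homD -ij.
Qed.

Lemma red_retract M X M' X' (t : M ~> M') (x : X ~> X') :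
  red isc t -> red isc x -> retract X M -> retract X' M'.
Proof.
move=> rt rx [i [p pi]].
have [i' iE] := red_map i rx rt; have [p' pE] := red_map p rt rx.
exists i', p' => u; have [xS _ _] := rx.
by have [z <-] := xS u; rewrite iE pE pi.
Qed.

(* Fitting's lemma applied to a lift to M of the projection of M' onto X. *)
Lemma split_lift S M M' (t : M ~> M') X Y : extfree S M -> killed S M ->
  red isc t -> split_dsum M' X Y -> exists X' Y' (x : X' ~> X) (y : Y' ~> Y),
  [/\ split_dsum M X' Y', red isc x & red isc y].
Proof.
move=> eM kM rt sM'; have [tS kM' _] := rt.
have [i [p [j [q [pi qj ij]]]]] := sM'; have [qi pj] := split_dsum0 pi qj ij.
have [f fE] := red_lift (hcomp (hcomp i p) t) eM kM rt (gen_surj tS).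
have [n [X' [i' [p' [n0 pi' pk' i1 i2]]]]] := fitting f.
have [Y' [j' [q' [qj' ij']]]] := retract_split pi'.
have [qi' pj'] := split_dsum0 pi' qj' ij'.
have tfn m : t (iter n f m) = i (p (t m)).
  case: n n0 {pk' i1 i2} => // n _; elim: n => [|n IH]; first by rewrite fE !homE.
  by rewrite iterS fE !homE IH pi.
exists X', Y', (hcomp (hcomp p t) i'), (hcomp (hcomp q t) j'); split.
- by exists i', p', j', q'.
- apply: red_intro => [z||x'].
  + have [m tm] := tS (i z); have [x' E] := i2 m.
    by exists x'; rewrite !homE -E tfn pi tm pi.
  + by apply: killed_inj kM'; apply: (can_inj pi).
  rewrite !homE => px; have [m im] := i1 x'.
  have /(red_ker rt)[m' E] : t (i' x') = 0.
    by move: px; rewrite im tfn pi => ->; rewrite hom0.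
  by exists (p' m'); rewrite -homP E pi'.
apply: red_intro => [z||y'].
- have [m tm] := tS (j z); exists (q' m); rewrite !homE.
  have := qj z; rewrite -tm {1}(ij' m) !homD; have [m' ->] := i1 (p' m).
  by rewrite tfn qi add0r.
- by apply: killed_inj kM'; apply: (can_inj qj).
rewrite !homE => qy; have /pk' E := pj' y'.
have /(red_ker rt)[m' E'] : t (j' y') = 0.
  by rewrite (ij (t _)) qy -tfn E !hom0 addr0.
by exists (q' m'); rewrite -homP E' qj'.
Qed.

Lemma retract_lift S M M' (t : M ~> M') X : extfree S M -> killed S M ->
  red isc t -> retract X M' -> exists X' (x : X' ~> X), retract X' M /\ red isc x.
Proof.
move=> eM kM rt [i [p pi]]; have [Y [j [q [qj ij]]]] := retract_split pi.
have [|X' [Y' [x [y [s rx ry]]]]] := @split_lift S M M' t X Y eM kM rt.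
  by exists i, p, j, q.
by exists X', x; split=> //; apply: split_dsum_retract s.
Qed.

Lemma killed_retract S X M : retract X M -> killed S M -> killed S X.
Proof. by move=> [i [p pi]]; apply: killed_inj; apply: (can_inj pi). Qed.

Lemma red_indec S M M' (t : M ~> M') : extfree S M -> killed S M ->
  red isc t -> indecomposable M <-> indecomposable M'.
Proof.
move=> eM kM rt; split=> /indecP[nz sp]; apply/indecP; split.
- by move=> /(red_zero rt).
- move=> X Y /(split_lift eM kM rt)[X' [Y' [x [y [s rx ry]]]]].
  by case: (sp _ _ s) => [/(red_zero rx)|/(red_zero ry)]; [left|right].
- by move=> /(red_zero rt).
move=> X Y s; have [X' [x rx]] := red_ex X; have [Y' [y ry]] := red_ex Y.
by case: (sp _ _ (red_split rt rx ry s)) => [/(red_zero rx)|/(red_zero ry)]; [left|right].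
Qed.

(** Summands of M inherit [extfree] and [killed], so [red_indec] and [red_iso] apply to them;
    together with [retract_lift] this makes reduction a bijection between the classes of
    indecomposable summands of M and of M'. *)
Lemma red_num_indec S M M' (t : M ~> M') k : extfree S M -> killed S M ->
  red isc t -> num_indec M k <-> num_indec M' k.
Proof.
move=> eM kM rt.
have good X : retract X M -> extfree S X /\ killed S X.
  by move=> r; split; [apply: extfree_retract r eM | apply: killed_retract r kM].
have rindec X X' (x : X ~> X') : retract X M -> red isc x ->
    indecomposable X <-> indecomposable X'.
  by move=> /good[eX kX] rx; apply: (red_indec eX kX rx).
have riso X Y X' Y' (x : X ~> X') (y : Y ~> Y') : retract X M -> retract Y M ->
    red isc x -> red isc y -> risom X Y <-> risom X' Y'.
  move=> /good[eX kX] /good[eY kY] rx ry; split=> /risomP i; apply/risomP.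
    exact: red_map_iso rx ry i.
  exact: (red_iso eX kX eY kY rx ry i).
split=> [[F [F1 F2 F3]]|[F [F1 F2 F3]]].
  have rF i : retract (F i) M by apply/summandP; case: (F1 i).
  have /fin_all_exists[G] := fun i => red_ex (F i).
  move=> /fin_all_exists[g gP]; exists G; split=> [i|i j|X iX /summandP rX].
  - split; first by apply/(rindec _ _ (g i)) => //; case: (F1 i).
    exact/summandP/(red_retract rt (gP i)).
  - by move=> /(riso _ _ _ _ (g i) (g j) (rF i) (rF j) (gP i) (gP j))/F2.
  have [X' [x [rX' rx]]] := retract_lift eM kM rt rX.
  have iX' : indecomposable X' by apply/(rindec _ _ x).
  have /summandP sX' := rX'; have [i i_iso] := F3 X' iX' sX'.
  by exists i; apply/(riso _ _ _ _ x (g i)).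
have /fin_all_exists[G] : forall i, exists X' (x : X' ~> F i), retract X' M /\ red isc x.
  by move=> i; have [_ /summandP r] := F1 i; apply: (retract_lift eM kM rt).
move=> /fin_all_exists[g gP].
have rG i : retract (G i) M by case: (gP i).
have rg i : red isc (g i) by case: (gP i).
exists G; split=> [i|i j|X iX /summandP rX].
- split; last exact/summandP.
  by apply/(rindec _ _ (g i)) => //; case: (F1 i).
- by move=> /(riso _ _ _ _ (g i) (g j) (rG i) (rG j) (rg i) (rg j))/F2.
have [X' [x rx]] := red_ex X.
have [||i i_iso] := F3 X'; first by apply/(rindec _ _ x).
  exact/summandP/(red_retract rt rx).
by exists i; apply/(riso _ _ _ _ x (g i)).
Qed.

(** A repeated summand X + X of M' lifts to a summand X1 + X2 of M, both parts reducing to X; they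
    are isomorphic by [red_iso], so X1 is repeated in M. *)
Lemma red_basic S M M' (t : M ~> M') : extfree S M -> killed S M ->
  red isc t -> basic M <-> basic M'.
Proof.
move=> eM kM rt; split=> bM X iX /summandP r.
  have [W [w [rW rw]]] := retract_lift eM kM rt r.
  have eW := extfree_retract rW eM; have kW := killed_retract rW kM.
  have [X1 [X2 [x1 [x2 [s r1 r2]]]]] := split_lift eW kW rw (split_dsum_dsum2 X X).
  have t1 := split_dsum_retract s.
  have t2 := split_dsum_retract (split_dsum_sym s).
  have e1 := extfree_retract t1 eW; have k1 := killed_retract t1 kW.
  have e2 := extfree_retract t2 eW; have k2 := killed_retract t2 kW.
  have i21 := red_iso e2 k2 e1 k1 r2 r1 (iso_refl _).
  have /split_dsumP/risomP i11 := split_dsum_isor i21 s.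
  apply: (bM X1); first by apply/(red_indec e1 k1 r1).
  apply/summandP/(retract_trans _ rW)/iso_retract/iso_sym; exact: i11.
have [X' [x rx]] := red_ex X; have [D [d rD]] := red_ex (dsum2 X X).
have /split_dsumP/risomP i := red_split rD rx rx (split_dsum_dsum2 X X).
have rX : retract X M := retract_trans (split_dsum_retract (split_dsum_dsum2 X X)) r.
have eX := extfree_retract rX eM; have kX := killed_retract rX kM.
apply: (bM X'); first by apply/(red_indec eX kX rx).
apply/summandP/(retract_trans _ (red_retract rt rD r))/iso_retract/iso_sym; exact: i.
Qed.

End CentralReduction.

(** * Change of algebra *)

Section Descent.
Variables (K : fieldType) (A B : fdalgebra K) (f : algHom A B).
Hypothesis fS : surj f.
Let kf (a : A) := f a = 0.
Local Notation res := (restriction f).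

Lemma killed_res (M : rmodule B) : killed kf (res M).
Proof. by move=> a fa m; rewrite /= fa ractr0. Qed.

Lemma hom_res (M N : rmodule B) (g : M ~> N) :
  exists g' : res M ~> res N, forall m, g' m = g m.
Proof.
have gh : @is_rhom K A (res M) (res N) g by move=> m a; apply: (homP g m (f a)).
by exists (Hom gh).
Qed.

Lemma hom_unres (M N : rmodule B) (g : res M ~> res N) :
  exists g' : M ~> N, forall m, g' m = g m.
Proof.
have gh : @is_rhom K B M N g.
  by move=> m b; have [a <-] := fS b; apply: (homP g m a).
by exists (Hom gh).
Qed.

Section DescentModule.
Variable X : rmodule A.
Hypothesis kX : killed kf X.
(** Only K-linear. It still defines an action, because preimages of the same b differ by elements of
    ker f, which kill X. *)
Let sec (b : B) : A := ((linfun (f : A -> B))^-1)%VF b.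
Let secK b : f (sec b) = b.
Proof.
have fl := linfunE (alghom_lin f).
rewrite -[f _]fl limg_lfunVK //; have [a <-] := fS b.
by rewrite -fl memv_img ?memvf.
Qed.
Let ract_eq (x : X) a a' : f a = f a' -> ract x a = ract x a'.
Proof.
move=> E; apply/eqP; rewrite -subr_eq0 -ractBr; apply/eqP/kX.
by rewrite /kf (lin_sub (alghom_lin f)) E subrr.
Qed.
Let act (x : X) (b : B) := ract x (sec b).
Fact descent_linl b : linear (act^~ b).
Proof. exact: ract_linl. Qed.
Fact descent_linr x : linear (act x).
Proof.
move=> k b b'; rewrite /act -ract_linr; apply: ract_eq.
by rewrite alghom_lin !secK.
Qed.
Fact descent1 x : act x (aone B) = x.
Proof. by rewrite -[RHS](@ract1 _ A) /act; apply: ract_eq; rewrite secK alghom1. Qed.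
Fact descentM x b b' : act x (b ** b') = act (act x b) b'.
Proof. by rewrite /act -ractM; apply: ract_eq; rewrite alghomM !secK. Qed.
Definition descent : rmodule B :=
  RModule descent_linl descent_linr descent1 descentM.

Lemma descent_iso : iso (res descent) X.
Proof.
have gh : @is_rhom K A (res descent) X \1%VF.
  move=> x a; rewrite !id_lfunE /= /act; apply: ract_eq; exact: secK.
have hh : @is_rhom K A X (res descent) \1%VF.
  by move=> x a; rewrite !id_lfunE /= /act; apply: ract_eq; rewrite secK.
by exists (Hom gh), (Hom hh); split=> x; rewrite /= !id_lfunE.
Qed.
End DescentModule.

Lemma descend (X : rmodule A) : killed kf X -> exists X', iso (res X') X.
Proof. by move=> kX; exists (descent kX); apply: descent_iso. Qed.

Lemma iso_res (M N : rmodule B) : iso (res M) (res N) <-> iso M N.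
Proof.
split=> -[g [h [gh hg]]].
  have [g' gE] := hom_unres g; have [h' hE] := hom_unres h.
  by exists g', h'; split=> m; rewrite ?gE ?hE ?gE.
have [g' gE] := hom_res g; have [h' hE] := hom_res h.
by exists g', h'; split=> m; rewrite ?gE ?hE ?gE.
Qed.

Lemma retract_res (M N : rmodule B) : retract (res M) (res N) <-> retract M N.
Proof.
split=> -[g [h gh]].
  have [g' gE] := hom_unres g; have [h' hE] := hom_unres h.
  by exists g', h' => m; rewrite gE hE.
have [g' gE] := hom_res g; have [h' hE] := hom_res h.
by exists g', h' => m; rewrite gE hE.
Qed.

Lemma split_dsum_res (M X Y : rmodule B) :
  split_dsum (res M) (res X) (res Y) <-> split_dsum M X Y.
Proof.
split=> -[i [p [j [q [pi qj ij]]]]].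
  have [i' iE] := hom_unres i; have [p' pE] := hom_unres p.
  have [j' jE] := hom_unres j; have [q' qE] := hom_unres q.
  by exists i', p', j', q'; split=> m; rewrite ?iE ?pE ?jE ?qE ?iE ?jE //; apply: ij.
have [i' iE] := hom_res i; have [p' pE] := hom_res p.
have [j' jE] := hom_res j; have [q' qE] := hom_res q.
by exists i', p', j', q'; split=> m; rewrite ?iE ?pE ?jE ?qE ?iE ?jE //; apply: ij.
Qed.

Lemma zero_res (M : rmodule B) : zero_module (res M) <-> zero_module M.
Proof. by []. Qed.

Lemma retract_descend (X : rmodule A) (M : rmodule B) : retract X (res M) ->
  exists2 X', iso (res X') X & retract X' M.
Proof.
move=> r; have [X' i] := descend (killed_retract r (@killed_res M)).
by exists X' => //; apply/retract_res/(retract_trans (iso_retract i)).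
Qed.

Lemma indec_res (M : rmodule B) : indecomposable (res M) <-> indecomposable M.
Proof.
split=> /indecP[nz sp]; apply/indecP; split=> // X Y s.
  by have := sp (res X) (res Y); apply; apply/split_dsum_res.
have [X' iX _] := retract_descend (split_dsum_retract s).
have [Y' iY _] := retract_descend (split_dsum_retract (split_dsum_sym s)).
have {}s : split_dsum (res M) (res X') (res Y').
  apply: split_dsum_isor (iso_sym iY) _; apply: split_dsum_sym.
  by apply: split_dsum_isor (iso_sym iX) _; apply: split_dsum_sym.
have zi U V : iso U V -> zero_module U -> @zero_module K A V.
  move=> [g [h [_ gh]]] /zero_modP z; apply/zero_modP => v.
  by rewrite -(gh v) (z (h v)) hom0.
by move/split_dsum_res: s => /sp[/zero_res|/zero_res]; [left; apply: zi iX _ |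
  right; apply: zi iY _].
Qed.

Lemma num_indec_res (M : rmodule B) k : num_indec (res M) k <-> num_indec M k.
Proof.
split=> -[F [F1 F2 F3]].
  have /fin_all_exists[G GP] i : exists X', iso (res X') (F i) /\ retract X' M.
    have [_ /summandP r] := F1 i; have [X' i1 i2] := retract_descend r.
    by exists X'.
  exists G; split=> [i|i j /risomP ij|X /indec_res iX /summandP rX].
  - have [i1 i2] := GP i; split; last exact/summandP.
    by apply/indec_res/(indec_iso (iso_sym i1)); case: (F1 i).
  - have [[i1 _] [j1 _]] := (GP i, GP j); apply/F2/risomP.
    apply: iso_trans (iso_sym i1) (iso_trans _ j1); exact/iso_res.
  have [|i /risomP i1] := F3 (res X) iX; first by apply/summandP/retract_res.
  exists i; have [i2 _] := GP i; apply/risomP/iso_res.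
  exact: iso_trans i1 (iso_sym i2).
exists (fun i => res (F i)); split=> [i|i j /risomP/iso_res/risomP/F2 //|X iX /summandP rX].
  by have [iF /summandP rF] := F1 i; split; [apply/indec_res|apply/summandP/retract_res].
have [X' i1 /summandP r] := retract_descend rX.
have [|i /risomP i2] := F3 X' _ r; first exact/indec_res/(indec_iso (iso_sym i1)).
exists i; apply/risomP/(iso_trans (iso_sym i1)); exact/iso_res.
Qed.

Lemma dsum2_res (X Y : rmodule B) : iso (dsum2 (res X) (res Y)) (res (dsum2 X Y)).
Proof.
have s : split_dsum (res (dsum2 X Y)) (res X) (res Y).
  exact/split_dsum_res/split_dsum_dsum2.
by apply: iso_sym; apply/risomP/split_dsumP.
Qed.

Lemma basic_res (M : rmodule B) : basic (res M) <-> basic M.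
Proof.
split=> bM X iX /summandP r.
  apply: (bM (res X)); first exact/indec_res.
  apply/summandP/(retract_trans (iso_retract (dsum2_res X X))); exact/retract_res.
have [X' i1 _] : exists2 X', iso (res X') X & retract X' M.
  apply: retract_descend; apply: retract_trans r.
  exact: split_dsum_retract (split_dsum_dsum2 X X).
apply: (bM X'); first exact/indec_res/(indec_iso (iso_sym i1)).
apply/summandP/retract_res/(retract_trans _ r)/iso_retract.
apply: iso_trans (iso_sym (dsum2_res _ _)) _.
exact: (split_dsum_unique (split_dsum_dsum2 _ _) (split_dsum_dsum2 _ _) i1 i1).
Qed.

Lemma gen_res (M N : rmodule B) : gen (res M) (res N) <-> gen M N.
Proof.
split=> h n; elim: (h n) => [|g m y _ _ IH].
- exact: span0.
- by have [g' gE] := hom_unres g; rewrite -[g m]gE; apply: span_cons.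
- exact: span0.
by have [g' gE] := hom_res g; rewrite -[g m]gE; apply: span_cons.
Qed.

(** Restriction identifies B-modules with the A-modules killed by ker f, homomorphisms included, so
    vanishing of Ext relative to ker f is absolute vanishing over B. *)
Lemma extfree_res (N : rmodule B) :
  extfree kf (res N) <-> extfree (fun=> False) N.
Proof.
split=> eN Y Z g kY gS gk h.
  have [g' gE] := hom_res g; have [h' hE] := hom_res h.
  have [| |y gy|e eE] := eN (res Y) (res Z) g' _ _ _ h'.
  - exact: killed_res.
  - by move=> z; have [y <-] := gS z; exists y; rewrite gE.
  - have /gk : g y = 0 by rewrite -gE.
    elim=> [|u m v gu _ IH]; first exact: span0.
    have [u' uE] := hom_res u; rewrite -[u m]uE; apply: span_cons => // m'.
    by rewrite gE uE gu.
  have [e' e'E] := hom_unres e; exists e' => m.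
  by rewrite e'E -gE eE hE.
have [Y' [u [u' [u'u uu']]]] := descend kY.
have [Z' [v [v' [v'v vv']]]] := descend (killed_surj gS kY).
have [g' gE] := hom_unres (hcomp v' (hcomp g u)).
have [h' hE] := hom_unres (hcomp v' h).
have [| |y gy|e eE] := eN Y' Z' g' _ _ _ h'; first by [].
- move=> z; have [y gy] := gS (v z); exists (u' y).
  by rewrite gE !homE uu' gy v'v.
- have : g (u y) = 0 by move: gy; rewrite gE !homE => E; rewrite -(vv' (g _)) E hom0.
  move=> /gk s; rewrite -(u'u y); move: (u y) s => z.
  elim=> [|w m x gw _ IH]; first by rewrite hom0; apply: span0.
  have [w' wE] := hom_unres (hcomp u' w).
  rewrite homD -[u' (w m)]hcompE -[hcomp u' w m]wE; apply: span_cons => // m'.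
  by rewrite gE !homE wE homE uu' gw hom0.
have [e' e'E] := hom_res e; exists (hcomp u e') => m; rewrite homE e'E.
have := congr1 v (eE m); rewrite gE hE !homE !vv' => E; exact: E.
Qed.

Lemma red_regular : exists t : regular A ~> res (regular B),
  (forall a, t a = f a) /\ red kf t.
Proof.
have [||t tE] := @mkhom K A (regular A) (res (regular B)) f.
- exact: alghom_lin.
- exact: alghomM.
exists t; split=> //; split=> [b||Y g kY].
- by have [a <-] := fS b; exists a.
- exact: killed_res.
apply: fac_epi => [b|a ta]; first by have [a <-] := fS b; exists a.
rewrite -[a]amul1l -[_ ** _]/(ract (aone A : regular A) a) homP.
by apply: kY; rewrite /kf -tE.
Qed.

Lemma red_free n : exists t : free_mod A n ~> res (free_mod B n), red kf t.
Proof.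
have [||t tE] := @mkhom K A (free_mod A n) (res (free_mod B n))
    (fun v => [ffun i => f (v i)] : free_mod B n).
- move=> k u v; apply/ffunP => i; rewrite dffunD dffunZ !ffunE.
  by rewrite alghom_lin.
- by move=> v a; apply/ffunP => i; rewrite !ffunE alghomM.
have tS : surj t.
  move=> b; have /fin_all_exists[v vE] i : exists a, f a = b i by apply: fS.
  by exists [ffun i => v i]; rewrite tE; apply/ffunP => i; rewrite !ffunE.
exists t; split=> // [|Y g kY]; first exact: killed_res.
apply: fac_epi => // v tv; have [e eE] := dsum_hom_sum g.
rewrite eE big1 // => i _.
rewrite -[v i]amul1l -[_ ** _]/(ract (aone A : regular A) (v i)) homP.
apply: kY; have := congr1 (fun w : free_mod B n => w i) tv.
by rewrite tE !ffunE.
Qed.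

(** Used with g : B -> B/(f e): the kernel of g f is then the ideal generated by ker f and e, which
    is expressed here through the modules that it kills. *)
Lemma killed_res_comp (C : fdalgebra K) (g : algHom B C) (e : A) :
  (forall M, killed (fun b => g b = 0) M <-> killed (fun b => b = f e) M) ->
  forall M : rmodule A, killed (fun a => g (f a) = 0) M <->
    killed (fun a => kf a \/ a = e) M.
Proof.
move=> ge M; split=> kM a.
  have ge0 : g (f e) = 0.
    have [_ h] := ge (restriction g (regular C)).
    have k0 : killed (fun b => g b = 0) (restriction g (regular C)).
      by move=> b gb m; rewrite /= gb (lin0 (amul_linr _)).
    have /ge/(_ (f e) (erefl _) (aone C)) := k0.
    by rewrite /= amul1l.
  move=> [fa|->] m; apply: kM => //.
  by rewrite fa (lin0 (alghom_lin g)).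
have [|M' [u [u' [u'u uu']]]] := @descend M; first by move=> x fx; apply: kM; left.
have /ge k' : killed (fun b => b = f e) M'.
  move=> b -> m; apply: (can_inj u'u); rewrite hom0 -[LHS]/(u (ract (m : res M') e)) homP.
  by apply: kM; right.
move=> gfa m; rewrite -(uu' m) -homP -[ract _ a]/(ract (u' m : M') (f a)) k' //.
exact: hom0.
Qed.

End Descent.

Lemma quot_hom_surj (K : fieldType) (A : fdalgebra K) (I : ideal A) : surj (quot_hom I).
Proof. by move=> b; exists (vsval b); apply: qprojK. Qed.

Lemma killed_quot (K : fieldType) (A : fdalgebra K) (e : A) (M : rmodule A) :
  killed (fun a => quot_hom (gen_ideal e) a = 0) M <-> killed (fun a => a = e) M.
Proof.
have kE a : quot_hom (gen_ideal e) a = 0 <-> a \in gen_ideal_vs e.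
  by rewrite -[_ \in _](@qproj_eq0 _ _ (gen_ideal e)); split=> /eqP.
split=> kM a.
  move=> -> m; apply: kM; apply/kE.
  by have := mem_gen_ideal e (aone A) (aone A); rewrite amul1l amul1r.
move=> /kE ae m; apply/eqP.
have l : linear (fun a : A => ract m a) by exact: ract_linr.
rewrite -[ract m a](linfunE l) -memv_ker; apply: (subvP _ _ ae).
apply: gen_ideal_ind => x y; by rewrite memv_ker linfunE // !ractM (kM e (erefl e)) ract0.
Qed.

(** * The tensor product as a largest killed quotient *)

Section TensorReduction.
Variables (K : fieldType) (A B : fdalgebra K) (f : algHom A B) (U : rmodule A).
Hypothesis fS : surj f.

(** The map u |-> u (x) 1 is onto, because u (x) f(a) = u a (x) 1. A map g from U to a module killed
    by ker f, that is, to a B-module, yields the balanced map (u, b) |-> g(u) b and hence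
    factors. *)
Lemma red_tensor : exists t : U ~> restriction f (tensor f U), red (fun a => f a = 0) t.
Proof.
have [||t tE] := @mkhom K A U (restriction f (tensor f U)) (fun u => tens f u (aone B)).
- by move=> k u v; apply: tens_linl.
- by move=> u a; rewrite /= tens_balanced -[RHS]/(ract (tens f u (aone B)) (f a))
    tensM amul1r amul1l.
have tS : surj t.
  move=> x; have : (x : tensor f U) = x by [].
  rewrite -{2}(qprojK x); set w := vsval x => ->.
  have -> : w = \sum_(i < \dim {: U}) ktensor (vbasis {: U})`_i (w i).
    apply/ffunP => i; rewrite dsum_sumE (bigD1 i) //= ffunE coord_free;
      last exact: (basis_free (vbasisP _)).
    rewrite eqxx scale1r big1 ?addr0 // => j ji; rewrite ffunE coord_free.
      by rewrite (negbTE ji) scale0r.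
    exact: (basis_free (vbasisP _)).
  have /fin_all_exists[a aE] i : exists a, f a = w i by apply: fS.
  exists (\sum_(i < \dim {: U}) ract (vbasis {: U})`_i (a i)).
  rewrite hom_sum (lin_sum (@qproj_lin _ _ _)); apply: eq_bigr => i _.
  by rewrite tE tens_balanced amul1r aE.
exists t; split=> // [|Y g kY]; first exact: killed_res.
have [Y' [v [v' [v'v vv']]]] := descend fS kY.
have [||| h [hE _]] := @tensor_universal K A B f U Y' (fun u b => ract (v' (g u) : Y') b).
- by move=> b k x y; rewrite !linearP ract_linl.
- by move=> u k x y; rewrite ract_linr.
- by move=> u a b; rewrite ractM !homP.
have hh : @is_rhom K A (restriction f (tensor f U)) (restriction f Y') h.
  move=> x a; have [u <-] := tS x.
  by rewrite -[ract (t u) a]homP !tE !hE homP homP /= !ract1.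
exists (hcomp v (Hom hh)) => u; rewrite homE tE -[Hom hh _]/(h _) hE ract1.
exact: vv'.
Qed.

End TensorReduction.

(** * Lifting modules and the reduction theorem *)

Section LiftModule.
Variables (K : fieldType) (A : fdalgebra K) (c : A) (nc : nat).
Hypothesis cC : forall a : A, c ** a = a ** c.
Hypothesis c_nil : iter nc (amul c) (aone A) = 0.
Let isc (a : A) := a = c.
Let B := quot_alg (gen_ideal c).
Let f : algHom A B := quot_hom (gen_ideal c).
Let fS : surj f := @quot_hom_surj K A (gen_ideal c).
Let kf (a : A) := f a = 0.
Local Notation res := (restriction f).

Let red_kf U T (t : U ~> T) : red kf t <-> red isc t.
Proof. by split; apply: red_ext => Y; split=> /killed_quot. Qed.

(** P is a summand of B^n, which is the reduction of A^n; [retract_lift] applies to A^n because free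
    modules have no extensions. *)
Lemma lift_projective (P : rmodule B) : dual_basis P ->
  exists Q (t : Q ~> res P), dual_basis Q /\ red isc t.
Proof.
move=> dP; have [n [g gS]] := free_cover P.
have rP := projective_retract (dual_basis_projective dP) gS.
have [u ru] := red_free fS n.
have [] := @retract_lift K A c nc cC c_nil (fun=> False) _ _ u (res P).
- exact: dual_basis_extfree (free_dual_basis A n).
- by [].
- exact/red_kf.
- exact/(retract_res fS).
move=> Q [t [rQ rt]]; exists Q, t; split=> //.
exact: dual_basis_retract rQ (free_dual_basis A n).
Qed.

Lemma lift_module (N0 : rmodule A) : killed isc N0 -> extfree isc N0 ->
  exists N (s : N ~> N0), red isc s /\ extfree (fun=> False) N.
Proof.
move=> kN0 eN0.
have [|N' iN] := @descend K A B f fS N0; first exact/killed_quot.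
have eN' : extfree (fun=> False) N'.
  apply/(extfree_res fS)/(extfree_iso iN); apply: extfree_weaken eN0 => Y.
  by move=> /killed_quot.
have [P1 [P0 [d [p [[dP1 dess] [dP0 _] pS pd]]]]] := min_presentation N'.
have ext := extfree_ext_pres eN' dP1 dess dP0 pS pd.
have [Q1 [t1 [dQ1 r1]]] := lift_projective dP1.
have [Q0 [t0 [dQ0 r0]]] := lift_projective dP0.
have [[t1S _ t1P] [t0S _ t0P]] := (r1, r0).
have [d' dE] := hom_res f d; have [p' pE] := hom_res f p.
have [D DE] : exists D : Q1 ~> Q0, forall x, t0 (D x) = hcomp d' t1 x.
  exact: dual_basis_lift.
have [N [q [qS qk]]] := coker_mod D.
have [s sE] : exists s : N ~> res N', forall y, s (q y) = hcomp p' t0 y.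
  apply: fac_epi => // y /qk[x <-]; rewrite homE DE homE pE dE.
  by apply/pd; exists (t1 x).
have sS : surj s.
  move=> z; have [y yz] := pS z; have [x xy] := t0S y; exists (q x).
  by rewrite sE homE xy pE.
have rs : red isc s.
  apply/red_kf; split=> // [|Y g kY]; first exact: killed_res.
  have kcY : killed isc Y by apply/killed_quot.
  have [g1 g1E] := t0P Y (hcomp g q) kcY.
  have [g2 g2E] : exists g2 : res N' ~> Y, forall y, g2 (p' y) = g1 y.
    apply: fac_epi => [z|y]; first by have [y <-] := pS z; exists y; rewrite pE.
    rewrite pE => /pd[x <-]; have [z zx] := t1S x.
    rewrite -[d x]dE -zx -[d' _]hcompE -DE g1E homE.
    by have /qk -> : exists z', D z' = D z by [exists z]; rewrite hom0.
  by exists g2 => n; have [y <-] := qS n; rewrite sE homE g2E g1E homE.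
(* al factors through D modulo c^k, for every k. *)
have extQ (al : Q1 ~> N) : exists be : Q0 ~> N, forall x, be (D x) = al x.
  suff: forall k, exists (be : Q0 ~> N) (ga : Q1 ~> N), forall x,
      al x = be (D x) + iter k (fun n => ract n c) (ga x).
    move=> /(_ nc)[be [ga E]]; exists be => x.
    by rewrite E (c_nilM c_nil) addr0.
  elim=> [|k [be [ga E]]].
    by exists (hzero Q0 N), al => x; rewrite homE add0r.
  (* Modulo c the error ga becomes a map P1 -> N', which extends along d to be2. With a lift be4 of
     be2, the difference ga - be4 D lands in Nc, and as Q1 is projective it is c times some ga'. *)
  have [ga1 ga1E] := t1P _ (hcomp s ga) (proj1 (killed_quot _ _) (@killed_res _ _ _ f N')).
  have [ga2 ga2E] := hom_unres fS ga1; have [be2 be2E] := ext ga2.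
  have [be3 be3E] := hom_res f be2.
  have [be4 be4E] : exists be4 : Q0 ~> N, forall y, s (be4 y) = hcomp be3 t0 y.
    exact: dual_basis_lift.
  have [cm cmE] := cmap_hom cC N.
  have [ga' gaE] : exists ga' : Q1 ~> N, forall x,
      cm (ga' x) = hsub ga (hcomp be4 D) x.
    apply: dual_basis_lift => // x.
    suff /(red_ker cC rs)[m mE] : s (hsub ga (hcomp be4 D) x) = 0.
      by exists m; rewrite cmE mE.
    rewrite !homE homB be4E homE DE homE be3E dE be2E ga2E ga1E homE.
    exact: subrr.
  exists (hadd be (hcomp (hpow cm k) be4)), ga' => x.
  have ck n : hpow cm k n = iter k (fun n => ract n c) n.
    by rewrite hpowE; apply: eq_iter.
  rewrite E !homE ck -addrA iterSr -cmE gaE !homE -!ck -homD.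
  by rewrite (addrC (be4 (D x))) subrK.
have eN : extfree (fun=> False) N.
  exact: (ext_pres_extfree (p := q) dQ1 dQ0 qS qk extQ).
have [u [u' [u'u uu']]] := iN.
exists N, (hcomp u s); split=> //; have [_ ks sP] := rs; split=> // [n|Y g kY].
  by have [m mE] := sS (u' n); exists m; rewrite homE mE uu'.
have [g' gE] := sP Y g kY; exists (hcomp g' u') => n.
by rewrite !homE u'u gE.
Qed.

End LiftModule.

(** * Support tau-tilting modules described over A itself *)

Section SupportTauTilting.
Variables (K : fieldType) (A : fdalgebra K).

Definition quot_regular (e : A) : rmodule A :=
  restriction (quot_hom (gen_ideal e)) (regular (quot_alg (gen_ideal e))).

(** By [extfree_idem], rigidity over A/(e) is rigidity over A for modules killed by e, so the
    reduction lemmas can be applied to M with S empty; A/(e) remains only in the number of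
    summands. *)
Lemma support_tau_tiltingP (M : rmodule A) : support_tau_tilting M <->
  exists e, [/\ e ** e = e, killed (fun a => a = e) M, extfree (fun=> False) M &
    exists k, num_indec M k /\ num_indec (quot_regular e) k].
Proof.
have qS (e : A) := @quot_hom_surj K A (gen_ideal e).
split=> -[e].
  move=> [ee [N [[/tau_rigidP eN [k [Nk Ak]]] /risomP i]]].
  have kM : killed (fun a => a = e) M.
    have [u [u' [uu' u'u]]] := i; apply/killed_quot.
    by apply: (killed_surj (f := u')) (@killed_res _ _ _ _ _) => m; exists (u m).
  exists e; split=> //.
  - apply: (extfree_idem ee); first by move=> a [//|]; apply: kM.
    apply: (extfree_iso i); move/(extfree_res (qS e)): eN; apply: extfree_weaken => Y kY.
    by apply/killed_quot => a ae; apply: kY; right.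
  exists k; split; last exact/(num_indec_res (qS e)).
  by apply: (num_indec_iso (iso_sym i)); apply/(num_indec_res (qS e)).
move=> [ee kM eM [k [Mk Ak]]]; exists e; split=> //.
have [|N i] := @descend K A _ _ (qS e) M; first exact/killed_quot.
exists N; split; last exact/risomP/iso_sym.
split.
  apply/tau_rigidP/(extfree_res (qS e))/(extfree_iso i).
  by apply: extfree_weaken eM => Y _ a [].
exists k; split; apply/(num_indec_res (qS e)) => //.
exact: num_indec_iso (iso_sym i) Mk.
Qed.

End SupportTauTilting.

Section RestrictionComp.
Variables (K : fieldType) (A B C : fdalgebra K) (f : algHom A B) (g : algHom B C).

Lemma alg_comp_lin : linear (g \o f).
Proof. by move=> k x y; rewrite /= !alghom_lin. Qed.
Lemma alg_comp1 : (g \o f) (aone A) = aone C.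
Proof. by rewrite /= !alghom1. Qed.
Lemma alg_compM x y : (g \o f) (x ** y) = (g \o f) x ** (g \o f) y.
Proof. by rewrite /= !alghomM. Qed.
Definition alg_comp : algHom A C := AlgHom alg_comp_lin alg_comp1 alg_compM.

Lemma restriction_comp (M : rmodule C) :
  iso (restriction alg_comp M) (restriction f (restriction g M)).
Proof.
have h1 : @is_rhom K A (restriction alg_comp M) (restriction f (restriction g M)) \1%VF.
  by move=> m a; rewrite !id_lfunE.
have h2 : @is_rhom K A (restriction f (restriction g M)) (restriction alg_comp M) \1%VF.
  by move=> m a; rewrite !id_lfunE.
by exists (Hom h1), (Hom h2); split=> m; rewrite /= !id_lfunE.
Qed.

End RestrictionComp.

Lemma red_join (K : fieldType) (A : fdalgebra K) (S T : A -> Prop)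
    (U V W : rmodule A) (u : U ~> V) (v : V ~> W) :
  red S u -> red T v -> red (fun a => S a \/ T a) (hcomp v u).
Proof.
move=> [uS kV uP] [vS kW vP]; split=> [y||Y f kY].
- by have [x <-] := vS y; have [z <-] := uS x; exists z; rewrite homE.
- by move=> a [Sa|Ta]; [apply: killed_surj vS kV a Sa | apply: kW].
have kS : killed S Y by move=> a Sa; apply: kY; left.
have kT : killed T Y by move=> a Ta; apply: kY; right.
have [f1 f1E] := uP Y f kS; have [f2 f2E] := vP Y f1 kT.
by exists f2 => z; rewrite homE f2E f1E.
Qed.

(* The Fitting decomposition of left multiplication by a preimage of e0 gives e. *)
Lemma lift_idempotent (K : fieldType) (A B : fdalgebra K) (f : algHom A B) (e0 : B) :
  surj f -> e0 ** e0 = e0 -> exists e : A, e ** e = e /\ f e = e0.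
Proof.
move=> fS ee0; have [x fx] := fS e0.
have [||g gE] := @mkhom K A (regular A) (regular A) (fun a => x ** a).
- exact: amul_linr.
- by move=> a b; rewrite /= amulA.
have fg n a : (0 < n)%N -> f (iter n g a) = e0 ** f a.
  case: n => // n _; elim: n => [|n IH]; first by rewrite /= gE alghomM fx.
  by rewrite iterS gE alghomM fx IH amulA ee0.
have [n [X [i [p [n0 pi pk i1 i2]]]]] := fitting g.
pose e : A := i (p (aone A)); exists e.
have ea a : i (p a) = e ** a.
  by rewrite -{1}[a]amul1l -[_ ** a]/(ract (aone A : regular A) a) !homP.
split; first by rewrite -ea pi.
have [u uE] := i1 (p (aone A)).
have e1 : e0 ** f e = f e by rewrite /e uE fg // amulA ee0.
have /pk E : p (aone A - e) = 0 by rewrite homB pi subrr.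
have := fg n (aone A - e) n0; rewrite E (lin0 (alghom_lin f)).
rewrite (lin_sub (alghom_lin f)) (lin_sub (amul_linr _)) alghom1 amul1r e1.
by move=> /esym/eqP; rewrite subr_eq0 => /eqP.
Qed.

(** * Reduction along a surjection with kernel in cA *)

Section Reduction.
Variables (K : fieldType) (A B : fdalgebra K) (f : algHom A B) (c : A) (nc : nat).
Hypothesis fS : surj f.
Hypothesis cC : forall a : A, c ** a = a ** c.
Hypothesis c_nil : iter nc (amul c) (aone A) = 0.
Hypothesis kerf : forall a, f a = 0 -> exists b, a = c ** b.
Let isc (a : A) := a = c.
Let kf (a : A) := f a = 0.
Local Notation res := (restriction f).

Let killed_c (M : rmodule A) : killed isc M -> killed kf M.
Proof. by move=> kM a /kerf[b ->] m; rewrite ractM (kM c (erefl c)) ract0. Qed.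

Lemma quot_regular_extfree (C : fdalgebra K) (g : algHom A C) : surj g ->
  extfree (fun a => g a = 0) (restriction g (regular C)).
Proof.
move=> gS; apply/(extfree_res gS); apply: dual_basis_extfree.
exists 1%N, (fun=> aone C), (fun=> hid _) => x.
by rewrite big_ord1 homE /= amul1l.
Qed.

(** Both modules have the reduction A/(e, c), because ker f lies in cA. Each is projective over its
    own factor algebra, so it has as many indecomposable summands as its reduction. *)
Lemma num_indec_quot_regular (e : A) k :
  num_indec (quot_regular e) k <-> num_indec (quot_regular (f e)) k.
Proof.
pose q := quot_hom (gen_ideal e); pose g := quot_hom (gen_ideal (f e)).
have qS : surj q by apply: quot_hom_surj.
have gS : surj g by apply: quot_hom_surj.
pose gf := alg_comp f g; have gfS : surj gf by apply: surj_comp fS gS.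
have [u [_ ru]] := red_regular qS; have [v [_ rv]] := red_regular gfS.
have [W [w rw]] := red_ex cC (quot_regular e).
have [W' [w' rw']] := red_ex cC (restriction gf (regular (quot_alg (gen_ideal (f e))))).
have W_iso : iso W W'.
  apply: red_unique (red_join ru rw) _; apply: red_ext (red_join rv rw') => M.
  have gP := @killed_res_comp K A B f fS _ g e (fun N => killed_quot (f e) N) M.
  split=> kM.
    have kc : killed isc M by move=> a ac; apply: kM; right.
    have kq : killed (fun a => q a = 0) M by move=> a qa; apply: kM; left.
    move=> a [ga|]; last exact: kc.
    apply: (proj2 gP) => // b [fb|be]; first exact: (killed_c kc).
    exact: (proj1 (killed_quot e M)).
  have kc : killed isc M by move=> a ac; apply: kM; right.
  have kg : killed (fun a => g (f a) = 0) M by move=> a ga; apply: kM; left.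
  move=> a [qa|]; last exact: kc.
  apply: (proj2 (killed_quot e M)) => // b be.
  by apply: (proj1 gP) => //; right.
have rc := restriction_comp f g (regular _).
rewrite (red_num_indec cC c_nil k (quot_regular_extfree qS) (@killed_res _ _ _ _ _) rw).
transitivity (num_indec (restriction gf (regular (quot_alg (gen_ideal (f e))))) k).
  rewrite (red_num_indec cC c_nil k (quot_regular_extfree gfS) (@killed_res _ _ _ _ _) rw').
  by split; apply: num_indec_iso => //; apply: iso_sym.
rewrite -(num_indec_res fS).
by split; apply: num_indec_iso => //; apply: iso_sym.
Qed.

(** Modules killed by c are killed by ker f, so U -> U/Uc factors through U (x) B, and W = U/Uc is
    the reduction of both. *)
Lemma tensor_red (U : rmodule A) : extfree (fun=> False) U ->
  exists W (t : U ~> res (tensor f U)) (w : U ~> W) (w' : res (tensor f U) ~> W),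
  [/\ red kf t, red isc w, red isc w' & extfree kf (res (tensor f U))].
Proof.
move=> eU; have [t rt] := red_tensor U fS.
have [W [w' rw']] := red_ex cC (res (tensor f U)).
exists W, t, (hcomp w' t), w'; split=> //; first exact: red_comp rt rw'.
by apply: red_extfree rt _; apply: extfree_weaken eU => Y _ a [].
Qed.

Lemma killed_False (M : rmodule A) : killed (fun=> False) M.
Proof. by move=> a []. Qed.

Lemma tensor_stau_tilt (U : rmodule A) : stau_tilt U -> stau_tilt (tensor f U).
Proof.
move=> [/support_tau_tiltingP[e [ee kU eU [k [Uk Ak]]]] bU].
have [W [t [w [w' [rt rw rw' eT]]]]] := tensor_red eU.
have kU0 := @killed_False U; have kT := @killed_res _ _ _ f (tensor f U).
split.
  apply/support_tau_tiltingP; exists (f e); split.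
  - by rewrite -alghomM ee.
  - move=> _ -> x; have [tS _ _] := rt; have [u <-] := tS x.
    by rewrite -[LHS]/(ract (t u) e) -homP kU // hom0.
  - exact/(extfree_res fS).
  exists k; split; last exact/num_indec_quot_regular.
  apply/(num_indec_res fS)/(red_num_indec cC c_nil k eT kT rw').
  exact/(red_num_indec cC c_nil k eU kU0 rw).
apply/(basic_res fS)/(red_basic cC c_nil eT kT rw').
exact/(red_basic cC c_nil eU kU0 rw).
Qed.

Lemma tensor_iso (U V : rmodule A) : stau_tilt U -> stau_tilt V ->
  risom U V <-> risom (tensor f U) (tensor f V).
Proof.
move=> [/support_tau_tiltingP[e [_ _ eU _]] _] [/support_tau_tiltingP[e' [_ _ eV _]] _].
have [W [t [w [w' [rt rw rw' _]]]]] := tensor_red eU.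
have [W1 [t1 [w1 [w1' [rt1 rw1 rw1' _]]]]] := tensor_red eV.
split=> /risomP i; apply/risomP.
  exact/(iso_res fS)/(red_map_iso rt rt1).
apply: (red_iso cC c_nil eU (@killed_False U) eV (@killed_False V) rw rw1).
by apply: (red_map_iso rw' rw1'); apply/(iso_res fS).
Qed.

Lemma tensor_gen_le (U V : rmodule A) : stau_tilt U -> stau_tilt V ->
  gen_le U V <-> gen_le (tensor f U) (tensor f V).
Proof.
move=> [/support_tau_tiltingP[e [_ _ eU _]] _] [/support_tau_tiltingP[e' [_ _ eV _]] _].
have [W [t [w [w' [rt rw rw' _]]]]] := tensor_red eU.
have [W1 [t1 [w1 [w1' [rt1 rw1 rw1' _]]]]] := tensor_red eV.
rewrite !gen_leP; split=> VU.
  exact/(gen_res fS)/(red_gen rt1 rt).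
apply: (red_gen_lift cC c_nil eV (@killed_False U) rw1 rw).
by apply: (red_gen rw1' rw'); apply/(gen_res fS).
Qed.

(** T/Tc is lifted to a rigid N over A. Then N (x) B and T are both rigid relative to ker f with the
    same reduction T/Tc, so [red_iso] identifies them. The idempotent for N is a lift of the one for
    T. *)
Lemma tensor_stau_tilt_onto (T : rmodule B) : stau_tilt T ->
  exists2 U, stau_tilt U & risom (tensor f U) T.
Proof.
move=> [/support_tau_tiltingP[e0 [ee0 kT eT [k [Tk Bk]]]] bT].
have [e [ee fe]] := lift_idempotent fS ee0.
have eT' : extfree kf (res T) by apply/(extfree_res fS).
have kT' := @killed_res _ _ _ f T.
have [N0 [w rw]] := red_ex cC (res T).
have kN0 : killed isc N0 by case: rw.
have [||N [s [rs eN]]] := @lift_module K A c nc cC c_nil N0 => //.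
  by apply: red_extfree rw _; apply: extfree_weaken eT' => Y; apply: killed_c.
have kN := @killed_False N.
have sN : stau_tilt N.
  split.
    apply/support_tau_tiltingP; exists e; split=> //.
      move=> _ ->; have [wS _ _] := rw.
      have ke0 x : ract (x : N0) e = 0.
        by have [y <-] := wS x; rewrite -homP -[ract y e]/(ract (y : T) (f e))
          fe (kT e0 (erefl e0)) hom0.
      apply: (nakayama_ind cC c_nil rs) => [|u v ue ve|u ue|n].
      - exact: ract0.
      - by rewrite ractD ue ve addr0.
      - by rewrite -ractM cC ractM ue ract0.
      (* n - n e is killed by the idempotent e and has the same image as n, since e kills N0 =
         T/Tc. *)
      exists (n - ract n e); first by rewrite ractB -ractM ee subrr.
      by rewrite homB homP ke0 subr0.
    exists k; split; last by apply/num_indec_quot_regular; rewrite fe.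
    apply/(red_num_indec cC c_nil k eN kN rs)/(red_num_indec cC c_nil k eT' kT' rw).
    exact/(num_indec_res fS).
  apply/(red_basic cC c_nil eN kN rs)/(red_basic cC c_nil eT' kT' rw).
  exact/(basic_res fS).
exists N => //; have [W [t [w1 [w1' [rt rw1 rw1' eN']]]]] := tensor_red eN.
apply/risomP/(iso_res fS).
apply: (red_iso cC c_nil eN' (@killed_res _ _ _ _ _) eT' kT' rw1' rw).
exact: red_unique rw1 rs.
Qed.

End Reduction.

(** * The Auslander algebra and the preprojective algebra *)

Section SubAlgebra.
Variables (K : fieldType) (A : fdalgebra K) (W : {vspace A}).
Hypothesis W1 : aone A \in W.
Hypothesis WM : forall x y : A, x \in W -> y \in W -> x ** y \in W.
Let V : vectType K := subvs_of W.
Let mul (x y : V) : V := vsproj W ((vsval x : A) ** vsval y).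
Let one : V := vsproj W (aone A).

Let val_lin k (x y : V) : vsval (k *: x + y) = k *: vsval x + vsval y.
Proof. exact: linearP. Qed.
Fact sub_mulE x y : vsval (mul x y) = (vsval x : A) ** vsval y.
Proof. by rewrite vsprojK // WM ?subvsP. Qed.
Fact sub_oneE : vsval one = aone A.
Proof. by rewrite vsprojK. Qed.
Fact sub_linl y : linear (mul^~ y).
Proof.
move=> k u v; apply: val_inj; rewrite [LHS]sub_mulE [RHS]val_lin !sub_mulE val_lin.
exact: (amul_linl (vsval y)).
Qed.
Fact sub_linr x : linear (mul x).
Proof.
move=> k u v; apply: val_inj; rewrite [LHS]sub_mulE [RHS]val_lin !sub_mulE val_lin.
exact: (amul_linr (vsval x : A)).
Qed.
Fact sub_mul1 : left_id one mul.
Proof. by move=> x; apply: val_inj; rewrite [LHS]sub_mulE sub_oneE amul1l. Qed.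
Fact sub_1mul : right_id one mul.
Proof. by move=> x; apply: val_inj; rewrite [LHS]sub_mulE sub_oneE amul1r. Qed.
Fact sub_mulA : associative mul.
Proof.
move=> x y z; apply: val_inj.
by rewrite [LHS]sub_mulE [RHS]sub_mulE !sub_mulE amulA.
Qed.

Definition sub_alg : fdalgebra K :=
  FDAlgebra (AlgStruct sub_linl sub_linr sub_mul1 sub_1mul sub_mulA).

Definition sub_incl : algHom sub_alg A :=
  @AlgHom K sub_alg A (fun x : V => vsval x) val_lin sub_oneE sub_mulE.

End SubAlgebra.

Section Quivers.
Variables (K : fieldType) (n : nat).

Lemma auslander_rel_hom (A B : algebra K) (f : algHom A B) (e a b : nat -> A) :
  auslander_rel n e a b ->
  auslander_rel n (f \o e) (f \o a) (f \o b).
Proof.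
move=> [[ee es ea eb] ab1 ab].
have f0 : f 0 = 0 := lin0 (alghom_lin f).
split; first split.
- by move=> i j hi hj; rewrite /= -alghomM ee //; case: ifP.
- by rewrite -(alghom1 f) -es (lin_sum (alghom_lin f)).
- by move=> i hi; rewrite /= -!alghomM ea.
- by move=> i hi; rewrite /= -!alghomM eb.
- by move=> n1; rewrite /= -alghomM ab1.
by move=> i hi; rewrite /= -!alghomM ab.
Qed.

(* The endomorphism of Gam obtained from the universal property through the
   subalgebra W is the identity. *)
Lemma preprojective_gen (Gam : fdalgebra K) (e a b : nat -> Gam) (W : {vspace Gam}) :
  is_preprojective n e a b -> aone Gam \in W ->
  (forall x y : Gam, x \in W -> y \in W -> x ** y \in W) ->
  (forall i, (1 <= i <= n)%N -> e i \in W) ->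
  (forall i, (1 <= i < n)%N -> a i \in W) ->
  (forall i, (1 <= i < n)%N -> b i.+1 \in W) -> forall x, x \in W.
Proof.
move=> [[[[ee es ea eb] ab1 ab] ba] univ] W1 WM We Wa Wb x.
pose S := sub_alg W1 WM; pose P (y : Gam) : S := vsproj W y.
have [io [ioI [ioW PK]]] : exists io : algHom S Gam,
    injective io /\ (forall s, io s \in W) /\ (forall y, y \in W -> io (P y) = y).
  exists (sub_incl W1 WM); split; first exact: val_inj.
  by split=> [s|y yW]; [apply: subvsP | rewrite /= vsprojK].
have io0 : io 0 = 0 := lin0 (alghom_lin io).
have i_1 i : (1 <= i < n)%N -> (1 <= i.+1 <= n)%N by case/andP.
have i_0 i : (1 <= i < n)%N -> (1 <= i <= n)%N.
  by case/andP=> -> /ltnW.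
have rel : preprojective_rel n (P \o e) (P \o a) (P \o b).
  split; first split; first split.
  - move=> i j hi hj; apply: ioI; rewrite alghomM /= !PK ?We // ee //.
    by case: ifP; rewrite ?PK ?We.
  - apply: ioI; rewrite alghom1 (lin_sum (alghom_lin io)) -es.
    rewrite big_nat_cond [RHS]big_nat_cond; apply: eq_bigr => i /andP[hi _].
    by rewrite /= PK ?We.
  - by move=> i hi; apply: ioI; rewrite !alghomM /= !PK ?We ?Wa ?i_1 ?i_0 // ea.
  - by move=> i hi; apply: ioI; rewrite !alghomM /= !PK ?We ?Wb ?i_1 ?i_0 // eb.
  - by move=> n1; apply: ioI; rewrite alghomM io0 /= !PK ?Wa ?Wb ?ab1.
  - move=> [|[|i]] // hi; apply: ioI; rewrite !alghomM /= !PK ?Wa ?Wb ?ab //.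
    + by case/andP: hi => _ /ltnW.
    + by case/andP: hi => _ /ltnW.
  move=> n1; apply: ioI; rewrite alghomM io0 /= !PK ?ba //.
    by apply: Wa; case: (n) n1 => [|[|m]] //=.
  by case: (n) n1 Wb => [|[|m]] // _ Wb'; apply: Wb'; rewrite /= ltnSn.
have [h [[he ha hb] _]] := univ S _ _ _ rel.
have [f [_ funiq]] := univ Gam e a b (conj (And3 (And4 ee es ea eb) ab1 ab) ba).
pose idh : algHom Gam Gam := @AlgHom K Gam Gam id (fun k u v => erefl) erefl
  (fun u v => erefl).
have E1 := funiq idh (And3 (fun _ _ => erefl) (fun _ _ => erefl) (fun _ _ => erefl)).
have -> : x = io (h x).
  rewrite -[x in LHS]/(idh x) E1 -[io (h x)]/(alg_comp h io x) funiq //.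
  split=> i hi; rewrite /= ?he ?ha ?hb //= PK //;
    by [apply: We | apply: Wa | apply: Wb].
exact: ioW.
Qed.

End Quivers.

(** * Generators of the Auslander algebra and the element c *)

Section AuslanderGenerators.
Variables (K : fieldType) (n : nat).
Local Notation M := (trunc_sum K n).
Local Notation Lam := (auslander_alg K n).
Local Notation elt := (@trunc_elt K n).
Implicit Types (q r : {poly K}) (x : M).

Lemma trunc_mul_linq i j : linear (@trunc_mul K n i j).
Proof.
move=> k q r; apply/lfunP => x; apply/ffunP => m.
rewrite add_lfunE scale_lfunE dffunD dffunZ !trunc_mulE.
case: ifP => _; last by rewrite scaler0 addr0.
rewrite scaler_sumr -big_split; apply: eq_bigr => l _ /=.
by rewrite mulrDl -scalerAl linearP.
Qed.

Lemma trunc_elt_linq i j : linear (elt i j).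
Proof. by move=> k q r; rewrite /trunc_elt trunc_mul_linq linearP. Qed.

Lemma lam_eq (g h : Lam) : (forall x : M, vsval g x = vsval h x) -> g = h.
Proof. by move=> E; apply/val_inj/lfunP. Qed.

Lemma in_qpoly_id m (p : {poly %/ ('X^(m.+1) : {poly K})}) :
  in_qpoly 'X^(m.+1) (p : {poly K}) = p.
Proof.
apply: val_inj; rewrite /= Pdiv.CommonRing.rmodp_small //.
exact: size_mk_monic.
Qed.

Lemma in_qpoly_dvd m q : in_qpoly 'X^(m.+1) q = 0 -> 'X^(m.+1) %| q.
Proof.
move=> /(congr1 val) /=; rewrite mk_monic_Xn /= => E.
rewrite (Pdiv.RingMonic.rdivp_eq (monicXn K m.+1) q) E addr0.
exact: dvdp_mull.
Qed.

(** A predicate rather than a subspace, so that the agreement of two algebra maps can serve as P;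
    the unit is not listed, being the sum of the e_i. *)
Definition aus_gen (P : Lam -> Prop) :=
  [/\ P 0, forall k g h, P g -> P h -> P (k *: g + h),
      forall g h, P g -> P h -> P (g ** h) &
      [/\ forall i, (1 <= i <= n)%N -> P (aus_e K n i),
          forall i, (1 <= i < n)%N -> P (aus_a K n i) &
          forall i, (1 <= i < n)%N -> P (aus_b K n i.+1)]].

Section Closure.
Variable P : Lam -> Prop.
Hypothesis hP : aus_gen P.

(** Multiplication by x on K[x]/(x^(i+1)) is b_(i+1) a_i for i > 0, and it is zero for i = 0. *)
Lemma aus_gen_X i : (i < n)%N -> P (elt i.+1 i.+1 'X).
Proof.
case: hP => [P0 PD PM [Pe Pa Pb]].
case: i => [|i] hi.
  suff -> : elt 1 1 'X = 0 by [].
  have wd : trunc_wd 1 1 ('X : {poly K}) by rewrite /trunc_wd dvdp_mull.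
  apply: lam_eq => x; rewrite trunc_eltE //.
  rewrite [RHS](_ : _ = 0 :> M); last exact: zero_lfunE.
  apply/ffunP => k; rewrite trunc_mulE [RHS]ffunE; case: eqP => // -[k0].
  by rewrite big1 // => l _; rewrite k0 in_qpolyXn_eq0 // dvdp_mulr.
have : P (aus_b K n i.+2 ** aus_a K n i.+1).
  by apply: PM; [apply: Pb | apply: Pa].
rewrite /aus_a /aus_b /= trunc_elt_mul ?mulr1 ?trunc_wd1 ?trunc_wdX //.
by rewrite /= ltnW.
Qed.

Lemma aus_gen_poly i q : (i < n)%N -> P (elt i.+1 i.+1 q).
Proof.
case: (hP) => [P0 PD PM [Pe Pa Pb]] hi.
have e1 : P (elt i.+1 i.+1 1) by apply: Pe.
have PZ k g : P g -> P (k *: g) by move=> Pg; rewrite -[_ *: _]addr0; apply: PD.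
have wd r : trunc_wd i.+1 i.+1 r by rewrite /trunc_wd dvdp_mull.
elim/poly_ind: q => [|q c IH].
  by rewrite (lin0 (trunc_elt_linq _ _)).
rewrite -[q * 'X]scale1r (trunc_elt_linq _ _) -alg_polyC; apply: PD.
  by rewrite -(@trunc_elt_mul K n i.+1 i.+1 i.+1) //; apply: PM => //; apply: aus_gen_X.
by rewrite (lin_scale (trunc_elt_linq _ _)); apply: PZ.
Qed.

(** Products of arrows a are the canonical projections; products of arrows b, in the next lemma, are
    the inclusions by powers of x. *)
Lemma aus_gen_down i d : (i + d < n)%N -> P (elt (i + d).+1 i.+1 1).
Proof.
case: (hP) => [P0 PD PM [Pe Pa Pb]].
elim: d => [|d IH] hi; first by rewrite addn0 in hi *; apply: Pe.
have : P (elt (i + d).+1 i.+1 1 ** aus_a K n (i + d).+1).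
  by apply: PM; [apply: IH; apply: ltnW; rewrite -addnS | apply: Pa; rewrite /= -addnS].
rewrite /aus_a trunc_elt_mul ?mulr1 ?addnS ?trunc_wd1 //.
  by rewrite /= ltnW // -addnS.
by rewrite ltnS leq_addr.
Qed.

Lemma aus_gen_up i d : (i + d < n)%N -> P (elt i.+1 (i + d).+1 'X^d).
Proof.
case: (hP) => [P0 PD PM [Pe Pa Pb]].
elim: d => [|d IH] hi; first by rewrite addn0 expr0 in hi *; apply: Pe.
have wd : trunc_wd i.+1 (i + d).+1 ('X^d : {poly K}).
  by rewrite /trunc_wd -exprD addnS addnC.
have : P (aus_b K n (i + d).+2 ** elt i.+1 (i + d).+1 'X^d).
  by apply: PM; [apply: Pb; rewrite /= -addnS | apply: IH; apply: ltnW; rewrite -addnS].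
rewrite /aus_b trunc_elt_mul ?trunc_wdX //=; first by rewrite -exprS addnS.
by rewrite ltnW // -addnS.
Qed.

(** If j <= i, the map is multiplication by q on the source followed by the projection. Otherwise
    well-definedness forces x^(j-i) to divide q, and the cofactor acts before the inclusion by
    x^(j-i). *)
Lemma aus_gen_elt i j q : (i < n)%N -> (j < n)%N -> trunc_wd i.+1 j.+1 q ->
  P (elt i.+1 j.+1 q).
Proof.
case: (hP) => [P0 PD PM _] hi hj wd.
have wdi r : trunc_wd i.+1 i.+1 r by rewrite /trunc_wd dvdp_mull.
have [ji|ij] := leqP j i.
  have E : (j + (i - j))%N = i by rewrite subnKC.
  rewrite -[q]mul1r -(@trunc_elt_mul K n i.+1 i.+1 j.+1) ?trunc_wd1 //.
  by apply: PM; [rewrite -{1}E; apply: aus_gen_down; rewrite E | apply: aus_gen_poly].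
have E : (i + (j - i))%N = j by rewrite subnKC // ltnW.
have Xd : trunc_wd i.+1 j.+1 ('X^(j - i) : {poly K}).
  by rewrite /trunc_wd -exprD addnS addnC E.
have /dvdpP[r qE] : 'X^(j - i) %| q.
  move: wd; rewrite /trunc_wd -{1}E -addSn addnC exprD dvdp_mul2r //.
  by rewrite expf_eq0 polyX_eq0.
rewrite qE mulrC -(@trunc_elt_mul K n i.+1 i.+1 j.+1) //.
by apply: PM; [rewrite -{1}E; apply: aus_gen_up; rewrite E | apply: aus_gen_poly].
Qed.

(** A homomorphism out of K[x]/(x^(i+1)) is multiplication by the image q of 1, where [del] is 1
    placed in that summand; q is admissible because x^(i+1) kills [del]. *)
Lemma aus_corner (h : Lam) (i j : 'I_n) : exists2 q, trunc_wd i.+1 j.+1 q &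
  aus_e K n j.+1 ** h ** aus_e K n i.+1 = elt i.+1 j.+1 q.
Proof.
pose f := vsval h; have fh : is_rhom f by apply/rhomsP/subvsP.
pose del : M := [ffun l : 'I_n => if l == i then 1 else 0].
pose y : M := f del; pose q : {poly K} := y j.
have yact p : f (ract del p) = ract y p by rewrite fh.
have wd : trunc_wd i.+1 j.+1 q.
  apply: in_qpoly_dvd.
  have z : ract del (in_qpoly 'X^n 'X^(i.+1) : trunc_alg K n) = 0.
    apply/ffunP => l; rewrite [LHS]ffunE !ffunE /=; case: eqP => [->|_]; last exact: mul0r.
    by rewrite mul1r in_qpoly_trunc in_qpolyXn_eq0.
  have := congr1 (fun w : M => w j) (yact (in_qpoly 'X^n 'X^(i.+1))).
  rewrite z linear0 [LHS]ffunE [RHS]ffunE /= => E.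
  rewrite in_qpolyM in_qpoly_id E.
  by congr (_ * _); rewrite in_qpoly_trunc.
exists q => //; apply: lam_eq => x.
rewrite trunc_eltE // !end_algM !comp_lfunE !trunc_eltE ?trunc_wd1 //.
have ei : trunc_mul n i.+1 i.+1 1 x = ract del (in_qpoly 'X^n (x i : {poly K}) : trunc_alg K n).
  apply/ffunP => k; rewrite trunc_mulE [RHS]ffunE !ffunE eqSS.
  case: eqP => [/val_inj ->|ki].
    rewrite eqxx (bigD1 i) //= big1 ?addr0 => [|l /andP[/eqP[li] /eqP[]]];
      last exact: val_inj.
    by rewrite !mul1r in_qpoly_trunc.
  case: eqP => [E|_]; first by case: ki; rewrite E.
  by rewrite /= mul0r.
rewrite ei -/f yact; apply/ffunP => k; rewrite !trunc_mulE eqSS.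
case: eqP => // /val_inj ->.
rewrite (bigD1 j) //= big1 ?addr0 => [|l /andP[/eqP[li] /eqP[]]]; last exact: val_inj.
rewrite mul1r (bigD1 i) //= [in RHS]big1 ?addr0 => [|l /andP[/eqP[li] /eqP[]]];
  last exact: val_inj.
rewrite in_qpoly_id ffunE /= in_qpolyM in_qpoly_id.
by congr (_ * _); rewrite in_qpoly_trunc.
Qed.

(** The Peirce decomposition with respect to the e_i reduces the claim to the corners, which
    [aus_corner] describes. *)
Lemma aus_gen_all h : P h.
Proof.
case: (hP) => [P0 PD _ _].
have PS (I : Type) (s : seq I) (F : I -> Lam) : (forall i, P (F i)) ->
    P (\sum_(i <- s) F i).
  move=> PF; elim: s => [|i s IH]; first by rewrite big_nil.
  by rewrite big_cons -[F i]scale1r; apply: PD.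
have -> : h = \sum_(j < n) \sum_(i < n) aus_e K n j.+1 ** h ** aus_e K n i.+1.
  rewrite -{1}[h]amul1r -{1}[h]amul1l -aus_sum_e big_add1 big_mkord /=.
  rewrite (lin_sum (amul_linl _)) (lin_sum (amul_linl _)).
  by apply: eq_bigr => j _; rewrite (lin_sum (amul_linr _)).
apply: (PS) => j; apply: (PS) => i.
by have [q wd ->] := aus_corner h i j; apply: aus_gen_elt.
Qed.
End Closure.

Let X : trunc_alg K n := in_qpoly 'X^n 'X.

Lemma ract_lfun_X_hom : is_rhom (ract_lfun M X).
Proof.
move=> x p; rewrite !ract_lfunE -!ractM; congr (ract x _); exact: mulrC.
Qed.

(* Multiplication by x; it is central because Lambda is K[x]/(x^n)-linear. *)
Definition aus_c : Lam := vsproj (rhoms M M) (ract_lfun M X).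

Lemma aus_cE x : vsval aus_c x = ract x X.
Proof. by rewrite vsprojK ?ract_lfunE //; apply/rhomsP/ract_lfun_X_hom. Qed.

Lemma aus_c_central (g : Lam) : aus_c ** g = g ** aus_c.
Proof.
apply: lam_eq => x; rewrite !end_algM !comp_lfunE !aus_cE.
by have /rhomsP -> := subvsP (g : subvs_of (rhoms M M)).
Qed.

Lemma aus_c_nil : (0 < n)%N -> iter n (amul aus_c) (aone Lam) = 0.
Proof.
move=> n0; have E k x : vsval (iter k (amul aus_c) (aone Lam)) x =
    ract x (in_qpoly 'X^n 'X^k : trunc_alg K n).
  elim: k => [|k IH].
    by rewrite -[iter 0 _ _]/(aone Lam) [vsval _]end_alg1 id_lfunE expr0 in_qpoly1 ract1.
  rewrite iterS [vsval _]end_algM comp_lfunE IH aus_cE -ractM; congr (ract x _).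
  by rewrite exprSr in_qpolyM.
apply: lam_eq => x; rewrite E [RHS](_ : _ = 0 :> M); last exact: zero_lfunE.
(* Here n > 0 matters: for n = 0 the convention on [{poly %/ 'X^0}] would make this class 1. *)
have -> : in_qpoly 'X^n ('X^n : {poly K}) = 0.
  by case: (n) n0 => // m _; rewrite in_qpolyXn_eq0.
exact: ractr0.
Qed.

Lemma aus_c_elt i j q : trunc_wd i j q -> aus_c ** elt i j q = elt i j ('X * q).
Proof.
move=> wd; have wd' : trunc_wd i j ('X * q).
  by rewrite /trunc_wd -mulrA; apply: dvdp_mull.
apply: lam_eq => x; rewrite end_algM comp_lfunE aus_cE !trunc_eltE //.
apply/ffunP => k; rewrite ffunE !trunc_mulE; case: ifP => _; last exact: mul0r.
rewrite /= in_qpoly_trunc mulr_suml; apply: eq_bigr => l _.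
by rewrite -in_qpolyM mulrC mulrA.
Qed.

Lemma aus_ba : (1 < n)%N ->
  aus_b K n n ** aus_a K n n.-1 = aus_c ** aus_e K n n.
Proof.
move=> n1; have E : n.-1.+1 = n by apply/prednK/ltnW.
rewrite aus_c_elt ?trunc_wd1 // /aus_a /aus_b E trunc_elt_mul //.
- by rewrite leq_pred andbT -ltnS E.
- by apply: trunc_wd1; rewrite -{2}E.
by rewrite -{2}E; apply: trunc_wdX.
Qed.

End AuslanderGenerators.

(** * The surjection onto the preprojective algebra *)

Section AuslanderToPreprojective.
Variables (K : fieldType) (n : nat).
Variables (Gam : fdalgebra K) (e a b : nat -> Gam).
Hypothesis hGam : is_preprojective n e a b.
Variable pi : algHom (auslander_alg K n) Gam.
Hypothesis hpi : maps_gens n pi (aus_e K n) (aus_a K n) (aus_b K n) e a b.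
Local Notation Lam := (auslander_alg K n).

Lemma aus_to_preprojective_surj : surj pi.
Proof.
have lpi := linfunE (alghom_lin pi); case: hpi => [he ha hb].
have im x : pi x \in limg (linfun (pi : Lam -> Gam)).
  by apply/mem_limgP; exists x; rewrite lpi.
move=> y; suff /mem_limgP[x <-] : y \in limg (linfun (pi : Lam -> Gam)).
  by exists x; rewrite lpi.
apply: (preprojective_gen hGam).
- by rewrite -(alghom1 pi).
- by move=> _ _ /mem_limgP[u <-] /mem_limgP[v <-]; rewrite !lpi -alghomM.
- by move=> i hi; rewrite -he.
- by move=> i hi; rewrite -ha.
by move=> i hi; rewrite -hb.
Qed.

(** Lambda/(c) satisfies the preprojective relations, since b_n a_(n-1) = c e_n vanishes in it. The
    universal property of Gamma gives g such that g pi is the projection onto Lambda/(c), by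
    comparison on generators; hence ker pi lies in the ideal (c), which is c Lambda as c is
    central. *)
Lemma aus_to_preprojective_ker (x : Lam) : pi x = 0 -> exists y, x = aus_c K n ** y.
Proof.
pose c := aus_c K n; pose q := quot_hom (gen_ideal c).
have q0 y : q y = 0 <-> y \in gen_ideal_vs c.
  by rewrite -[_ \in _](@qproj_eq0 _ _ (gen_ideal c)); split=> /eqP.
have qc y : q (c ** y) = 0.
  by apply/q0; have := mem_gen_ideal c (aone Lam) y; rewrite amul1l.
have rel : preprojective_rel n (q \o aus_e K n) (q \o aus_a K n) (q \o aus_b K n).
  split; first exact/auslander_rel_hom/aus_rel.
  move=> n1; rewrite -(qc (aus_e K n n)) -aus_ba //; exact/esym/alghomM.
case: hGam => _ /(_ _ _ _ _ rel)[g [[ge ga gb] _]]; case: hpi => [he ha hb].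
have gpi : forall y, g (pi y) = q y.
  apply: aus_gen_all; split.
  - by rewrite !(lin0 (alghom_lin _)).
  - by move=> k u v Eu Ev; rewrite !alghom_lin Eu Ev.
  - by move=> u v Eu Ev; rewrite !alghomM Eu Ev.
  by split=> i hi; rewrite ?he ?ha ?hb // ?ge ?ga ?gb.
move=> px; have /q0 : q x = 0 by rewrite -gpi px (lin0 (alghom_lin g)).
have lc : linear (fun y : Lam => c ** y) by exact: amul_linr.
have sub : (gen_ideal_vs c <= limg (linfun (fun y : Lam => c ** y : Lam)))%VS.
  apply: gen_ideal_ind => u v; apply/mem_limgP; exists (u ** v).
  by rewrite linfunE // amulA aus_c_central.
by move=> /(subvP sub)/mem_limgP[y <-]; exists y; rewrite linfunE.
Qed.

End AuslanderToPreprojective.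

Theorem theorem1p3 (K : fieldType) (n : nat) (hn : (0 < n)%N)
    (Gam : fdalgebra K) (e a b : nat -> Gam)
    (hGam : is_preprojective n e a b)
    (pi : algHom (auslander_alg K n) Gam)
    (hpi : maps_gens n pi (aus_e K n) (aus_a K n) (aus_b K n) e a b) :
  bij_on_classes (@stau_tilt K (auslander_alg K n)) (@stau_tilt K Gam)
    (fun U => tensor pi U) /\
  (forall U V : rmodule (auslander_alg K n), stau_tilt U -> stau_tilt V ->
     gen_le U V <-> gen_le (tensor pi U) (tensor pi V)).
Proof.
have piS := aus_to_preprojective_surj hGam hpi.
have cC := @aus_c_central K n; have c_nil := @aus_c_nil K n hn.
have kerpi := aus_to_preprojective_ker hGam hpi.
split; last exact: (tensor_gen_le piS cC c_nil kerpi).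
split; first exact: (tensor_stau_tilt piS cC c_nil kerpi).
  exact: (tensor_iso piS cC c_nil kerpi).
exact: (tensor_stau_tilt_onto piS cC c_nil kerpi).
Qed.
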